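(* Let $\mathfrak H=\mathrm{Gal}\bigl(E/\mathbf Q(\sqrt p,\sqrt{-p})\bigr)$ and let $\delta:\mathfrak H\to\mathrm{GL}(\mathcal S(X,E))$ be the map $\delta(\sigma)=A(\sigma)D(\sigma)$ defined in the context. Then $\delta$ is a $1$-cocycle, i.e. $\delta(\sigma\tau)=\delta(\sigma)\,{}^\sigma\!\delta(\tau)$ for all $\sigma,\tau\in\mathfrak H$, and $${}^\sigma W_\lambda(g)=\delta(\sigma)^{-1}W_\lambda(g)\,\delta(\sigma)\qquad\text{for all } g\in\mathrm{Sp}(V),\ \sigma\in\mathfrak H .$$
   Context: **Local field.** $F$ is a non-archimedean local field with ring of integers $\mathcal O$, residue field of order $q$ and characteristic $p\neq 2$, absolute value $|s|=q^{-v(s)}$. $\lambda$ is a non-trivial continuous unitary character of $F^+$. $d_\lambda t$ is the Haar measure on $F$ self-dual for $\lambda$, i.e. for which the Fourier transform $\mathcal F_\lambda\phi(s)=\int_F\lambda(st)\phi(t)\,d_\lambda t$ satisfies $\mathcal F_\lambda\mathcal F_\lambda\phi(t)=\phi(-t)$ for locally constant compactly supported $\phi$. **Symplectic space.** $V$ is a finite-dimensional $F$-vector space with a non-degenerate alternating form $\langle\ ,\ \rangle$, $V=X\oplus Y$ with $X,Y$ maximal totally isotropic, $x_1,\dots,x_n$ a fixed basis of $X$, and $y_1,\dots,y_n$ the basis of $Y$ with $\langle x_i,y_j\rangle=\delta_{ij}$. $\mathrm{Sp}(V)$ acts on $V$ on the right; products are composed accordingly. Write $g=\begin{pmatrix}a&b\\c&d\end{pmatrix}$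 with $a:X\to X$, $b:X\to Y$, $c:Y\to X$, $d:Y\to Y$, so $xg=xa+xb$, $yg=yc+yd$. Put $Y_g=Y/\ker c$ and $P=\{g\in\mathrm{Sp}(V): Yg=Y\}$. **Measures.** For $0\le i\le n$ let $\tau_i\in\mathrm{Sp}(V)$ be given by $x_j\tau_i=-y_j,\ y_j\tau_i=x_j$ for $j\le i$ and $x_j\tau_i=x_j,\ y_j\tau_i=y_j$ for $j>i$. Identify $Y_{\tau_i}$ with the span of $y_1,\dots,y_i$ and let $\mu_{\lambda,\tau_i}=\prod_{k=1}^i d_\lambda y_k$. If $\dim Y_g=i$, then $g=p_1\tau_ip_2$ for some $p_1,p_2\in P$; $p_1$ induces an isomorphism $\overline{p_1}:Y_g\to Y_{\tau_i}$, and $\mu_{\lambda,g}=|\det(p_1p_2|_Y)|^{-1/2}\,\overline{p_1}\cdot\mu_{\lambda,\tau_i}$, where $(\overline{p_1}\cdot\mu)(O)=\mu(O\overline{p_1})$. It is known that this Haar measure on $Y_g$ is well defined. **Weil operators.** For a subfield $L\subseteq\mathbf C$, $\mathcal S(X,L)$ is the space of locally constant compactly supported functions $X\to L$, and $\mathcal S(X)=\mathcal S(X,\mathbf C)$. For $g\in\mathrm{Sp}(V)$, $\phi\in\mathcal S(X)$, $x\in X$, $$[W_\lambda(g)\phi](x)=\int_{Y_g}\lambda\Bigl(\tfrac{\langle xa,xb\rangle-2\langle xb,yc\rangle+\langle yc,yd\rangle}{2}\Bigr)\phi(xa+yc)\,d\mu_{\lambda,g}y .$$ It is known (Ranga Rao)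 that $W_\lambda$ is a projective representation of $\mathrm{Sp}(V)$ on $\mathcal S(X)$ with $W_\lambda(p_1gp_2)=W_\lambda(p_1)W_\lambda(g)W_\lambda(p_2)$ for $p_1,p_2\in P$. **Galois actions.** $\mathbf Q(\lambda)$ is the field generated over $\mathbf Q$ by the values of $\lambda$, and $E=\mathbf Q(\lambda)(\sqrt{-1})$; the operators $W_\lambda(g)$ preserve $\mathcal S(X,E)$. $\mathrm{Gal}(E/\mathbf Q)$ acts on $\mathcal S(X,E)$ by $(\sigma(\phi))(x)=\sigma(\phi(x))$ and on $\mathrm{End}(\mathcal S(X,E))$ by ${}^\sigma T(\phi)=\sigma(T(\sigma^{-1}(\phi)))$; ${}^\sigma W_\lambda(g)$ means ${}^\sigma(W_\lambda(g))$. Let $\mathcal P$ be the closure of the prime ring of $F$ ($\mathbf Z/p\mathbf Z$ if $\mathrm{char}\,F=p$, $\mathbf Z_p$ if $\mathrm{char}\,F=0$). The image of $\lambda$ is $\nu_p$ (the complex $p$-th roots of unity) resp. the group of all complex $p$-power roots of unity, and $\mathcal P^*\simeq\mathrm{Gal}(\mathbf Q(\lambda)/\mathbf Q)$, $s\mapsto\sigma_s$, where $\sigma_s(\zeta)=\zeta^s$ for $\zeta\in\mathrm{im}\,\lambda$. **The map $\delta$.** Restriction to $\mathbf Q(\lambda)$ identifies $\mathfrak H$ with $\{\sigma_r: r\in(\mathcal P^* )^2\}$. Let $\epsilon\in\mathcal P^*$ be a primitive $(p-1)$-th root of unity, and $U_1=\{1\}$ if $\mathrm{char}\,F=p$, $U_1=1+p\mathbf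 Z_p$ if $\mathrm{char}\,F=0$. Each $\sigma\in\mathfrak H$ has $\sigma|_{\mathbf Q(\lambda)}=\sigma_{\epsilon^{2i}s^2}$ for a unique integer $1\le i\le(p-1)/2$ and a unique $s\in U_1$. Let $\eta\in\mathfrak H$ be the element with $\eta|_{\mathbf Q(\lambda)}=\sigma_{\epsilon^2}$. For $t\in F^*$ let $g_t\in\mathrm{Sp}(V)$ be $(x+y)g_t=t^{-1}x+ty$; put $\iota=g_{-1}$, $\rho_e=\frac12(I+W_\lambda(\iota))$, $\rho_o=\frac12(I-W_\lambda(\iota))$. Fix $u\in\mathbf Q(\nu_p,\sqrt{-1})$ with $N(u)=-1$, $N$ being the norm from $\mathbf Q(\nu_p,\sqrt{-1})$ to $\mathbf Q(\sqrt p,\sqrt{-p})$ (such $u$ exists). For $\sigma$ with associated $(i,s)$, define $D(\sigma)=W_\lambda(g_{\epsilon^is})$, $A(\sigma)=\rho_e+\bigl(\prod_{l=0}^{i-1}\eta^l(u)\bigr)\rho_o$, and $\delta(\sigma)=A(\sigma)D(\sigma)$. *)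

(* Defs.v *)
From HB Require Import structures.
From mathcomp Require Import all_boot all_order all_algebra.
From mathcomp Require Import all_classical all_reals all_analysis.
From mathcomp Require Import complex.
Set Implicit Arguments.
Unset Strict Implicit.
Unset Printing Implicit Defensive.
Import Order.TTheory GRing.Theory Num.Theory.
Import numFieldNormedType.Exports.
Local Open Scope classical_set_scope.
Local Open Scope ring_scope.
Local Open Scope complex_scope.
Local Open Scope quotient_scope.

(* A non-archimedean local field: complete for a discrete absolute value with
   finite residue field of order q, normalised by |s| = q^(-v(s)), v being the
   valuation with value group Z. *)
HB.mixin Record isNonArchLocalField (R : realType) F
    of GRing.Field F & Uniform F := {
  absv : F -> R;
  residue_order : nat;
  absv0 : absv 0 = 0;
  absvM : forall x y : F, absv (x * y) = absv x * absv y;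
  absvD : forall x y : F, absv (x + y) <= Num.max (absv x) (absv y);
  absv_value : forall x : F, x != 0 ->
    exists v : int, absv x = residue_order%:R ^ (- v);
  absv_uniformizer : exists x, absv x = residue_order%:R^-1;
  absv_residue : exists r : 'I_residue_order -> F,
    (forall i, absv (r i) <= 1) /\
    (forall x, absv x <= 1 -> exists! i, absv (x - r i) < 1);
  absv_entourage : @entourage F =
    filter_from [set e : R | 0 < e]
      (fun e => [set xy : F * F | absv (xy.1 - xy.2) < e]);
  local_complete : forall G : set_system F,
    ProperFilter G -> cauchy G -> exists l : F, G --> l
}.

#[short(type="nonArchLocalFieldType")]
HB.structure Definition NonArchLocalField (R : realType) :=
  {F of GRing.Field F & Uniform F & isNonArchLocalField R F}.

HB.instance Definition _ (R : realType) (F : nonArchLocalFieldType R) :=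
  isPointed.Build F 0.

Definition residue_char (R : realType) (F : nonArchLocalFieldType R) (p : nat) :=
  prime p /\ absv (p%:R : F) < 1.

Definition borel (T : ptopologicalType) := g_sigma_algebraType (@open T).

(* The canonical topology of a finite-dimensional vector space; v2r is a linear
   isomorphism onto F^n. *)
Definition fdtop (R : realType) (F : nonArchLocalFieldType R) (U : vectType F)
  : Type := initial_topology (@VectorInternalTheory.v2r F U).

HB.instance Definition _ (R : realType) (F : nonArchLocalFieldType R)
  (U : vectType F) := Topological.on (fdtop U).
HB.instance Definition _ (R : realType) (F : nonArchLocalFieldType R)
  (U : vectType F) := isPointed.Build (fdtop U) (0 : U).

Definition schwartz (R : realType) (T : topologicalType) (L : set R[i])
  : set (T -> R[i]) :=
  [set phi : T -> R[i] | [/\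
                 forall x : T, \forall y \near x, phi y = phi x,
                 compact (closure [set x : T | phi x != 0]) &
                 range phi `<=` L]].

Definition cintegral (R : realType) d (T : measurableType d)
    (mu : set T -> \bar R) (f : T -> R[i]) : R[i] :=
  fine (\int[mu]_t (complex.Re (f t))%:E)%E
    +i* fine (\int[mu]_t (complex.Im (f t))%:E)%E.

Section Character.
Variables (R : realType) (F : nonArchLocalFieldType R).

Definition unitary_character (lam : F -> R[i]) :=
  [/\ forall s t, lam (s + t) = lam s * lam t,
      forall s, `|lam s| = 1 & continuous (lam : F -> R[i]^o)].

Definition haar_measure (mu : {measure set (borel F) -> \bar R}) :=
  [/\ forall (x : F) (A : set F), @measurable _ (borel F) A ->
        mu [set x + a | a in A] = mu A,
      forall K : set F, compact K -> (mu K < +oo)%E &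
      forall U : set F, open U -> U !=set0 -> (0 < mu U)%E].

Definition fourier (lam : F -> R[i]) (mu : {measure set (borel F) -> \bar R})
    (phi : F -> R[i]) : F -> R[i] :=
  fun s => @cintegral R _ (borel F) mu (fun t : F => lam (s * t) * phi t).

Definition self_dual (lam : F -> R[i])
    (mu : {measure set (borel F) -> \bar R}) :=
  forall phi, @schwartz R F setT phi ->
  forall t, fourier lam mu (fourier lam mu phi) t = phi (- t).

(* nu is the product measure on F^i: F being second countable, the Borel sets
   of F^i are generated by the boxes. *)
Definition product_haar (mu : {measure set (borel F) -> \bar R}) (i : nat)
    (nu : {measure set (borel 'rV[F]_i) -> \bar R}) :=
  forall A : 'I_i -> set F, (forall k, @measurable _ (borel F) (A k)) ->
  nu [set t : 'rV[F]_i | forall k, A k (t ord0 k)] = (\prod_(k < i) mu (A k))%E.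

End Character.

Section Symplectic.
Variables (F : fieldType) (V : vectType F).

Definition isotropic (B : V -> V -> F) (U : {vspace V}) :=
  forall v w, v \in U -> w \in U -> B v w = 0.

Definition max_isotropic (B : V -> V -> F) (U : {vspace V}) :=
  isotropic B U /\
  forall U' : {vspace V}, isotropic B U' -> (U <= U')%VS -> U' = U.

End Symplectic.

Record polarized_space (F : fieldType) (V : vectType F) (n : nat) :=
  PolarizedSpace {
  sform : {biscalar V};
  spX : {vspace V};
  spY : {vspace V};
  bX : n.-tuple V;
  bY : n.-tuple V;
  sform_alt : forall v, sform v v = 0;
  sform_nondeg : forall v, (forall w, sform v w = 0) -> v = 0;
  spXY_sum : (spX + spY)%VS = fullv;
  spXY_cap : (spX :&: spY)%VS = 0%VS;
  spX_max : max_isotropic sform spX;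
  spY_max : max_isotropic sform spY;
  bX_basis : basis_of spX bX;
  bY_basis : basis_of spY bY;
  sform_dual : forall i j : 'I_n, sform bX`_i bY`_j = (i == j)%:R
}.

(* Endomorphisms act on the right: v g is written (g v), and the product g h is
   (h \o g)%VF. *)
Section Weil.
Variables (R : realType) (F : nonArchLocalFieldType R) (V : vectType F).
Variables (n : nat) (D : polarized_space V n).
Local Notation C := R[i].
Local Notation X := (spX D).
Local Notation Y := (spY D).
Local Notation "<< v , w >>" := (sform D v w).

Definition Sp : set 'End(V) := [set g | forall v w, <<g v, g w>> = <<v, w>>].

Definition prX : 'End(V) := daddv_pi X Y.
Definition prY : 'End(V) := daddv_pi Y X.

(* The blocks a, b are only meant on X and c, d only on Y. *)
Definition blk_a (g : 'End(V)) : 'End(V) := (prX \o g)%VF.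
Definition blk_b (g : 'End(V)) : 'End(V) := (prY \o g)%VF.
Definition blk_c (g : 'End(V)) : 'End(V) := (prX \o g)%VF.
Definition blk_d (g : 'End(V)) : 'End(V) := (prY \o g)%VF.

Definition parabolic : set 'End(V) := [set g | Sp g /\ (g @: Y)%VS = Y].

Definition ker_c (g : 'End(V)) : {vspace V} := (Y :&: lker (blk_c g))%VS.

Definition mod_ker_c (g : 'End(V)) : rel (fdtop (subvs_of Y)) :=
  fun y1 y2 => vsval (y1 : subvs_of Y) - vsval (y2 : subvs_of Y) \in ker_c g.

Lemma mod_ker_c_refl g : reflexive (mod_ker_c g).
Proof. by move=> y; rewrite /mod_ker_c subrr mem0v. Qed.

Lemma mod_ker_c_sym g : symmetric (mod_ker_c g).
Proof. by move=> y1 y2; rewrite /mod_ker_c -opprB rpredN. Qed.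

Lemma mod_ker_c_trans g : transitive (mod_ker_c g).
Proof.
by move=> y2 y1 y3 h1 h2; rewrite /mod_ker_c -(subrKA (vsval y2)) rpredD.
Qed.

Canonical mod_ker_c_equiv g := EquivRel (mod_ker_c g)
  (@mod_ker_c_refl g) (@mod_ker_c_sym g) (@mod_ker_c_trans g).

Definition Yq (g : 'End(V)) : ptopologicalType :=
  quotient_topology {eq_quot (mod_ker_c g)}.

Definition dim_Yq (g : 'End(V)) : nat := (\dim Y - \dim (ker_c g))%N.

Definition is_tau (i : nat) (t : 'End(V)) := forall j : 'I_n,
  t (bX D)`_j = (if (j < i)%N then - (bY D)`_j else (bX D)`_j) /\
  t (bY D)`_j = (if (j < i)%N then (bX D)`_j else (bY D)`_j).

(* Some (p1, p2) in P x P with g = p1 tau_i p2, where i = dim Y_g. *)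
Definition decomp (g : 'End(V)) : 'End(V) * 'End(V) :=
  xget (\1%VF, \1%VF) [set p | [/\ parabolic p.1, parabolic p.2 &
    exists2 t, is_tau (dim_Yq g) t & g = (p.2 \o (t \o p.1))%VF]].

Definition detY (g : 'End(V)) : F :=
  \det (\matrix_(i < n, j < n) coord (bY D) j (g (bY D)`_i)).

(* The map Y_g -> Y_{tau_i} induced by p1, with Y_{tau_i}, the quotient of Y by
   the span of the y_j for j > i, identified with F^i; the coordinate of y in Y
   along y_k is <<x_k, y>>. *)
Definition p1bar (g p1 : 'End(V)) (i : nat) (w : Yq g) : 'rV[F]_i :=
  \row_(k < i) <<(bX D)`_k, p1 (vsval (repr w : subvs_of Y))>>.

Section Operators.
Variables (lam : F -> C).
Variable muX : forall i, {measure set (borel 'rV[F]_i) -> \bar R}.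

Definition mu_Yq (g : 'End(V)) : set (borel (Yq g)) -> \bar R := fun O =>
  let i := dim_Yq g in let p := decomp g in
  ((Num.sqrt (absv (detY (p.2 \o p.1)%VF)))^-1%:E
     * muX i [set p1bar p.1 i w | w in O])%E.

(* The integrand depends only on the class of y modulo ker c. *)
Definition weil (g : 'End(V)) (phi : subvs_of X -> C) : subvs_of X -> C :=
  fun x0 => @cintegral R _ (borel (Yq g)) (@mu_Yq g) (fun w : Yq g =>
    let x := vsval x0 in
    let y := vsval (repr w : subvs_of Y) in
    let: xa := blk_a g x in let: xb := blk_b g x in
    let: yc := blk_c g y in let: yd := blk_d g y in
    lam ((<<xa, xb>> - 2%:R * <<xb, yc>> + <<yc, yd>>) / 2%:R)
      * phi (vsproj X (xa + yc))).

Definition g_ (t : F) : 'End(V) := t^-1 *: prX + t *: prY.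

Definition rho_e (phi : subvs_of X -> C) : subvs_of X -> C :=
  fun x => 2%:R^-1 * (phi x + weil (g_ (-1)) phi x).
Definition rho_o (phi : subvs_of X -> C) : subvs_of X -> C :=
  fun x => 2%:R^-1 * (phi x - weil (g_ (-1)) phi x).

End Operators.
End Weil.

Section Galois.
Variable R : realType.
Local Notation C := R[i].

Definition is_subfield (L : set C) :=
  [/\ L 1, forall x y, L x -> L y -> L (x - y)
         & forall x y, L x -> L y -> L (x / y)].

Definition field_gen (A : set C) : set C := smallest is_subfield A.

(* An automorphism of L over K is represented by its extension to C by the
   identity outside L, so that equal automorphisms are equal functions. *)
Definition Gal (L K : set C) : set (C -> C) :=
  [set s | [/\ set_bij L L s,
               forall x y, L x -> L y -> s (x + y) = s x + s y,
               forall x y, L x -> L y -> s (x * y) = s x * s y,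
               forall x, K x -> s x = x &
               forall x, ~ L x -> s x = x]].

Definition gal_norm (L K : set C) (u : C) : C :=
  \big[*%R/1]_(s \in Gal L K) s u.

Definition nu_ (p : nat) : set C := [set z | z ^+ p = 1].

Definition quad_field (p : nat) : set C :=
  field_gen [set sqrtC p%:R; sqrtC (- p%:R)].

Definition cyclo_field (p : nat) : set C := field_gen (nu_ p `|` [set 'i]).

Variable F : nonArchLocalFieldType R.

Definition char_field (lam : F -> C) : set C := field_gen (range lam).
Definition Efield (lam : F -> C) : set C :=
  field_gen (char_field lam `|` [set 'i]).

Definition Hgal (p : nat) (lam : F -> C) : set (C -> C) :=
  Gal (Efield lam) (quad_field p).

Definition prime_closure : set F := closure (range (fun m : int => m%:~R : F)).
Definition prime_units : set F :=
  [set s | [/\ s != 0, prime_closure s & prime_closure s^-1]].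

(* When char F = p this is {1}, as p%:R = 0. *)
Definition U1 (p : nat) : set F :=
  [set s | exists2 z, prime_closure z & s = 1 + p%:R * z].

(* zeta^s for zeta a p-power root of unity and s in the closure of the prime
   ring: zeta^m for any integer m congruent to s modulo the order of zeta. *)
Definition zexp (p : nat) (zeta : C) (s : F) : C :=
  xget 1 [set w | exists (m : int) (k : nat),
    [/\ zeta ^+ (p ^ k) = 1,
        exists2 z, prime_closure z & s - m%:~R = (p ^ k)%:R * z &
        w = zeta ^ m]].

(* sigma restricts to sigma_s on Q(lambda); im(lambda) generates Q(lambda). *)
Definition restricts_to (p : nat) (lam : F -> C) (sigma : C -> C) (s : F) :=
  forall t, sigma (lam t) = zexp p (lam t) s.

Variable eps : F.

Definition gal_index (p : nat) (lam : F -> C) (sigma : C -> C) : nat * F :=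
  xget (1%N, 1) [set c | [/\ (1 <= c.1 <= p.-1./2)%N, U1 p c.2 &
    restricts_to p lam sigma (eps ^+ (2 * c.1) * c.2 ^+ 2)]].

Variables (V : vectType F) (n : nat) (D : polarized_space V n).
Variable lam : F -> C.
Variable muX : forall i, {measure set (borel 'rV[F]_i) -> \bar R}.

Local Notation fns := (subvs_of (spX D) -> C).

Definition SXE : set fns := @schwartz R (fdtop (subvs_of (spX D))) (Efield lam).

Definition in_GL (T : fns -> fns) :=
  [/\ set_bij SXE SXE T,
      forall phi psi, SXE phi -> SXE psi ->
        T (fun x => phi x + psi x) = (fun x => T phi x + T psi x) &
      forall c phi, Efield lam c -> SXE phi ->
        T (fun x => c * phi x) = (fun x => c * T phi x)].

Definition op_inv (T : fns -> fns) : fns -> fns :=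
  'pinv_(fun _ _ => 0) SXE T.

Definition gal_conj (sigma : C -> C) (T : fns -> fns) : fns -> fns :=
  fun phi => sigma \o T ('pinv_id (Efield lam) sigma \o phi).

Definition A_op (eta : C -> C) (u : C) (i : nat) (phi : fns) : fns :=
  fun x => rho_e lam muX phi x
    + (\prod_(0 <= l < i) iter l eta u) * rho_o lam muX phi x.

Definition delta (p : nat) (eta : C -> C) (u : C) (sigma : C -> C)
    (phi : fns) : fns :=
  let: (i, s) := gal_index p lam sigma in
  A_op eta u i (weil lam muX (g_ D (eps ^+ i * s)) phi).

End Galois.

(* Main.v *)
Require Import Defs.
From HB Require Import structures.
From mathcomp Require Import all_boot all_order all_algebra all_fingroup all_solvable.
From mathcomp Require Import all_classical all_reals all_analysis.
From mathcomp Require Import complex.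
From mathcomp Require Import measurable_realfun finfield.
From mathcomp Require Import ring lra zify.
Set Implicit Arguments.
Unset Strict Implicit.
Unset Printing Implicit Defensive.
Import Order.TTheory GRing.Theory Num.Theory.
Import numFieldNormedType.Exports.
Import VectorInternalTheory.
Local Open Scope classical_set_scope.
Local Open Scope ring_scope.
Local Open Scope complex_scope.

(** Every integral defining [weil lam muX g phi] is a finite sum: the integrand is
  constant on cosets of a small lattice and vanishes off a large one, so the value
  is a constant of the form sqrt (p ^ k) times a sum of values of [lam] and [phi].
  The constant lies in Q(sqrt p, sqrt (-p)) because self-duality forces the square
  of the volume of the ring of integers to be a power of q.  Hence sigma in H can
  be moved under the sum, where it replaces lam z by lam (t^2 z) with t = eps^i s,
  and the quadratic nature of the phase turns t^2 into the substitution y -> t y,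
  that is into conjugation by D(sigma) = W(g_t).  Both D(sigma) and W(g) preserve
  parity, so the factor A(sigma), a scalar on even and on odd functions, commutes
  with W(g).

  The cocycle relation reduces to c_(i+j) = c_i * eta^i(c_j) for
  c_i = prod_(l < i) eta^l(u).  When i + j exceeds (p-1)/2 the index wraps around,
  and N(u) = -1 matches the sign eps^((p-1)/2) = -1, which acts by the parity
  operator.  That sigma restricts to a square exponent follows from the Gauss sum:
  it lies in Q(sqrt p, sqrt (-p)) and a non-square exponent would change its sign. *)

(** * Balls in a local field *)

(** The obstacle is that sigma is a purely algebraic map, with no continuity, so it can be applied
    to an integral only once the integral is a finite algebraic expression. For this reason local
    constancy and compact support are carried as explicit radii, and one family of sample points
    must serve both an integrand and its conjugate under sigma. The intertwining relation is proved
    in the multiplied-out form delta(sigma) . sigma-W(g) = W(g) . delta(sigma); inverting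
    delta(sigma) then needs W(g) to preserve S(X, E). Local constancy and the field of values are
    visible on the finite sum, but compact support in x comes from cancellation, that is from the
    nontriviality of [lam]. The measure on Y_g enters through a chosen decomposition g = p1 tau_i
    p2. The only fact used about its scalar factor is that its square is zero or a power of q,
    except for g_t with |t| = 1, where the factor is 1. Both characteristics of F are treated at
    once through the closure of the prime ring: when p = 0 in F, congruence modulo p^k with k > 0
    simply becomes equality. *)

Section LocalField.
Variables (R : realType) (F : nonArchLocalFieldType R).
Local Notation q := (@residue_order R F).

Lemma absv_ge0 (x : F) : 0 <= absv x.
Proof.
have [->|/absv_value[v ->]] := eqVneq x 0; first by rewrite absv0.
by rewrite exprz_ge0.
Qed.

(** The class of 0 needs a representative, so q is not 0. If q were 1, every nonzero element would
    have absolute value 1, the single representative would equal every integral element, and 0 would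
    equal 1. *)
Lemma residue_order_gt1 : (1 < q)%N.
Proof.
have [r [r_int r_ex]] := @absv_residue R F.
have h0 : absv (0 : F) <= 1 by rewrite absv0.
have [i0 _] := r_ex 0 h0.
have q0 : (0 < q)%N by apply: leq_ltn_trans (ltn_ord i0).
rewrite ltn_neqAle q0 andbT; apply/negP => /eqP q1.
have abs1 (x : F) : x != 0 -> absv x = 1.
  by move=> /absv_value[v ->]; rewrite -q1 exp1rz.
have key (x : F) : absv x <= 1 -> x = r i0.
  move=> /r_ex[i [xi _]]; have -> : i0 = i.
    by apply: val_inj; case: (i0) (i) => [a ha] [b hb] /=; move: ha hb; rewrite -q1 !ltnS !leqn0 => /eqP-> /eqP->.
  by apply/eqP; rewrite -subr_eq0; apply: contraLR xi => /abs1->; rewrite ltxx.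
have : (1 : F) = 0 by rewrite (key _ h0) (key 1) // abs1 ?oner_neq0.
by move/eqP; rewrite oner_eq0.
Qed.

Let q_gt0 : 0 < q%:R :> R. Proof. by rewrite ltr0n ltnW // residue_order_gt1. Qed.
Let q_neq0 : q%:R != 0 :> R. Proof. by rewrite gt_eqF. Qed.
Let q_gt1 : 1 < q%:R :> R. Proof. by rewrite ltr1n residue_order_gt1. Qed.

Lemma absv_eq0 (x : F) : (absv x == 0) = (x == 0).
Proof.
have [->|x0] := eqVneq x 0; first by rewrite absv0 eqxx.
by have [v ->] := absv_value _ x0; rewrite expfz_eq0 (negPf q_neq0) andbF.
Qed.

Lemma absv1 : absv (1 : F) = 1.
Proof.
have /mulfI : absv (1 : F) != 0 by rewrite absv_eq0 oner_neq0.
by apply; rewrite -absvM !mulr1.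
Qed.

Lemma absvX (x : F) n : absv (x ^+ n) = absv x ^+ n.
Proof. by elim: n => [|n IH]; rewrite ?expr0 ?absv1 // !exprS absvM IH. Qed.

Lemma absv_root_unity (x : F) n : (0 < n)%N -> x ^+ n = 1 -> absv x = 1.
Proof.
move=> n0 /(congr1 absv); rewrite absvX absv1 => /eqP.
by rewrite pexpr_eq1 // ?absv_ge0 // => /eqP.
Qed.

Lemma absvN (x : F) : absv (- x) = absv x.
Proof.
by rewrite -mulN1r absvM (@absv_root_unity (-1) 2) ?mul1r // sqrrN expr1n.
Qed.

Lemma absvV (x : F) : absv x^-1 = (absv x)^-1.
Proof.
have [->|x0] := eqVneq x 0; first by rewrite !(invr0, absv0).
apply: (@mulfI _ (absv x)); first by rewrite absv_eq0.
by rewrite -absvM !mulfV ?absv1 // absv_eq0.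
Qed.

(** The fractional ideal of elements of valuation at least [m]; the ball shrinks as [m] grows. *)
Definition fball (m : int) : set F := [set x | absv x <= q%:R ^ (- m)].

Lemma fball_exp_le (a b : int) : (q%:R ^ (- a) <= q%:R ^ (- b) :> R) = (b <= a).
Proof. by rewrite ler_eXz2l // lerN2. Qed.

Lemma fball0 m : fball m 0.
Proof. by rewrite /fball /= absv0 exprz_ge0 // ltW. Qed.

Lemma fballD m x y : fball m x -> fball m y -> fball m (x + y).
Proof.
rewrite /fball /= => hx hy; apply: le_trans (absvD _ _) _.
by rewrite ge_max hx.
Qed.

Lemma fballN m x : fball m x -> fball m (- x).
Proof. by rewrite /fball /= absvN. Qed.

Lemma fballB m x y : fball m x -> fball m y -> fball m (x - y).
Proof. by move=> hx hy; apply: fballD hx (fballN hy). Qed.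

Lemma fballBC m x y : fball m (x - y) -> fball m (y - x).
Proof. by move=> h; rewrite -opprB; exact: fballN. Qed.

Lemma fballM a b x y : fball a x -> fball b y -> fball (a + b) (x * y).
Proof.
rewrite /fball /= absvM opprD expfzDr // => hx hy.
by apply: ler_pM; rewrite ?absv_ge0.
Qed.

Lemma fball_sub a b x : a <= b -> fball b x -> fball a x.
Proof. by rewrite /fball /= -fball_exp_le => h /le_trans; apply. Qed.

Lemma fball1 : fball 0 1.
Proof. by rewrite /fball /= absv1 oppr0 expr0z. Qed.

Lemma fball0M m x y : fball 0 x -> fball m y -> fball m (x * y).
Proof. by move=> hx hy; rewrite -(add0r m); apply: fballM. Qed.

Lemma fballM0 m x y : fball m x -> fball 0 y -> fball m (x * y).
Proof. by move=> hx hy; rewrite -(addr0 m); apply: fballM. Qed.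

Lemma fball_sum m (I : Type) (s : seq I) (P : pred I) (f : I -> F) :
  (forall i, P i -> fball m (f i)) -> fball m (\sum_(i <- s | P i) f i).
Proof.
move=> h; elim/big_ind : _ => //; [exact: fball0|exact: fballD].
Qed.

Lemma fball_int (n : int) : fball 0 n%:~R.
Proof.
have nat_in (k : nat) : fball 0 k%:R.
  elim: k => [|k IH]; first exact: fball0.
  by rewrite -natr1; apply: fballD => //; exact: fball1.
case: n => n; first exact: nat_in.
by rewrite NegzE mulrNz; apply/fballN/nat_in.
Qed.

Lemma fball_unit (m : int) x y : absv y = 1 -> fball m (y * x) <-> fball m x.
Proof. by move=> y1; rewrite /fball /= absvM y1 mul1r. Qed.

(** The value group is discrete, so an open ball is the next closed ball. *)
Lemma fballS (m : int) x : absv x < q%:R ^ (- m) <-> fball (m + 1) x.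
Proof.
split; last first.
  by rewrite /fball /= => /le_lt_trans; apply; rewrite ltr_eXz2l // ltrN2 ltrDl.
have [->|/absv_value[v vE]] := eqVneq x 0; first by move=> _; exact: fball0.
by rewrite /fball /= vE ltr_eXz2l // ltrN2 fball_exp_le lezD1.
Qed.

Lemma fball_ex x : exists m : int, fball m x.
Proof.
have [->|/absv_value[v vE]] := eqVneq x 0; first by exists 0; exact: fball0.
by exists v; rewrite /fball /= vE.
Qed.

Lemma fball_exP x : exists m : nat, fball (- m%:Z) x.
Proof.
have [m hm] := fball_ex x; exists `|m|%N; apply: fball_sub hm.
by rewrite lerNl abszE; apply: le_trans (ler_norm (- m)) _; rewrite normrN.
Qed.

Lemma exprNz_cvg0 (e : R) : 0 < e -> exists m : nat, (q%:R ^ (- m%:Z) : R) < e.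
Proof.
move=> e0; have e1 : 0 <= e^-1 by rewrite invr_ge0 ltW.
have := archi_boundP e1.
set N := Num.bound _ => hN; exists N.
rewrite -exprnN invf_plt ?posrE ?exprn_gt0 //.
apply: lt_trans hN _; rewrite -natrX ltr_nat ltn_expl ?residue_order_gt1 //.
Qed.

Lemma fball_cap x : (forall m : nat, fball m x) -> x = 0.
Proof.
move=> h; apply/eqP; rewrite -absv_eq0 -[_ == _]negbK; apply/negP => hx.
have : 0 < absv x by rewrite lt_def hx absv_ge0.
by move=> /exprNz_cvg0[m]; rewrite ltNge => /negP; apply; exact: h.
Qed.

Lemma nbhs_fball (x : F) (A : set F) :
  nbhs x A <-> exists m : nat, forall h, fball m h -> A (x + h).
Proof.
rewrite -nbhs_entourageE /nbhs_ /= absv_entourage; split.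
  move=> [E [e /= e0 sE] sA]; have [m hm] := exprNz_cvg0 e0; exists m => h hh.
  apply: sA; apply/xsectionP; apply: sE => /=.
  by rewrite opprD addNKr absvN; exact: le_lt_trans hm.
move=> [m hm]; exists [set xy : F * F | absv (xy.1 - xy.2) < q%:R ^ (- m%:Z)].
  by exists (q%:R ^ (- m%:Z)) => //=; rewrite exprz_gt0.
move=> y /xsectionP /= /ltW hy; rewrite -(subrK x y) addrC; apply: hm.
by apply: fballBC.
Qed.

Lemma uniformizer_ex : exists w : F, forall m : int, absv (w ^ m) = q%:R ^ (- m).
Proof.
have [w hw] := @absv_uniformizer R F; exists w.
have hX (n : nat) : absv (w ^+ n) = q%:R ^- n by rewrite absvX hw exprVn.
case=> n; first by rewrite -exprnP hX -exprnN.
by rewrite NegzE opprK -exprnN absvV hX invrK.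
Qed.

(** A complete system of representatives of [fball a] modulo [fball b]; these are the sample points
    of the finite sums that replace integrals. *)
Definition transv (I : finType) (rho : I -> F) (a b : int) :=
  (forall i, fball a (rho i)) /\
  forall x, fball a x -> exists! i, fball b (x - rho i).

(** Each step appends one more digit of the expansion in the uniformizer. The cardinality is
    recorded because it gives the ratio of the volumes of balls. *)
Lemma transv_ex (a : int) (n : nat) :
  exists (I : finType) (rho : I -> F), #|I| = (q ^ n)%N /\ transv rho a (a + n%:Z).
Proof.
elim: n => [|n [I [rho [cardI [rho_in rho_ex]]]]].
  exists unit, (fun=> 0); split; first by rewrite card_unit.
  split=> [_|x hx]; first exact: fball0.
  by exists tt; split=> [|[]] //; rewrite !subr0.
have [w hw] := uniformizer_ex; set b := a + n%:Z in rho_ex *.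
have b1 : a + n.+1%:Z = b + 1 by rewrite /b -addrA -PoszD addn1.
have ab : a <= b by rewrite lerDl.
have wb0 : w ^ b != 0 by rewrite -absv_eq0 hw expfz_eq0 (negPf q_neq0) andbF.
have [r [r_int r_ex]] := @absv_residue R F.
have r_in i : fball 0 (r i) by rewrite /fball /= oppr0 expr0z.
have wr_in i : fball b (w ^ b * r i) by apply: fballM0 => //; rewrite /fball /= hw.
exists (I * 'I_q)%type, (fun p => rho p.1 + w ^ b * r p.2); split.
  by rewrite card_prod cardI card_ord expnSr.
split=> [[i j]|x hx] /=; first by apply: fballD => //; exact: fball_sub ab _.
have [i [hi iU]] := rho_ex x hx.
have hz : absv ((w ^ b)^-1 * (x - rho i)) <= 1.
  by rewrite absvM absvV hw mulrC ler_pdivrMr ?exprz_gt0 // mul1r.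
have conv j : absv ((w ^ b)^-1 * (x - rho i) - r j) < 1 <->
              fball (b + 1) (x - (rho i + w ^ b * r j)).
  rewrite -fballS.
  have -> : x - (rho i + w ^ b * r j) = w ^ b * ((w ^ b)^-1 * (x - rho i) - r j).
    by rewrite mulrBr mulVKf // opprD addrA.
  by rewrite absvM hw -[X in _ <-> _ < X]mulr1 ltr_pM2l // exprz_gt0.
have [j [hj jU]] := r_ex _ hz.
exists (i, j); rewrite b1; split; first exact/conv.
move=> [i' j'] /= h'; have ii : i = i'.
  apply: iU; rewrite -(subrK (w ^ b * r j') (x - _)) -[X in X + _]addrA -opprD.
  by apply: fballD => //; apply: fball_sub h'; rewrite lerDl.
by rewrite -ii in h' *; rewrite (jU j') //; exact/conv.
Qed.

End LocalField.

(** * The order of the residue field *)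

Local Open Scope classical_set_scope.

(** A separate copy of the index type of the residue classes, so that it can carry the additive
    group structure of the residue field. *)
Definition residue_index (R : realType) (F : nonArchLocalFieldType R) : Type :=
  'I_(@residue_order R F).
HB.instance Definition _ (R : realType) (F : nonArchLocalFieldType R) :=
  Finite.on (residue_index F).

Section Residue.
Variables (R : realType) (F : nonArchLocalFieldType R).
Local Notation q := (@residue_order R F).

Let rcid := cid (@absv_residue R F).
Let r : residue_index F -> F := projT1 rcid.
Let i0 : residue_index F := Ordinal (ltnW (residue_order_gt1 F)).
Let res (x : F) : residue_index F := xget i0 [set i | fball 1 (x - r i)].

Let r_in i : fball 0 (r i).
Proof. by rewrite /fball /= oppr0 expr0z; have [] := projT2 rcid. Qed.

Let r_ex x : fball 0 x -> exists! i, fball 1 (x - r i).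
Proof.
have conv (y : F) : absv y < 1 <-> fball 1 y.
  by rewrite -[X in fball X _](add0r 1) -fballS oppr0 expr0z.
rewrite {1}/fball /= oppr0 expr0z => /(proj2 (projT2 rcid))[i [hi iU]].
by exists i; split=> [|j /conv/iU//]; exact/conv.
Qed.

Let resP x : fball 0 x -> fball 1 (x - r (res x)).
Proof. by move=> /r_ex[i [hi _]]; apply: (@xgetPex _ i0 [set i | fball 1 (x - r i)]); exists i. Qed.

Let res_eq x y : fball 0 x -> fball 0 y -> fball 1 (x - y) -> res x = res y.
Proof.
move=> x0 y0 xy; have [i [_ iU]] := r_ex x0.
rewrite -(iU _ (resP x0)); apply: iU.
by rewrite -(subrK y x) -addrA; apply: fballD => //; exact: resP.
Qed.

Let res_r i : res (r i) = i.
Proof.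
have [j [_ jU]] := r_ex (r_in i).
by rewrite -(jU _ (resP (r_in i))) -(jU i) // subrr; exact: fball0.
Qed.

Let r_res x : fball 0 x -> fball 1 (r (res x) - x).
Proof. by move=> x0; rewrite -opprB; apply/fballN/resP. Qed.

Let add i j := res (r i + r j).
Let opp i := res (- r i).

Let r0D i j : fball 0 (r i + r j). Proof. exact: fballD. Qed.

Let addA : associative add.
Proof.
move=> i j k; apply: res_eq; try by apply: fballD; exact: r_in.
have -> : r i + r (add j k) - (r (add i j) + r k) =
   (r (add j k) - (r j + r k)) - (r (add i j) - (r i + r j)) by ring.
by apply: fballB; exact: r_res.
Qed.

Let add0 : left_id (res 0) add.
Proof.
move=> i; rewrite -[RHS]res_r; apply: res_eq => //; rewrite addrK.
by rewrite -[r _]subr0; apply: r_res; exact: fball0.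
Qed.

Let addN : left_inverse (res 0) opp add.
Proof.
move=> i; apply: res_eq => //; first exact: fball0.
by rewrite subr0 -[r i]opprK; apply: r_res; exact: fballN.
Qed.

HB.instance Definition _ := Finite_isGroup.Build (residue_index F) addA add0 addN.

(** The additive group of the residue field is killed by p, hence is a p-group. This brings square
    roots of powers of q into Q(sqrt p, sqrt (-p)). *)
Lemma residue_order_pow p : residue_char F p -> exists2 f : nat, (0 < f)%N & q = (p ^ f)%N.
Proof.
move=> [p_pr p1].
have pG : (p.-group (setTfor (residue_index F)))%g.
  rewrite -pnat_exponent; apply: (@pnat_dvd _ p); last by rewrite pnat_id.
  apply/exponentP => x _.
  have gX (n : nat) : (x ^+ n)%g = res (r x *+ n).
    elim: n => [|n IH]; first by rewrite expg0 mulr0n.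
    rewrite expgS IH; apply: res_eq => //.
      by rewrite -mulr_natl; apply: fball0M => //; exact: (fball_int _ (Posz _)).
    rewrite mulrS opprD addrACA subrr add0r; apply: r_res.
    by rewrite -mulr_natl; apply: fball0M => //; exact: (fball_int _ (Posz _)).
  rewrite gX; apply: res_eq; last 1 first.
  - rewrite subr0 -mulr_natl; apply: (@fballM0 _ _ 1) => //.
    by rewrite -[X in fball X _](add0r 1) -fballS oppr0 expr0z.
  - by rewrite -mulr_natl; apply: fball0M => //; exact: (fball_int _ (Posz _)).
  - exact: fball0.
have [f] := p_natP pG; rewrite cardsT card_ord => qE.
exists f => //; rewrite lt0n; apply/eqP => f0.
by have := residue_order_gt1 F; rewrite qE f0 expn0.
Qed.

End Residue.

(** * Neighbourhoods and compactness of balls in F, F^d and vector spaces *)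

Section Topology.
Variables (R : realType) (F : nonArchLocalFieldType R).

Lemma ultra_seq T (G : set_system T) (UG : UltraFilter G) (I : eqType) (s : seq I)
    (P : I -> set T) :
  G [set x | exists2 i, i \in s & P i x] -> exists i, G (P i).
Proof.
elim: s => [|i s IH] Gs; first by have [x []] := filter_ex Gs.
have [|GC] := in_ultra_setVsetC (P i) UG; first by exists i.
apply: IH; apply: filterS (filterI Gs GC) => x [[j]].
by rewrite inE => /orP[/eqP->//|js Pj] _; exists j.
Qed.

(** At every radius the ball is a finite union of cosets, so an ultrafilter selects one coset at
    each radius; it is therefore Cauchy and converges by completeness. *)
Lemma fball_compact (m : int) : compact (@fball R F m).
Proof.
rewrite compact_ultra => G UG Gm.
have step (n : nat) : exists x, G [set y | fball (m + n%:Z) (y - x)].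
  have [I [rho [_ [rho_in rho_ex]]]] := transv_ex F m n.
  have [|i Gi] := @ultra_seq _ G UG _ (enum I) (fun i => [set y | fball (m + n%:Z) (y - rho i)]).
    by apply: filterS Gm => x /rho_ex[i [hi _]]; exists i; rewrite ?mem_enum.
  by exists (rho i).
have CG : cauchy G.
  move=> A; rewrite nbhs_simpl absv_entourage => -[e /= e0 sA].
  have [k hk] := exprNz_cvg0 F e0.
  have [x Gx] := step (`|k%:Z - m|%N).
  have hx y z : fball (m + `|k%:Z - m|%N%:Z) (y - x) -> fball (m + `|k%:Z - m|%N%:Z) (z - x) -> A (y, z).
    move=> hy hz; apply: sA => /=.
    have : fball k (y - z).
      have hle : k%:Z <= m + `|k%:Z - m|%N%:Z by rewrite abszE -lerBlDl ler_norm.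
      have -> : y - z = (y - x) - (z - x) by rewrite opprB addrA subrK.
      by apply: fball_sub hle _; apply: fballB.
    by move=> /le_lt_trans; apply.
  exists ([set y | fball (m + `|k%:Z - m|%N%:Z) (y - x)], [set y | fball (m + `|k%:Z - m|%N%:Z) (y - x)]) => /=; last by move=> [y z] [] /= ? ?; exact: hx.
  by split; exact: Gx.
have [l Gl] := local_complete _ _ CG.
exists l; split=> //.
have Gb : G [set y | fball m (y - l)].
  apply: Gl; apply/nbhs_fball; exists `|m|%N => h /= hh.
  by rewrite addrC addKr; apply: fball_sub hh; rewrite abszE ler_norm.
have [y [/= hy hyl]] := filter_ex (filterI Gm Gb).
by rewrite -[l](subKr y); apply: fballB.
Qed.

Definition rball (d : nat) (m : int) : set 'rV[F]_d := [set v | forall k, fball m (v ord0 k)].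

Lemma rballD d m v w : @rball d m v -> rball m w -> rball m (v + w).
Proof. by move=> hv hw k; rewrite mxE; apply: fballD. Qed.

Lemma rballN d m v : @rball d m v -> rball m (- v).
Proof. by move=> hv k; rewrite mxE; apply: fballN. Qed.

Lemma rballB d m v w : @rball d m v -> rball m w -> rball m (v - w).
Proof. by move=> hv hw; apply: rballD hv (rballN hw). Qed.

Lemma rballZ d a b x v : fball a x -> @rball d b v -> rball (a + b) (x *: v).
Proof. by move=> hx hv k; rewrite mxE; apply: fballM. Qed.

Lemma rball_sub d a b v : a <= b -> @rball d b v -> rball a v.
Proof. by move=> ab hv k; apply: fball_sub ab _. Qed.

Lemma rball_exP d (v : 'rV[F]_d) : exists m : nat, rball (- m%:Z) v.
Proof.
have /choice[f hf] k := fball_exP (v ord0 k).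
exists (\max_k f k)%N => k; apply: fball_sub (hf k).
by rewrite lerN2 lez_nat leq_bigmax.
Qed.

Lemma nbhs_rball d (v : 'rV[F]_d) (A : set 'rV[F]_d) :
  nbhs v A <-> exists m : nat, forall h, rball m h -> A (v + h).
Proof.
split=> [[P P_nbhs sA]|[m hm]].
  have /choice[f hf] k : exists m : nat, forall h, fball m h -> P ord0 k (v ord0 k + h).
    exact/nbhs_fball/P_nbhs.
  exists (\max_k f k)%N => h hh; apply: sA => i j.
  rewrite (ord1 i) mxE; apply: hf; apply: fball_sub (hh j).
  by rewrite lez_nat leq_bigmax.
exists (fun i j => [set y | fball m (y - v i j)]) => [i j|w hw].
  apply/nbhs_fball; exists m => h hh.
  by rewrite /= addrC addKr.
by rewrite -(subrK v w) addrC; apply: hm => k; rewrite !mxE; exact: hw.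
Qed.

Lemma rball_compact d (m : int) : compact (@rball d m).
Proof. exact: (@rV_compact F d (fun=> fball m) (fun=> @fball_compact m)). Qed.

Variable U : vectType F.
Local Notation v2r := (@VectorInternalTheory.v2r F U).
Local Notation r2v := (@VectorInternalTheory.r2v F U).

(** This lattice depends on the coordinates [v2r]; by [hom_bounded] a linear map only shifts the
    index by a constant, so the choice is harmless. *)
Definition vball (m : int) : set (fdtop U) := [set v | rball m (v2r v)].

Lemma nbhs_vball (v : fdtop U) (A : set (fdtop U)) :
  nbhs v A <-> exists m : nat, forall h : U, vball m h -> A ((v : U) + h).
Proof.
split=> [[B [[C C_open <-] Cv sBA]]|[m hm]].
  have /nbhs_rball[m hm] : nbhs (v2r v) C by apply: open_nbhs_nbhs.
  by exists m => h hh; apply: sBA => /=; rewrite raddfD; exact: hm.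
have : nbhs (v2r v) [set w | rball m (w - v2r v)].
  by apply/nbhs_rball; exists m => h hh; rewrite /= addrC addKr.
rewrite nbhsE => -[C [C_open Cv] sC].
exists (v2r @^-1` C); split=> //; first by exists C.
move=> w /sC /=; rewrite -linearB => hw.
by have := hm (w - v) hw; rewrite addrC subrK.
Qed.

Lemma vball_compact (m : int) : compact (vball m).
Proof.
have r2v_cont : continuous (r2v : 'rV[F]_(dim U) -> fdtop U).
  apply: continuous_comp_initial => v.
  by move=> A; rewrite /= /nbhs_simpl r2vK => hA; apply: filterS hA => w; rewrite /= r2vK.
have -> : vball m = r2v @` (rball m).
  apply/seteqP; split=> [v hv|_ [w hw <-]].
    by exists (v2r v); rewrite ?VectorInternalTheory.v2rK.
  by rewrite /vball /= VectorInternalTheory.r2vK.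
apply: continuous_compact; last exact: rball_compact.
exact: continuous_subspaceT.
Qed.

End Topology.

Local Open Scope classical_set_scope.

(** * Radius bounds for linear maps and forms; Schwartz functions by radii *)

Section Bounded.
Variables (R : realType) (F : nonArchLocalFieldType R).
Implicit Types (U W : vectType F).

Lemma vballD U m (v w : U) : vball m v -> vball m w -> vball m (v + w).
Proof. by move=> hv hw; rewrite /vball /= raddfD; apply: rballD. Qed.

Lemma vballN U m (v : U) : vball m v -> vball m (- v).
Proof. by move=> hv; rewrite /vball /= raddfN; apply: rballN. Qed.

Lemma vballB U m (v w : U) : vball m v -> vball m w -> vball m (v - w).
Proof. by move=> hv hw; apply: vballD hv (vballN hw). Qed.

Lemma vball_sub U a b (v : U) : a <= b -> vball b v -> vball a v.
Proof. by move=> ab; exact: rball_sub. Qed.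

Lemma vballZ U a b (x : F) (v : U) : fball a x -> vball b v -> vball (a + b) (x *: v).
Proof. by move=> hx hv; rewrite /vball /= linearZ; exact: rballZ. Qed.

Lemma vball_unit U (m : int) (t : F) (v : U) : absv t = 1 -> vball m (t *: v) <-> vball m v.
Proof. by move=> t1; split=> h k; have := h k; rewrite linearZ mxE fball_unit. Qed.

Lemma vball_exP U (v : U) : exists m : nat, vball (- m%:Z) v.
Proof. exact: rball_exP. Qed.

Lemma vect_expand U (v : U) : v = \sum_i v2r v ord0 i *: r2v (delta_mx ord0 i).
Proof.
apply: v2r_inj; rewrite raddf_sum {1}[v2r v]row_sum_delta.
by apply: eq_bigr => i _ /=; rewrite linearZ /= r2vK.
Qed.

Lemma sup_ball (I : finType) (f : I -> F) : exists c : nat, forall i, fball (- c%:Z) (f i).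
Proof.
have /choice[g hg] i := fball_exP (f i).
exists (\max_i g i)%N => i; apply: fball_sub (hg i).
by rewrite lerN2 lez_nat leq_bigmax.
Qed.

Lemma hom_bounded U W (f : 'Hom(U, W)) :
  exists c : nat, forall (m : int) (v : U), vball m v -> vball (m - c%:Z) (f v).
Proof.
pose e i : U := r2v (delta_mx ord0 i).
have [c hc] := @sup_ball _ (fun p : 'I_(dim U) * 'I_(dim W) => v2r (f (e p.1)) ord0 p.2).
exists c => m v hv k; rewrite [v]vect_expand linear_sum raddf_sum summxE.
apply: fball_sum => i _ /=; rewrite !linearZ mxE.
by apply: fballM => //; exact: (hc (i, k)).
Qed.

Lemma form_bounded U (B : {biscalar U}) :
  exists c : nat, forall (a b : int) (v w : U), vball a v -> vball b w ->
    fball (a + b - c%:Z) (B v w).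
Proof.
pose e i : U := r2v (delta_mx ord0 i).
have [c hc] := @sup_ball _ (fun p : 'I_(dim U) * 'I_(dim U) => B (e p.1) (e p.2)).
exists c => a b v w hv hw; rewrite [v]vect_expand [w]vect_expand.
rewrite linear_sumlz; apply: fball_sum => i _.
rewrite linear_sumr; apply: fball_sum => j _.
rewrite linearZl_LR linearZr_LR /= -addrA; apply: fballM => //.
by apply: fballM => //; exact: (hc (i, j)).
Qed.

(** A single number bounds both the lattice of invariance and the support. By [niceat_le] it can be
    enlarged, so finitely many functions share one radius. *)
Definition niceat U (m : nat) (phi : U -> R[i]) :=
  (forall x h, vball m h -> phi (x + h) = phi x) /\
  (forall x, phi x != 0 -> vball (- m%:Z) x).

Lemma niceat_le U (a b : nat) (phi : U -> R[i]) : (a <= b)%N -> niceat a phi -> niceat b phi.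
Proof.
move=> ab [inv supp]; split=> [x h hh|x /supp]; last by apply: vball_sub; rewrite lerN2.
by apply: inv; apply: vball_sub hh.
Qed.

(** Compactness of the support turns the local radii of constancy into a uniform one. Conversely, a
    nice function is supported in a compact ball. *)
Lemma schwartz_nice U (L : set R[i]) (phi : U -> R[i]) :
  @schwartz R (fdtop U) L phi <-> (exists m, niceat m phi) /\ forall x, L (phi x).
Proof.
split=> [[loc cpt rng]|[[m [inv supp]] rng]].
  split; last by move=> x; apply: rng; exists x.
  pose P (i : nat) (x : fdtop U) := vball (- i%:Z) x /\
    forall h : U, vball i h -> phi ((x : U) + h) = phi x.
  have : \forall i \near \oo, closure [set x : fdtop U | phi x != 0] `<=` P i.
    have /compact_near_coveringP := cpt; apply => x _.
    have [a ha] := vball_exP x.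
    have /nbhs_vball[b hb] := loc x.
    exists ([set y : fdtop U | vball (maxn a b) ((y : U) - x)], [set i | (maxn a b <= i)%N]).
      split; last by exists (maxn a b).
      by apply/nbhs_vball; exists (maxn a b) => h hh; rewrite /= addrC addKr.
    move=> [y i] /= [hy]; rewrite geq_max => /andP[ai bi].
    have hyb : vball b ((y : U) - x) by apply: vball_sub hy; rewrite lez_nat leq_maxr.
    have yE : y = x + ((y : U) - x) :> U by rewrite addrC subrK.
    split=> [|h hh].
      rewrite yE; apply: vballD; first by apply: vball_sub ha; rewrite lerN2.
      by apply: vball_sub hyb; apply: le_trans (_ : 0 <= _); rewrite // oppr_le0.
    have := hb _ hyb; rewrite -yE => ->; rewrite yE -addrA; apply: hb.
    by apply: vballD => //; apply: vball_sub hh.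
  move=> [m _ hm]; exists m; have {hm} hm := hm m (leqnn m); split.
    move=> x h hh.
    (* Uniform invariance is known only at points of the support. If [phi x] vanishes but
       [phi (x + h)] does not, invariance at [x + h] under [- h] gives the equality. *)
    have nz_in y : phi y != 0 -> forall h : U, vball m h -> phi (y + h) = phi y.
      by move=> hy; have [|_] := hm y; [exact: subset_closure|].
    have [x0|] := eqVneq (phi x) 0; last by move=> /nz_in ->.
    have [->//|/nz_in hxh] := eqVneq (phi (x + h)) 0.
    by rewrite -(hxh (- h)) ?addrK //; apply: vballN.
  by move=> x hx; have [|+ _] := hm x; [exact: subset_closure|].
split; last by move=> _ [x _ <-].
- move=> x; apply/nbhs_vball; exists m => h; exact: inv.
- apply: (subclosed_compact _ (@vball_compact _ _ _ (- m%:Z))); first exact: closed_closure.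
  move=> x cx; have : nbhs x [set y : fdtop U | vball m ((y : U) - x)].
    by apply/nbhs_vball; exists m => h hh; rewrite /= addrC addKr.
  move=> /cx [y [/= hy hyx]]; have := supp y hy => hy'.
  rewrite -[x](subKr (y : U)); apply: vballB => //.
  by apply: vball_sub hyx; apply: le_trans (_ : 0 <= _); rewrite // oppr_le0.
Qed.

Lemma schwartz_fball (m : nat) : @schwartz R F setT (fun x => (`[< fball m x >])%:R).
Proof.
have inv (k : nat) x h : (m <= k)%N -> fball k h -> fball m (x + h) <-> fball m x.
  move=> mk hh; have {}hh : fball m h by apply: fball_sub hh.
  by split=> hx; [rewrite -[x](addrK h); apply: fballB|apply: fballD].
split=> //.
  move=> x; apply/nbhs_fball; exists m => h hh.
  by congr (nat_of_bool _)%:R; apply: asbool_equiv_eq; exact: inv hh.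
apply: (subclosed_compact _ (@fball_compact _ _ m)); first exact: closed_closure.
move=> x cx; have : nbhs x [set y | fball m (y - x)].
  by apply/nbhs_fball; exists m => h hh; rewrite /= addrC addKr.
move=> /cx [y [/=]]; case: asboolP; rewrite ?eqxx // => hy _ hyx.
by rewrite -[x](subKr y); apply: fballB.
Qed.

End Bounded.

Local Open Scope classical_set_scope.

Lemma borel_open (T : ptopologicalType) (A : set T) : open A -> @measurable _ (borel T) A.
Proof. by move=> oA; apply: sub_sigma_algebra. Qed.

(** * Integrals of step functions and the volume of the integers *)

Section Step.
Context d (T : measurableType d) (R : realType) (nu : {measure set T -> \bar R}).
Variables (I : finType) (A : I -> set T) (m : R).
Hypothesis A_meas : forall i, measurable (A i).
Hypothesis A_disj : forall i j t, A i t -> A j t -> i = j.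
Hypothesis A_vol : forall i, nu (A i) = m%:E.

Lemma integral_step (c : I -> R) (f : T -> R) :
  (forall i t, A i t -> f t = c i) -> (forall t, (forall i, ~ A i t) -> f t = 0) ->
  (\int[nu]_t (f t)%:E = ((\sum_i c i) * m)%:E)%E.
Proof.
move=> f_in f_out.
have A_int i : nu.-integrable [set: T] (fun t => (\1_(A i) t)%:E).
  apply/integrableP; split; first exact/measurable_EFinP/measurable_indic.
  rewrite (eq_integral (fun t => (\1_(A i) t)%:E)); last first.
    by move=> t _; rewrite gee0_abs // lee_fin.
  by rewrite integral_indic // setIT A_vol ltry.
have -> : (fun t => (f t)%:E) = (fun t => \sum_i (c i)%:E * (\1_(A i) t)%:E)%E.
  apply/funext => t; have [[i Ait]|nA] := pselect (exists i, A i t).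
    rewrite (bigD1 i) //= big1 ?adde0 => [|j ji].
      by rewrite indicE mem_set // mule1 (f_in i).
    rewrite indicE memNset ?mule0 // => Ajt.
    by move: ji; rewrite (A_disj Ajt Ait) eqxx.
  rewrite f_out ?big1 // => [i _|i Ai]; last by apply: nA; exists i.
  by rewrite indicE memNset ?mule0 // => Ai; apply: nA; exists i.
rewrite integral_sum //; last by move=> i; apply: integrableZl.
rewrite big_distrl /= -sumEFin; apply: eq_bigr => i _.
by rewrite integralZl // integral_indic // setIT A_vol EFinM.
Qed.

Lemma cintegral_step (c : I -> R[i]) (f : T -> R[i]) :
  (forall i t, A i t -> f t = c i) -> (forall t, (forall i, ~ A i t) -> f t = 0) ->
  cintegral nu f = (\sum_i c i) * m%:C.
Proof.
move=> f_in f_out; rewrite /cintegral.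
rewrite (integral_step (c := fun i => complex.Re (c i))); last 2 first.
- by move=> i t /f_in->.
- by move=> t /f_out->.
rewrite (integral_step (c := fun i => complex.Im (c i))); last 2 first.
- by move=> i t /f_in->.
- by move=> t /f_out->.
rewrite /= (_ : \sum_i c i = (\sum_i complex.Re (c i)) +i* (\sum_i complex.Im (c i))).
  by apply/eqP; rewrite eq_complex /= !mulr0 subr0 add0r !eqxx.
apply/eqP; rewrite eq_complex /=.
rewrite (big_morph (@complex.Re R) (id1 := 0) (op1 := +%R)) //; last by case=> ? ? [? ?].
rewrite (big_morph (@complex.Im R) (id1 := 0) (op1 := +%R)) //; last by case=> ? ? [? ?].
by rewrite !eqxx.
Qed.

End Step.

Section Haar.
Variables (R : realType) (F : nonArchLocalFieldType R).
Variable mu : {measure set (borel F) -> \bar R}.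
Hypothesis mu_haar : haar_measure mu.
Local Notation q := (@residue_order R F).

Lemma ball_open (x : F) (m : int) : open [set y | fball m (y - x)].
Proof.
rewrite openE => y /= hy; apply/nbhs_fball; exists `|m|%N => h hh /=.
rewrite addrAC; apply: fballD => //; apply: fball_sub hh.
by rewrite abszE ler_norm.
Qed.

Definition vol (m : int) : R := fine (mu (fball m)).

Lemma mu_fball (m : int) : mu (fball m) = (vol m)%:E.
Proof.
have [_ h _] := mu_haar; rewrite /vol fineK // ge0_fin_numE; first exact/h/fball_compact.
exact: measure_ge0.
Qed.

Lemma mu_ball (x : F) (m : int) : mu [set y | fball m (y - x)] = (vol m)%:E.
Proof.
have [h _ _] := mu_haar; rewrite -mu_fball.
have <- := h x (fball m); last first.
  by apply: (@borel_open F); have := @ball_open 0 m; under eq_set do rewrite subr0.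
congr (mu _); apply/seteqP; split=> [y hy|_ [y hy <-]] /=.
  by exists (y - x) => //; rewrite addrC subrK.
by rewrite addrC addKr.
Qed.

Lemma cintegral_transv (I : finType) (rho : I -> F) (a b : int) (f : F -> R[i]) :
  transv rho a b ->
  (forall x h, fball b h -> f (x + h) = f x) -> (forall x, ~ fball a x -> f x = 0) -> a <= b ->
  @cintegral R _ (borel F) mu f = (\sum_i f (rho i)) * (vol b)%:C.
Proof.
move=> [rho_in rho_ex] f_inv f_out ab.
have r_in i t : fball b (t - rho i) -> fball a t.
  by move=> hi; rewrite -[t](subrK (rho i)); apply: fballD => //; apply: fball_sub hi.
apply: (@cintegral_step _ (borel F) R mu I (fun i => [set y : F | fball b (y - rho i)]) (vol b) _ _ _ (fun i => f (rho i)) f).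
- by move=> i; apply: (@borel_open F); exact: ball_open.
- by move=> i j t /= hi hj; have [k [_ kU]] := rho_ex t (r_in _ _ hi); rewrite -(kU i) // (kU j).
- by move=> i; exact: mu_ball.
- by move=> i t /= hi; rewrite -[t](subrK (rho i)) addrC f_inv.
- by move=> t ht; apply: f_out => /rho_ex[i [hi _]]; exact: (ht i).
Qed.

Lemma cintegral_fball (m : int) (c : R[i]) :
  @cintegral R _ (borel F) mu (fun x : F => c * (`[< fball m x >])%:R) = c * (vol m)%:C.
Proof.
transitivity ((\sum_(i : unit) c) * (vol m)%:C); last by rewrite big_const card_unit /= addr0.
apply: (@cintegral_step _ (borel F) R mu unit (fun=> fball m : set F) (vol m) _ _ _ (fun=> c)).
- move=> _; apply: (@borel_open F).
  by have := @ball_open 0 m; under eq_set do rewrite subr0.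
- by move=> [] [].
- by move=> _; exact: mu_fball.
- by move=> _ t h; case: asboolP => //; rewrite mulr1.
- by move=> t ht; case: asboolP => [/(ht tt)//|_]; rewrite mulr0.
Qed.

Lemma volS (m : int) (n : nat) : vol m = q%:R ^+ n * vol (m + n%:Z).
Proof.
have [I [rho [cI rhoT]]] := transv_ex F m n.
have mn : m <= m + n%:Z by rewrite lerDl.
have := cintegral_transv (f := fun x => 1 * (`[< fball m x >])%:R) rhoT.
have inv (x h : F) : fball m h -> fball m (x + h) <-> fball m x.
  by move=> hh; split=> hx; [rewrite -[x](addrK h); apply: fballB|apply: fballD].
rewrite cintegral_fball mul1r => h.
have {}h := h _ _ mn.
have /(congr1 (@complex.Re R)) : (vol m)%:C = (q ^ n)%:R%:C * (vol (m + n%:Z))%:C.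
  rewrite h.
  - rewrite (eq_bigr (fun=> 1)) => [|i _]; last by rewrite mul1r; case: asboolP => // -[]; case: rhoT.
    by rewrite sumr_const cI rmorph_nat.
  - move=> x k hk; congr (_ * (nat_of_bool _)%:R); apply: asbool_equiv_eq; apply: inv.
    by apply: fball_sub hk.
  - by move=> x hx; case: asboolP => //; rewrite mulr0.
by rewrite -rmorphM /= natrX.
Qed.

Lemma volE (m : int) : vol m = q%:R ^ (- m) * vol 0.
Proof.
have q0 : q%:R != 0 :> R by rewrite pnatr_eq0 -lt0n ltnW ?residue_order_gt1.
case: m => n; first by rewrite (volS 0 n) add0r -exprnN mulKf ?expf_neq0.
by rewrite NegzE opprK (volS _ n.+1) addNr.
Qed.

End Haar.

(** * Conductor of the character and the self-dual volume *)

Section Char.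
Variables (R : realType) (F : nonArchLocalFieldType R) (lam : F -> R[i]).
Hypothesis lam_char : unitary_character lam.
Local Notation q := (@residue_order R F).

Lemma lamD s t : lam (s + t) = lam s * lam t. Proof. by case: lam_char. Qed.

Lemma lam_neq0 s : lam s != 0.
Proof. by case: lam_char => _ h _; rewrite -normr_eq0 h oner_neq0. Qed.

Lemma lam0 : lam 0 = 1.
Proof. by apply: (mulfI (lam_neq0 0)); rewrite -lamD addr0 mulr1. Qed.

Lemma lamN s : lam (- s) = (lam s)^-1.
Proof. by apply: (mulfI (lam_neq0 s)); rewrite -lamD subrr lam0 mulfV ?lam_neq0. Qed.

Lemma lamMn s n : lam (s *+ n) = lam s ^+ n.
Proof. by elim: n => [|n IH]; rewrite ?mulr0n ?lam0 // mulrS lamD IH exprS. Qed.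

Lemma lamMz s (n : int) : lam (n%:~R * s) = lam s ^ n.
Proof.
case: n => n; first by rewrite -[n%:~R]/(n%:R) mulr_natl lamMn.
by rewrite NegzE mulrNz mulNr lamN -[n.+1%:~R]/(n.+1%:R) mulr_natl lamMn exprnN.
Qed.

(** The circle has no small subgroups: if |y - 1| < 1/2 then |y^2 - 1| = |y - 1| |y + 1| is at least
    3/2 |y - 1|, so repeated squaring would push the powers away from 1. The linear lower bound
    [lin] already contradicts the archimedean property. *)
Lemma small_powers_eq1 (z : R[i]) : (forall n, `|z ^+ n - 1| < 2%:R^-1) -> z = 1.
Proof.
move=> hz; pose w k : R := complex.Re `|z ^+ (2 ^ k) - 1|.
have wE k : `|z ^+ (2 ^ k) - 1| = (w k)%:C by rewrite /w normc_def.
have w0 k : 0 <= w k by rewrite -lecR -wE normr_ge0.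
have grow k : w k * (1 + 2%:R^-1) <= w k.+1.
  rewrite -lecR -wE expnS mulnC exprM -[1 in X in _ <= X](expr1n _ 2) subr_sqr.
  rewrite normrM wE rmorphM; apply: ler_wpM2l; first by rewrite lecR w0.
  have := hz (2 ^ k)%N; set y := z ^+ _ => hy.
  have : `|2%:R : R[i]| <= `|y + 1| + `|y - 1|.
    rewrite -[X in _ + X]normrN; apply: le_trans (ler_normD _ _); rewrite (_ : _ + _ = 2%:R) //; ring.
  rewrite normr_nat => h. rewrite rmorphD /= rmorph1 rmorphV ?unitfE ?pnatr_eq0 // rmorph_nat.
  rewrite -(lerD2r `|y - 1|); apply: (le_trans _ h).
  apply: (@le_trans _ _ ((1 + 2%:R^-1) + 2%:R^-1)); first by rewrite lerD2l ltW.
  by rewrite [X in X <= _](_ : _ = 2%:R) //; field.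
have lin k : w 0 * (1 + k%:R / 2%:R) <= w k.
  elim: k => [|k IH]; first by rewrite mul0r addr0 mulr1.
  apply: le_trans (grow k); rewrite -natr1.
  have k0 : 0 <= k%:R :> R by [].
  have -> : w 0%N * (1 + (k%:R + 1) / 2%:R) = w 0%N * (1 + k%:R / 2%:R) + w 0%N / 2%:R.
    by rewrite mulrDl mul1r addrA mulrDr.
  rewrite [leRHS]mulrDr mulr1; apply: lerD => //; rewrite ler_pM2r ?invr_gt0 //.
  by apply: le_trans IH; rewrite ler_peMr // lerDl divr_ge0.
have w_lt k : w k < 2%:R^-1.
  by rewrite -ltcR -wE rmorphV ?unitfE ?pnatr_eq0 // rmorph_nat.
apply/eqP; rewrite -subr_eq0 -normr_eq0 -[z]expr1 (wE 0); apply/eqP; congr (_%:C).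
apply/eqP; rewrite eq_le w0 andbT leNgt; apply/negP => wp.
have /archi_boundP : 0 <= (w 0)^-1 by rewrite invr_ge0.
set N := Num.bound _ => hN;
have : w 0 * (N%:R / 2%:R) < 2%:R^-1.
  by apply: le_lt_trans (w_lt N); apply: le_trans (lin N); rewrite ler_wpM2l // lerDr.
rewrite mulrA gtr_pMl ?invr_gt0 // ltNge => /negP; apply; apply: ltW.
by rewrite mulrC -ltr_pdivrMr // div1r.
Qed.

(** Balls are additive groups, so all powers of [lam x] stay near 1 once x lies in a small ball. *)
Lemma lam_trivial_nbhs : exists k : nat, forall x, fball k x -> lam x = 1.
Proof.
case: lam_char => _ _ lam_cont.
have : nbhs (lam 0 : R[i]^o) (ball (lam 0 : R[i]^o) (2%:R^-1)).
  by apply: nbhsx_ballx; rewrite invr_gt0.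
move=> /(lam_cont 0); have : ball (lam 0 : R[i]^o) 2%:R^-1 `<=` [set z | `|lam 0 - z| < 2%:R^-1] by [].
move: (ball _ _) => B sB lam_near.
have /nbhs_fball[k hk] : nbhs (0 : F) (fun x => B (lam x)) by exact: lam_near.
exists k => x hx; apply: small_powers_eq1 => n.
have : B (lam (x *+ n)); last by move=> /sB /=; rewrite lam0 lamMn distrC.
rewrite -[_ *+ _]add0r; apply: hk.
by rewrite -mulr_natl; apply: fball0M => //; exact: (fball_int _ (Posz _)).
Qed.

Hypothesis lam_nontriv : exists t, lam t <> 1.

(** The condition on [s] is inherited by every element of smaller absolute value, because the
    quotient is integral. It holds on a small ball, and it fails on a ball containing [t0], as
    [t = 1] shows; the minimal exponent is the conductor. *)
Lemma lam_conductor : exists c : int, forall s,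
  (forall t, fball 0 t -> lam (s * t) = 1) <-> fball c s.
Proof.
have [k hk] := lam_trivial_nbhs; have [t0 ht0] := lam_nontriv.
have [M hM] := fball_exP t0.
pose S s := forall t, fball 0 t -> lam (s * t) = 1.
pose P (n : nat) := `[< forall s, fball (- M%:Z + n%:Z) s -> S s >].
have exP : exists n, P n.
  exists (M + k)%N; apply/asboolP => s hs t ht; apply: hk.
  by apply: fballM0 ht; rewrite PoszD addKr in hs.
case: (ex_minnP exP) => n /asboolP Pn nmin.
exists (- M%:Z + n%:Z) => s; split=> [Ss|]; last exact: Pn.
apply: contrapT => hs; case: n Pn nmin hs => [|n] Pn nmin hs.
  apply: ht0; rewrite -[t0]mulr1; apply: Pn; last exact: fball1.
  by apply: fball_sub hM; rewrite addr0.
have /nmin : P n; last by rewrite ltnn.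
apply/asboolP => s' hs' t ht.
have s0 : s != 0 by apply: contra_not_neq hs => ->; exact: fball0.
have hle : absv s' <= absv s.
  apply: le_trans hs' _; rewrite leNgt; apply/negP => /fballS.
  by rewrite -addrA -PoszD addn1.
have -> : s' * t = s * (s^-1 * s' * t) by rewrite -mulrA mulVKf.
apply: Ss; apply: fball0M ht.
by rewrite /fball /= oppr0 expr0z absvM absvV mulrC ler_pdivrMr ?mul1r // lt_def absv_eq0 s0 absv_ge0.
Qed.

Variable mu : {measure set (borel F) -> \bar R}.
Hypothesis mu_haar : haar_measure mu.
Hypothesis mu_dual : self_dual lam mu.

Lemma transv_shift (I : finType) (rho : I -> F) (a b : int) t :
  transv rho a b -> fball a t -> transv (fun i => rho i + t) a b.
Proof.
move=> [rho_in rho_ex] ht; split=> [i|x hx]; first exact: fballD.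
have [i [hi iU]] := rho_ex (x - t) (fballB hx ht).
exists i; split=> [|j hj]; first by rewrite opprD addrA addrAC.
by apply: iU; move: hj; rewrite opprD addrA addrAC.
Qed.

(** Orthogonality of characters: if [lam (s * t0)] differs from 1 for some integral [t0], shifting
    the representatives by [t0] multiplies the sum by that value, which forces it to vanish. *)
Lemma fourier_fball0 s : fourier lam mu (fun x => (`[< fball 0 x >])%:R) s =
  (vol mu 0)%:C * (`[< forall t, fball 0 t -> lam (s * t) = 1 >])%:R.
Proof.
have [k hk] := lam_trivial_nbhs; have [M hM] := fball_exP s.
have [I [rho [_ rhoT]]] := transv_ex F 0 (k + M); rewrite add0r in rhoT.
have inv (x h : F) : fball 0 h -> fball 0 (x + h) <-> fball 0 x.
  by move=> hh; split=> hx; [rewrite -[x](addrK h); apply: fballB|apply: fballD].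
(* Stated for any representatives, since it is used for the one-point family, for [rho], and for
   [rho] shifted by [t0]. *)
have sumE (J : finType) (tau : J -> F) b : transv tau 0 b%:Z ->
   (forall h, fball b%:Z h -> lam (s * h) = 1) ->
   fourier lam mu (fun x => (`[< fball 0 x >])%:R) s = (\sum_i lam (s * tau i)) * (vol mu b)%:C.
  move=> tauT hb; rewrite /fourier (cintegral_transv mu_haar tauT); last 3 first.
  - move=> x h hh; rewrite mulrDr lamD (hb h) // mulr1.
    congr (_ * (nat_of_bool _)%:R); apply: asbool_equiv_eq; apply: inv.
    by apply: fball_sub hh.
  - by move=> x hx; case: asboolP => // _; rewrite mulr0.
  - by [].
  case: tauT => tau_in _; congr (_ * _); apply: eq_bigr => i _.
  by case: asboolP => [_|[]]; rewrite ?mulr1 //; exact: tau_in.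
have hb h : fball (k + M)%N%:Z h -> lam (s * h) = 1.
  move=> hh; apply: hk; have -> : k%:Z = - M%:Z + (k + M)%N%:Z by rewrite PoszD addrC addrK.
  exact: fballM.
case: asboolP => [s1|/existsNP[t0 /not_implyP[t0_in /eqP t0_1]]].
  rewrite (sumE unit (fun=> 0) 0%N) //.
  - by rewrite big_const card_unit /= addr0 mulr0 lam0 mulr1 mul1r.
  - split=> [_|x hx]; first exact: fball0.
    by exists tt; split=> [|[]] //; rewrite subr0.
rewrite mulr0; have E1 := sumE _ _ _ rhoT hb.
have := sumE _ _ _ (transv_shift rhoT t0_in) hb.
under eq_bigr do rewrite mulrDr lamD.
rewrite -mulr_suml mulrAC -E1 => /eqP.
rewrite -subr_eq0 -[X in X - _]mulr1 -mulrBr mulf_eq0 => /orP[/eqP//|].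
by rewrite subr_eq0 eq_sym (negPf t0_1).
Qed.

(** Fourier inversion at 0 for the indicator of the ring of integers says that the volumes of
    [fball 0] and of its dual lattice [fball c] have product 1, and they differ by the factor
    q^c. *)
Lemma vol_sq : exists c : int, vol mu 0 ^+ 2 = q%:R ^ c.
Proof.
have q0 : q%:R != 0 :> R by rewrite pnatr_eq0 -lt0n ltnW ?residue_order_gt1.
have [c hc] := lam_conductor; exists c.
have := mu_dual (schwartz_fball F 0) 0.
rewrite {1}/fourier (_ : (fun _ => _) = (fun t => (vol mu 0)%:C * (`[< fball c t >])%:R)); last first.
  apply/funext => t; rewrite mul0r lam0 // mul1r fourier_fball0.
  by congr (_ * (nat_of_bool _)%:R); apply: asbool_equiv_eq; exact: hc.
rewrite cintegral_fball // oppr0; case: asboolP => [_|[]]; last exact: fball0.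
rewrite -rmorphM => /(congr1 (@complex.Re R)) /=.
rewrite (volE mu_haar c) mulrCA -expr2 => h.
by rewrite -[LHS](mulKf (_ : q%:R ^ (- c) != 0)) ?expfz_neq0 // h mulr1 invr_expz opprK.
Qed.

End Char.

Local Open Scope classical_set_scope.

(** * The closure of the prime ring *)

Section PrimeClosure.
Variables (R : realType) (F : nonArchLocalFieldType R) (p : nat).
Hypothesis p_res : residue_char F p.
Local Notation Zp := (@prime_closure R F).

Let p_pr : prime p. Proof. by case: p_res. Qed.

Lemma ZpP s : Zp s <-> forall k : nat, exists m : int, fball k (s - m%:~R).
Proof.
split=> [hs k|hs A /nbhs_fball[k hk]].
  have : nbhs s [set y | fball k (y - s)].
    by apply/nbhs_fball; exists k => h hh; rewrite /= addrC addKr.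
  by move=> /hs[_ [[m _ <-] /= hm]]; exists m; exact: fballBC.
have [m hm] := hs k; exists m%:~R; split; first by exists m.
by rewrite -[m%:~R](subrKC s); apply: hk; exact: fballBC.
Qed.

Lemma Zp_int (m : int) : Zp m%:~R.
Proof. by apply/ZpP => k; exists m; rewrite subrr; exact: fball0. Qed.

Lemma Zp_fball0 s : Zp s -> fball 0 s.
Proof.
move=> /ZpP /(_ 0%N)[m hm]; rewrite -[s](subrK m%:~R).
by apply: (fballD _ (fball_int _ _)).
Qed.

Lemma ZpB s t : Zp s -> Zp t -> Zp (s - t).
Proof.
move=> /ZpP hs /ZpP ht; apply/ZpP => k; have [m hm] := hs k; have [n hn] := ht k.
exists (m - n); have -> : s - t - (m - n)%:~R = (s - m%:~R) - (t - n%:~R) by rewrite rmorphB /=; ring.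
exact: fballB.
Qed.

Lemma Zp0 : Zp 0. Proof. by have := @Zp_int 0; rewrite mulr0z. Qed.
Lemma Zp1 : Zp 1. Proof. by have := @Zp_int 1; rewrite mulr1z. Qed.

Lemma ZpD s t : Zp s -> Zp t -> Zp (s + t).
Proof.
by move=> hs ht; rewrite -[t]opprK; apply: ZpB => //; rewrite -sub0r; apply: ZpB => //; exact: Zp0.
Qed.

Lemma ZpM s t : Zp s -> Zp t -> Zp (s * t).
Proof.
move=> hs ht; apply/ZpP => k.
have [m hm] := (ZpP s).1 hs k; have [n hn] := (ZpP t).1 ht k.
exists (m * n); rewrite rmorphM /=.
have -> : s * t - m%:~R * n%:~R = (s - m%:~R) * t + m%:~R * (t - n%:~R) by ring.
apply: fballD; first by apply: fballM0 => //; exact: Zp_fball0.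
by apply: fball0M => //; exact: fball_int.
Qed.

Lemma ZpX s n : Zp s -> Zp (s ^+ n).
Proof. by move=> hs; elim: n => [|n IH]; [exact: Zp1|rewrite exprS; exact: ZpM]. Qed.

Lemma fball1_p : fball 1 (p%:R : F).
Proof. by rewrite -[X in fball X _](add0r 1) -fballS oppr0 expr0z; case: p_res. Qed.

Lemma fball_pX k : fball k%:Z (p%:R ^+ k : F).
Proof.
elim: k => [|k IH]; first exact: fball1.
by rewrite exprSr -addn1 PoszD; apply: fballM => //; exact: fball1_p.
Qed.

Lemma fball1_1 : ~ fball 1 (1 : F).
Proof. by rewrite -[X in fball X _](add0r 1) -fballS absv1 oppr0 expr0z ltxx. Qed.

Lemma fball1_int (n : int) : fball 1 (n%:~R : F) <-> (p %| n)%Z.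
Proof.
split=> [hn|/dvdzP[m ->]]; last first.
  by rewrite rmorphM /=; apply: (@fball0M _ _ 1); [exact: fball_int|exact: fball1_p].
apply: contrapT => /negP pn.
have : coprimez p n by rewrite coprimezE prime_coprime // -dvdzE.
move=> /coprimezP[[u v] /= uv]; apply: fball1_1.
have <- : (u * p + v * n)%:~R = 1 :> F by rewrite uv.
rewrite rmorphD !rmorphM /=; apply: fballD.
  by apply: (@fball0M _ _ 1); [exact: fball_int|exact: fball1_p].
by apply: (@fball0M _ _ 1) => //; exact: fball_int.
Qed.

Lemma fball_int_dvd (n : int) k : p%:R != 0 :> F ->
  absv (n%:~R : F) <= absv (p%:R ^+ k : F) -> ((p ^ k)%N %| n)%Z.
Proof.
move=> p0; elim: k n => [|k IH] n hn; first by rewrite expn0 dvd1z.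
have /IH/dvdzP[m mE] : absv (n%:~R : F) <= absv (p%:R ^+ k : F).
  apply: le_trans hn _; rewrite exprS absvM ler_piMl ?absv_ge0 // ltW //.
  by case: p_res.
move: hn; rewrite mE rmorphM /= exprS mulrC !absvM -pmulrn natrX.
rewrite [absv p%:R * _]mulrC ler_pM2l; last first.
  by rewrite lt_def absv_ge0 absv_eq0 expf_neq0.
move=> hm; have /fball1_int/dvdzP[m' ->] : fball 1 (m%:~R : F) by apply: le_trans hm fball1_p.
by rewrite -mulrA expnS PoszM dvdz_mull.
Qed.

(** If p = 0 in F, integers that agree modulo the maximal ideal are equal in F, so [s] is itself an
    integer. Otherwise close integer approximations of [s] differ by multiples of p^k, and the
    quotients of these differences converge to [z]. *)
Lemma Zp_approx s (k : nat) : Zp s ->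
  exists (m : int) (z : F), Zp z /\ s - m%:~R = (p ^ k)%:R * z.
Proof.
move=> hs; rewrite natrX; have [p0|p0] := eqVneq (p%:R : F) 0.
  have [m hm] := (ZpP s).1 hs 1%N; exists m, 0; split; first exact: Zp0.
  rewrite mulr0; apply: fball_cap => j.
  have [m' hm'] := (ZpP s).1 hs (maxn j 1).
  have hm1 : fball 1 (s - m'%:~R) by apply: fball_sub hm'; rewrite lez_nat leq_maxr.
  have : fball 1 ((m' - m)%:~R : F).
    by rewrite rmorphB /= -[X in fball _ X](subrKA s) -opprB; apply: fballD (fballN hm1) hm.
  move=> /fball1_int/dvdzP[c cE].
  have : (m' - m)%:~R = 0 :> F by rewrite cE rmorphM /= -[p%:~R]/(p%:R) p0 mulr0.
  rewrite rmorphB /= => /eqP; rewrite subr_eq0 => /eqP mm.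
  by rewrite -mm; apply: fball_sub hm'; rewrite lez_nat leq_maxl.
have pk0 : p%:R ^+ k != 0 :> F by rewrite expf_neq0.
(* Precision [N] is what makes two integer approximations of [s] congruent modulo p^k. *)
have [N hN] := fball_exP (p%:R ^+ k : F)^-1.
have [m hm] := (ZpP s).1 hs N; exists m, ((p%:R ^+ k)^-1 * (s - m%:~R)).
split; last by rewrite mulVKf.
apply/ZpP => j; have [m' hm'] := (ZpP s).1 hs (N + j)%N.
have /dvdzP[c cE] : ((p ^ k)%N %| m' - m)%Z.
  apply: fball_int_dvd => //.
  have : fball N ((m' - m)%:~R : F).
    rewrite rmorphB /= -[X in fball _ X](subrKA s) -opprB; apply: (fballD _ hm).
    by apply/fballN; apply: fball_sub hm'; rewrite lez_nat leq_addr.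
  move=> /(fballM hN); rewrite addNr /fball /= oppr0 expr0z absvM absvV mulrC.
  by rewrite ler_pdivrMr ?mul1r // lt_def absv_ge0 absv_eq0 pk0.
exists c; have -> : (p%:R ^+ k)^-1 * (s - m%:~R) - c%:~R = (p%:R ^+ k)^-1 * (s - m'%:~R).
  apply: (mulfI pk0); rewrite mulrBr !mulVKf //.
  have : (m' - m)%:~R = p%:R ^+ k * c%:~R :> F.
    by rewrite cE rmorphM /= mulrC -pmulrn natrX.
  by rewrite rmorphB /= => <-; ring.
by have := fballM hN hm'; rewrite PoszD addKr.
Qed.

Lemma Zp_near_int s : Zp s -> forall m : int, fball 1 (s - m%:~R) ->
  exists2 z, Zp z & s = m%:~R + p%:R * z.
Proof.
move=> hs m hm; have [n [z [hz]]] := Zp_approx 1 hs; rewrite expn1 => sE.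
have /fball1_int/dvdzP[c cE] : fball 1 ((n - m)%:~R : F).
  rewrite rmorphB /= -[X in fball _ X](subrKA s) -[n%:~R - s]opprB sE.
  apply: (fballD _ hm); apply: fballN; apply: (@fballM0 _ _ 1); first exact: fball1_p.
  exact: Zp_fball0.
exists (c%:~R + z); first by apply: ZpD => //; exact: Zp_int.
have <- : s - n%:~R + (n - m)%:~R + m%:~R = s by rewrite rmorphB /=; ring.
by rewrite sE cE rmorphM /=; ring.
Qed.

(* This rests on the compactness of the closure of the prime ring: the third hypothesis
   says that each condition is closed. *)
Lemma Zp_nested (P : nat -> F -> Prop) :
  (forall k, exists2 s, Zp s & P k s) -> (forall k s, P k.+1 s -> P k s) ->
  (forall k s, ~ P k s -> exists j : nat, forall h, fball j h -> ~ P k (s + h)) ->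
  exists2 s, Zp s & forall k, P k s.
Proof.
move=> P_ex P_dec P_closed; apply: contrapT => nP.
have P_le k j s : (k <= j)%N -> P j s -> P k s.
  elim: j => [|j IH]; first by rewrite leqn0 => /eqP->.
  by rewrite leq_eqVlt => /orP[/eqP->//|/IH h /P_dec/h].
have Zp_compact : compact Zp.
  apply: (subclosed_compact _ (@fball_compact _ _ 0)); first exact: closed_closure.
  by move=> s; exact: Zp_fball0.
have : \forall i \near \oo, Zp `<=` (fun s => ~ P i s).
  move/compact_near_coveringP: Zp_compact; apply => s hs.
  have [k hk] : exists k, ~ P k s by apply/existsNP => hP; apply: nP; exists s.
  have [j hj] := P_closed k s hk.
  exists ([set y | fball j (y - s)], [set i | (k <= i)%N]).
    split; last by exists k.
    by apply/nbhs_fball; exists j => h hh; rewrite /= addrC addKr.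
  move=> [y i] /= [hy ki] /(P_le _ _ _ ki); rewrite -[y](subrKC s); exact: hj.
move=> [i _ hi]; have [s hs Ps] := P_ex i.
exact: (hi i (leqnn i) s hs).
Qed.

(** In y^p - 1 = (y - 1)(1 + y + ... + y^(p-1)) the second factor is congruent to p, so it gains one
    step of the filtration. *)
Lemma near1_expp (y : F) (j : int) : 1 <= j -> fball j (y - 1) -> fball (j + 1) (y ^+ p - 1).
Proof.
move=> j1 hy; rewrite subrX1; apply: fballM => //.
have y1 i : fball 1 (y ^+ i - 1).
  rewrite subrX1; apply: (@fballM0 _ _ 1); first exact: fball_sub hy.
  apply: fball_sum => k _; elim: (nat_of_ord k) => [|n IH]; first exact: fball1.
  rewrite exprS; apply: fball0M => //; rewrite -[y](subrK 1).
  by apply: (fballD _ (fball1 F)); apply: fball_sub hy; apply: le_trans j1.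
have -> : \sum_(i < p) y ^+ i = \sum_(i < p) (y ^+ i - 1) + p%:R.
  by rewrite big_split /= sumrN sumr_const card_ord subrK.
by apply: (fballD _ fball1_p); apply: fball_sum => i _.
Qed.

Hypothesis p_odd : p <> 2%N.

Let p_odd' : odd p. Proof. by case: (even_prime p_pr). Qed.

(** The element x^((p^k + 1)/2) has square x * x^(p^k), and x^(p^k) tends to 1; compactness then
    yields an exact root. This also covers the case p = 0 in F. *)
Lemma Zp_sqrt x : Zp x -> fball 1 (x - 1) -> exists2 s, U1 p s & s ^+ 2 = x.
Proof.
move=> hx x1.
have x_pow k : fball (k.+1)%:Z (x ^+ (p ^ k) - 1).
  elim: k => [|k IH]; first by rewrite expr1.
  by rewrite expnSr exprM -addn1 PoszD; apply: near1_expp.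
have xpow1 i : fball 1 (x ^+ i - 1).
  rewrite subrX1; apply: (@fballM0 _ _ 1) => //.
  by apply: fball_sum => k _; apply: Zp_fball0; apply: ZpX.
have [|||s hs sP] := @Zp_nested (fun k s => fball 1 (s - 1) /\ fball k (s ^+ 2 - x)).
- move=> k; exists (x ^+ (p ^ k).+1./2); first exact: ZpX.
  split=> //; rewrite -exprM muln2 halfK /= oddX p_odd' orbT subn0 exprS -[X in _ - X]mulr1 -mulrBr.
  apply: fball0M; first exact: Zp_fball0.
  by apply: fball_sub (x_pow k); rewrite lez_nat.
- by move=> k s [s1 sk]; split=> //; apply: fball_sub sk; rewrite lez_nat.
- move=> k s nP; have [M hM] := fball_exP s.
  exists (k + M).+1 => h hh [h1 h2]; apply: nP.
  have h_in (i : nat) : (i <= (k + M).+1)%N -> fball i h by move=> le; apply: fball_sub hh.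
  split.
    rewrite -[s](addrK h) addrAC; apply: fballB => //; exact: (h_in 1%N).
  have -> : s ^+ 2 - x = ((s + h) ^+ 2 - x) - (h * s + h * s + h * h) by ring.
  apply: fballB => //.
  have hs : fball k (h * s).
    have -> : k%:Z = (k + M)%N%:Z + - M%:Z by rewrite PoszD addrK.
    by apply: fballM => //; apply: h_in.
  apply: fballD; first exact: fballD.
  by apply: fballM0; apply: h_in => //; rewrite -addnS leq_addr.
exists s; last by apply/eqP; rewrite -subr_eq0; apply/eqP/fball_cap => k; have [] := sP k.
have [s1 _] := sP 0%N.
by have [|z hz ->] := Zp_near_int hs (m := 1); [|exists z].
Qed.

(** The cofactor of x - 1 in x^n - 1 is congruent to n, hence nonzero. *)
Lemma root_unity_near1 (x : F) n : fball 1 (x - 1) -> x ^+ n = 1 -> ~ fball 1 (n%:R : F) -> x = 1.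
Proof.
move=> x1 xn n1; apply/eqP; rewrite -subr_eq0.
have /eqP : (x - 1) * \sum_(i < n) x ^+ i = 0 by rewrite -subrX1 xn subrr.
rewrite mulf_eq0 => /orP[//|/eqP sum0]; exfalso; apply: n1.
have -> : n%:R = \sum_(i < n) (1 - x ^+ i) :> F.
  by rewrite sumrB sum0 subr0 sumr_const card_ord.
apply: fball_sum => i _; rewrite -opprB subrX1; apply: fballN.
apply: (@fballM0 _ _ 1) => //; apply: fball_sum => k _.
have x0 : fball 0 x.
  by rewrite -[x](subrK 1); apply: (fballD _ (fball1 F)); apply: fball_sub x1.
by elim: (nat_of_ord k) => [|j IH]; [exact: fball1|rewrite exprS; apply: fball0M].
Qed.

End PrimeClosure.

Local Open Scope classical_set_scope.

(** * Subfields of the complex numbers and Gauss sums *)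

Section Subfields.
Variable R : realType.
Local Notation C := R[i].
Implicit Types (L K A : set C).

Lemma subfield_fields L : is_subfield L ->
  [/\ L 0, L 1, forall x, L x -> L (- x), forall x, L x -> L x^-1 &
    (forall x y, L x -> L y -> L (x + y)) /\ (forall x y, L x -> L y -> L (x * y))].
Proof.
move=> [L1 LB LV].
have L0 : L 0 by rewrite -(subrr 1); exact: LB.
have LN x : L x -> L (- x) by move=> hx; rewrite -sub0r; exact: LB.
have LI x : L x -> L x^-1 by move=> hx; rewrite -div1r; exact: LV.
split=> //; split=> x y hx hy; first by rewrite -[y]opprK; apply/LB/LN.
by rewrite -[y]invrK; apply/LV/LI.
Qed.

Section Closure.
Variable L : set C.
Hypothesis Lf : is_subfield L.
Lemma sf0 : L 0. Proof. by have [] := subfield_fields Lf. Qed.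
Lemma sf1 : L 1. Proof. by have [] := subfield_fields Lf. Qed.
Lemma sfN x : L x -> L (- x). Proof. by have [_ _ h _ _] := subfield_fields Lf; exact: h. Qed.
Lemma sfV x : L x -> L x^-1. Proof. by have [_ _ _ h _] := subfield_fields Lf; exact: h. Qed.
Lemma sfD x y : L x -> L y -> L (x + y).
Proof. by have [_ _ _ _ [h _]] := subfield_fields Lf; exact: h. Qed.
Lemma sfM x y : L x -> L y -> L (x * y).
Proof. by have [_ _ _ _ [_ h]] := subfield_fields Lf; exact: h. Qed.
Lemma sfB x y : L x -> L y -> L (x - y). Proof. by case: Lf => _ h _; exact: h. Qed.
Lemma sfX x n : L x -> L (x ^+ n).
Proof. by move=> hx; elim: n => [|n IH]; rewrite ?expr0 ?exprS; [exact: sf1|exact: sfM]. Qed.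
Lemma sf_sum (I : Type) (r : seq I) (P : pred I) (f : I -> C) :
  (forall i, P i -> L (f i)) -> L (\sum_(i <- r | P i) f i).
Proof. by move=> h; elim/big_ind : _ => //; [exact: sf0|move=> x y; exact: sfD]. Qed.
Lemma sf_prod (I : Type) (r : seq I) (P : pred I) (f : I -> C) :
  (forall i, P i -> L (f i)) -> L (\prod_(i <- r | P i) f i).
Proof. by move=> h; elim/big_ind : _ => //; [exact: sf1|move=> x y; exact: sfM]. Qed.
Lemma sf_nat n : L n%:R.
Proof. by elim: n => [|n IH]; [exact: sf0|rewrite -natr1; apply: sfD IH sf1]. Qed.
Lemma sfZ x (n : int) : L x -> L (x ^ n).
Proof. by case: n => n hx; [exact: sfX|rewrite NegzE -exprnN; apply/sfV/sfX]. Qed.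
Lemma sf_sqrt x y : L x -> x ^+ 2 = y ^+ 2 -> L y.
Proof.
move=> hx /eqP; rewrite eqf_sqr => /orP[/eqP<-//|/eqP xy]; rewrite -[y]opprK -xy; exact: sfN.
Qed.
End Closure.

Lemma field_gen_subfield A : is_subfield (field_gen A).
Proof.
split=> [M [[] //]|x y hx hy M MA|x y hx hy M MA].
  by case: (MA) => -[_ h _] _; apply: h; [exact: hx|exact: hy].
by case: (MA) => -[_ _ h] _; apply: h; [exact: hx|exact: hy].
Qed.

Lemma field_gen_sub A x : A x -> field_gen A x.
Proof. by move=> Ax M [_ AM]; exact: AM. Qed.

Lemma field_gen_min A L : is_subfield L -> A `<=` L -> field_gen A `<=` L.
Proof. by move=> Lf AL x; apply; split. Qed.

(** Only the behaviour on [L] is recorded, because elements of [Gal] are extended by the identity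
    and are not additive on all of C. *)
Definition homon L (s : C -> C) := [/\ s 1 = 1,
  forall x y, L x -> L y -> s (x + y) = s x + s y &
  forall x y, L x -> L y -> s (x * y) = s x * s y].

Section Hom.
Variables (L : set C) (s : C -> C).
Hypothesis Lf : is_subfield L.
Hypothesis s_hom : homon L s.
Lemma hom1 : s 1 = 1. Proof. by case: s_hom. Qed.
Lemma homD x y : L x -> L y -> s (x + y) = s x + s y. Proof. by case: s_hom => ? h ?; exact: h. Qed.
Lemma homM x y : L x -> L y -> s (x * y) = s x * s y. Proof. by case: s_hom => ? ? h; exact: h. Qed.
Lemma hom0 : s 0 = 0.
Proof. by apply: (addrI (s 0)); rewrite -homD ?addr0 //; exact: sf0. Qed.
Lemma homN x : L x -> s (- x) = - s x.
Proof. by move=> hx; apply: (addrI (s x)); rewrite -homD ?subrr ?hom0 //; exact: sfN. Qed.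
Lemma homB x y : L x -> L y -> s (x - y) = s x - s y.
Proof. by move=> hx hy; rewrite homD ?homN //; exact: sfN. Qed.
Lemma homV x : L x -> s x^-1 = (s x)^-1.
Proof.
move=> hx; have [->|x0] := eqVneq x 0; first by rewrite invr0 hom0 invr0.
have E : s x * s x^-1 = 1 by rewrite -homM ?mulfV ?hom1 //; exact: sfV.
have sx0 : s x != 0 by apply: contra_eq_neq E => ->; rewrite mul0r eq_sym oner_neq0.
by apply: (mulfI sx0); rewrite E mulfV.
Qed.
Lemma homX x n : L x -> s (x ^+ n) = s x ^+ n.
Proof.
by move=> hx; elim: n => [|n IH]; rewrite ?expr0 ?hom1 // !exprS homM ?IH //; exact: sfX.
Qed.
Lemma hom_sum (I : Type) (r : seq I) (P : pred I) (f : I -> C) :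
  (forall i, P i -> L (f i)) -> s (\sum_(i <- r | P i) f i) = \sum_(i <- r | P i) s (f i).
Proof.
move=> h; suff [] : s (\sum_(i <- r | P i) f i) = \sum_(i <- r | P i) s (f i) /\
    L (\sum_(i <- r | P i) f i) by [].
elim: r => [|i r [IH Lr]]; first by rewrite !big_nil hom0; split=> //; exact: sf0.
rewrite !big_cons; case: ifP => // Pi; rewrite (homD (h i Pi) Lr) IH; split=> //.
by apply: sfD => //; exact: h.
Qed.
Lemma hom_prod (I : Type) (r : seq I) (P : pred I) (f : I -> C) :
  (forall i, P i -> L (f i)) -> s (\prod_(i <- r | P i) f i) = \prod_(i <- r | P i) s (f i).
Proof.
move=> h; suff [] : s (\prod_(i <- r | P i) f i) = \prod_(i <- r | P i) s (f i) /\
    L (\prod_(i <- r | P i) f i) by [].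
elim: r => [|i r [IH Lr]]; first by rewrite !big_nil hom1; split=> //; exact: sf1.
rewrite !big_cons; case: ifP => // Pi; rewrite (homM (h i Pi) Lr) IH; split=> //.
by apply: sfM => //; exact: h.
Qed.
End Hom.

Lemma hom_agree A L s s' : is_subfield L -> homon L s -> homon L s' -> field_gen A `<=` L ->
  (forall x, A x -> s x = s' x) -> forall x, field_gen A x -> s x = s' x.
Proof.
move=> Lf hs hs' AL agr x hx; suff [] : (L `&` [set x | s x = s' x]) x by [].
apply: hx; split=> [|y Ay]; last by split; [apply: AL; exact: field_gen_sub|exact: agr].
split=> [|y z [Ly /= ey] [Lz /= ez]|y z [Ly /= ey] [Lz /= ez]] /=.
- by split; [exact: sf1|rewrite /= (hom1 hs) (hom1 hs')].
- by split; [exact: sfB|rewrite /= (homB Lf hs) // (homB Lf hs') // ey ez].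
- have Lz' := sfV Lf Lz; split; first exact: sfM.
  by rewrite /= (homM hs Ly Lz') (homM hs' Ly Lz') (homV Lf hs Lz) (homV Lf hs' Lz) ey ez.
Qed.

Lemma Gal_hom L K s : is_subfield K -> Gal L K s -> homon L s.
Proof. by move=> Kf [_ hD hM hK _]; split=> //; apply: hK; exact: sf1. Qed.

End Subfields.

Section Gauss.
Variables (R : realType) (p : nat).
Hypotheses (p_pr : prime p) (p_odd : p <> 2%N).
Local Notation C := R[i].
Variable zeta : C.
Hypothesis zeta_prim : p.-primitive_root zeta.
Local Notation quad := (@quad_field R p).

Let psi (a : 'F_p) : C := zeta ^+ a.

Let psi_nat n : psi n%:R = zeta ^+ n.
Proof. by rewrite /psi val_Fp_nat // prim_expr_mod. Qed.

Let psiD a b : psi (a + b) = psi a * psi b.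
Proof. by rewrite -[a]natr_Zp -[b]natr_Zp -natrD !psi_nat exprD. Qed.

Let sum_psi b : \sum_a psi (b * a) = if b == 0 then p%:R else 0.
Proof.
have [->|b0] := eqVneq b 0.
  rewrite (eq_bigr (fun=> 1)) => [|a _]; last by rewrite mul0r.
  by rewrite sumr_const card_Fp.
rewrite (reindex_onto (fun a => b^-1 * a) (fun a => b * a)) => [|a _]; last by rewrite mulKf.
rewrite (eq_big predT psi) => [|a|a _]; rewrite ?mulVKf ?eqxx //.
have E : \sum_a psi a = zeta * \sum_a psi a.
  rewrite {1}(reindex_onto (fun a => 1 + a) (fun a => a - 1)) => [|a _]; last by rewrite addrC subrK.
  rewrite mulr_sumr; apply: eq_big => [a|a _].
    by rewrite addrC addKr eqxx.
  by rewrite psiD (_ : psi 1 = zeta) // -[1]/(1%:R) psi_nat expr1.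
apply/eqP; have : (1 - zeta) * \sum_a psi a == 0 by rewrite mulrBl mul1r -E subrr.
rewrite mulf_eq0 => /orP[|//]; rewrite subr_eq0 => /eqP z1.
have : zeta ^+ 1 == zeta ^+ 0 by rewrite expr1 expr0 -z1.
by rewrite (eq_prim_root_expr zeta_prim) mod0n modn_small ?prime_gt1.
Qed.

Let G (c : 'F_p) : C := \sum_a psi (c * a ^+ 2).

Let G_sq c d : d != 0 -> G (c * d ^+ 2) = G c.
Proof.
move=> d0; rewrite /G [RHS](reindex_onto (fun a => d * a) (fun a => d^-1 * a)) => [|a _]; last by rewrite mulVKf.
apply: eq_big => [a|a _]; first by rewrite mulKf ?eqxx.
by rewrite exprMn -mulrA.
Qed.

Let two_neq0 : 2%:R != 0 :> 'F_p.
Proof.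
rewrite -(dvdn_pcharf (pchar_Fp p_pr)).
apply/negP => /(dvdn_leq (isT : (0 < 2)%N)) p2; apply: p_odd; apply/eqP.
by rewrite eqn_leq p2 prime_gt1.
Qed.

(** The substitution a = b + u makes the exponent linear in b; summing over b kills every term
    except u = 0. *)
Let G_conj : G 1 * G (-1) = p%:R.
Proof.
rewrite /G big_distrlr /= exchange_big /=.
transitivity (\sum_b \sum_u psi (u ^+ 2) * psi (2%:R * u * b)).
  apply: eq_bigr => b _.
  rewrite (reindex_onto (fun u => b + u) (fun a => a - b)) => [|a _]; last by rewrite addrC subrK.
  apply: eq_big => [u|u _]; first by rewrite addrC addKr eqxx.
  by rewrite -!psiD; congr psi; ring.
rewrite exchange_big /= (bigD1 0) //= [X in _ + X]big1 => [|u u0].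
  by rewrite -mulr_sumr sum_psi mulr0 eqxx expr0n /= mul1r addr0.
by rewrite -mulr_sumr sum_psi mulf_eq0 (negPf two_neq0) (negPf u0) mulr0.
Qed.

Variable gam : 'F_p.
Hypothesis gam_prim : p.-1.-primitive_root gam.

Let gam_neq0 : gam != 0.
Proof. by rewrite (prim_root_eq0 gam_prim) -lt0n -subn1 subn_gt0 prime_gt1. Qed.

Let gam_log c : c != 0 -> exists j : nat, (j < p.-1)%N /\ c = gam ^+ j.
Proof.
move=> c0; have c1 : c ^+ p.-1 = 1.
  apply: (mulfI c0); rewrite mulr1 -exprS prednK ?prime_gt0 //.
  by have := expf_card c; rewrite card_Fp.
by have [[j hj] ->] := prim_rootP gam_prim c1; exists j.
Qed.

Let G_parity j : G (gam ^+ j) = if odd j then G gam else G 1.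
Proof.
rewrite -{1}[j]odd_double_half exprD -muln2 exprM G_sq ?expf_neq0 //.
by case: odd.
Qed.

(** The sums G c over c != 0 add up to 0, and G c depends only on the parity of the logarithm of c.
    Pairing c with c * gam gives (p - 1)(G gam + G 1) = 0. *)
Let G_gam : G gam = - G 1.
Proof.
apply/eqP; rewrite -addr_eq0.
have sumG : \sum_(c | c != 0) G c = 0.
  have tot : \sum_c G c = p%:R.
    rewrite /G exchange_big /= (bigD1 0) //= [X in _ + X]big1 ?addr0 => [|a a0].
      rewrite (eq_bigr (fun=> 1)) => [|c _]; last by rewrite expr0n mulr0.
      by rewrite sumr_const card_Fp.
    by under eq_bigr do rewrite mulrC; rewrite sum_psi sqrf_eq0 (negPf a0).
  have G0 : G 0 = p%:R.
    rewrite /G (eq_bigr (fun=> 1)) => [|c _]; last by rewrite mul0r.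
    by rewrite sumr_const card_Fp.
  by move: tot; rewrite (bigD1 0) //= G0 => /(canRL (addKr _)) ->; rewrite addNr.
have sumG' : \sum_(c | c != 0) G (c * gam) = 0.
  rewrite -[RHS]sumG [RHS](reindex_onto (fun c => c * gam) (fun c => c / gam)) => [|c _]; last by rewrite divfK.
  by apply: eq_bigl => c; rewrite mulfK // eqxx andbT mulf_eq0 (negPf gam_neq0) orbF.
have : \sum_(c | c != 0) (G c + G (c * gam)) = 0 by rewrite big_split /= sumG sumG' addr0.
rewrite (eq_bigr (fun=> G gam + G 1)) => [|c /gam_log[j [_ ->]]]; last first.
  rewrite -exprSr !G_parity /=; case: odd => //=; exact: addrC.
rewrite sumr_const => /eqP; rewrite -mulr_natr mulf_eq0 pnatr_eq0 => /orP[//|].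
by move=> /eqP/card0_eq/(_ 1); rewrite unfold_in oner_eq0.
Qed.

(** Hence every element of H fixes ['i] and is determined by its effect on the values of [lam]. *)
Lemma i_in_quad : quad 'i.
Proof.
have qf := field_gen_subfield [set sqrtC p%:R; sqrtC (- p%:R)] : is_subfield quad.
have a : quad (sqrtC p%:R) by apply: field_gen_sub; left.
have b : quad (sqrtC (- p%:R)) by apply: field_gen_sub; right.
apply: (@sf_sqrt _ _ qf (sqrtC (- p%:R) / sqrtC p%:R)).
  by apply: (sfM qf) => //; exact: (sfV qf).
rewrite expr_div_n !sqrtCK mulNr mulfV ?pnatr_eq0 -?lt0n ?prime_gt0 //.
by apply/eqP; rewrite eq_complex /= !(mulr0, mul0r, mulr1, mul1r, sub0r, add0r, addr0) oppr0 !eqxx.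
Qed.

(** The sign records whether -1 is a square modulo p. It need not be resolved, because the base
    field contains the square roots of both p and -p. *)
Let G_sq_pm : G 1 ^+ 2 = p%:R \/ G 1 ^+ 2 = - p%:R.
Proof.
have [j [_ E]] : exists j : nat, (j < p.-1)%N /\ -1 = gam ^+ j :> 'F_p.
  by apply: gam_log; rewrite oppr_eq0 oner_neq0.
have := G_conj; rewrite E G_parity; case: odd; last by left.
by rewrite G_gam mulrN => <-; right; rewrite opprK.
Qed.

Lemma gauss_quad : quad (G 1).
Proof.
have qf := field_gen_subfield [set sqrtC p%:R; sqrtC (- p%:R)] : is_subfield quad.
by case: G_sq_pm => E; [apply: (@sf_sqrt _ _ qf (sqrtC p%:R))|
  apply: (@sf_sqrt _ _ qf (sqrtC (- p%:R)))]; rewrite ?sqrtCK //; apply: field_gen_sub; [left|right].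
Qed.

Lemma sqrt_p_in L : is_subfield L -> L zeta -> L 'i -> L (sqrtC p%:R).
Proof.
move=> Lf Lz Li; have LG : L (G 1) by apply: (sf_sum Lf) => a _; exact: (sfX Lf).
case: G_sq_pm => E; first by apply: (sf_sqrt Lf LG); rewrite sqrtCK.
apply: (sf_sqrt Lf (sfM Lf Li LG)); rewrite sqrtCK exprMn E.
rewrite (_ : 'i ^+ 2 = -1) ?mulrNN ?mul1r //.
by apply/eqP; rewrite eq_complex /= !(mulr0, mul0r, mulr1, mul1r, sub0r, add0r, addr0) oppr0 !eqxx.
Qed.

Lemma fix_quad_square L s k : is_subfield L -> homon L s -> L zeta ->
  (forall x, quad x -> s x = x) -> s zeta = zeta ^+ k ->
  exists l : nat, (l < p.-1./2)%N /\ k%:R = gam ^+ (2 * l).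
Proof.
move=> Lf s_hom Lz s_fix sz.
have k0 : k%:R != 0 :> 'F_p.
  (* If p divided k, then s would send the invertible element zeta - 1 to 0. *)
  apply/negP; rewrite -(dvdn_pcharf (pchar_Fp p_pr)) (prim_order_dvd zeta_prim) -sz => /eqP sz1.
  have z1 : zeta - 1 != 0.
    rewrite subr_eq0 -{1}[zeta]expr1 -(prim_order_dvd zeta_prim) dvdn1 neq_ltn prime_gt1 ?orbT //.
  have L1 : L (zeta - 1) by apply: (sfB Lf) => //; exact: sf1.
  have := homM s_hom L1 (sfV Lf L1); rewrite mulfV // (hom1 s_hom).
  rewrite (homB Lf s_hom Lz (sf1 Lf)) sz1 (hom1 s_hom) subrr mul0r => /eqP.
  by rewrite oner_eq0.
have [j [jp kE]] := gam_log k0.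
have sG : s (G 1) = G k%:R.
  rewrite (hom_sum Lf s_hom); last by move=> a _; exact: (sfX Lf).
  by apply: eq_bigr => a _; rewrite /psi (homX Lf s_hom) // sz -exprM -psi_nat natrM natr_Zp mul1r.
have Gn0 : G 1 != 0.
  apply/negP => /eqP G0; have /eqP := G_conj; rewrite G0 mul0r eq_sym pnatr_eq0.
  by rewrite -leqn0 leqNgt prime_gt0.
have := s_fix _ gauss_quad; rewrite sG kE G_parity; case: ifP => oj.
  rewrite G_gam => /eqP; rewrite eq_sym -addr_eq0 -mulr2n mulrn_eq0 /= (negPf Gn0) //.
move=> _; exists j./2; rewrite mul2n even_halfK ?oj //; split=> //.
have p_ev : ~~ odd p.-1.
  by case: (even_prime p_pr) => [/p_odd//|]; rewrite -{1}[p]prednK ?prime_gt0 //= => ->.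
by rewrite -ltn_double !even_halfK ?oj.
Qed.

End Gauss.

Local Open Scope classical_set_scope.

(** * Galois action on the character *)

Section GalIndex.
Variables (R : realType) (F : nonArchLocalFieldType R) (p : nat).
Hypotheses (p_res : residue_char F p) (p_odd : p <> 2%N).
Variable lam : F -> R[i].
Hypotheses (lam_char : unitary_character lam) (lam_nontriv : exists t, lam t <> 1).
Local Notation Zp := (@prime_closure R F).
Local Notation E := (Efield lam).
Local Notation quad := (@quad_field R p).
Local Notation h := p.-1./2.

Let p_pr : prime p. Proof. by case: p_res. Qed.

Lemma half_predK : (2 * h = p.-1)%N.
Proof.
rewrite mul2n even_halfK //.
by case: (even_prime p_pr) => [/p_odd//|]; rewrite -{1}[p]prednK ?prime_gt0 //= => ->.
Qed.

Let lamM1 := lamD lam_char.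

Lemma lam_pX_nbhs (j : nat) : exists k : nat, forall t, fball (- j%:Z) t ->
  forall z, fball 0 z -> lam ((p ^ k)%:R * z * t) = 1.
Proof.
have [K hK] := lam_trivial_nbhs lam_char; exists (K + j)%N => t ht z hz; apply: hK.
have -> : K%:Z = (K + j)%N%:Z + 0 + - j%:Z by rewrite addr0 PoszD addrK.
apply: fballM => //; apply: fballM => //; rewrite natrX; exact: fball_pX.
Qed.

Lemma lam_ppow t : exists k : nat, lam ((p ^ k)%:R * t) = 1.
Proof.
have [j hj] := fball_exP t; have [k hk] := lam_pX_nbhs j; exists k.
by rewrite -[_%:R]mulr1; apply: hk => //; exact: fball1.
Qed.

Lemma lam_natX k t : lam (k%:R * t) = lam t ^+ k.
Proof. by rewrite mulr_natl lamMn. Qed.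

Lemma lam_Zp w t : Zp w -> lam t = 1 -> lam (w * t) = 1.
Proof.
move=> hw ht; have [j hj] := fball_exP t; have [k hk] := lam_pX_nbhs j.
have [m [z [hz wE]]] := Zp_approx p_res k hw.
rewrite -[w](subrK m%:~R) mulrDl lamM1 lamMz // ht exp1rz mulr1 wE.
by apply: hk => //; exact: Zp_fball0.
Qed.

(** Every admissible pair of exponents in [zexp] yields this same root of unity, so the choice made
    by [xget] is immaterial and [restricts_to] becomes a scaling of the argument of [lam]. *)
Lemma zexpE r t : Zp r -> zexp p (lam t) r = lam (r * t).
Proof.
move=> hr; rewrite /zexp; set A := [set w | _].
have A_sub w : A w -> w = lam (r * t).
  move=> [m [k [tk [z hz rE] ->]]].
  rewrite -[r](subrK m%:~R) mulrDl lamM1 lamMz // rE.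
  by rewrite [_ * z]mulrC -mulrA lam_Zp ?mul1r // lam_natX.
suff : exists w, A w by move=> /(xgetPex 1)/A_sub.
have [k hk] := lam_ppow t; have [m [z [hz rE]]] := Zp_approx p_res k hr.
exists (lam t ^ m), m, k; split=> //; first by rewrite -lam_natX.
by exists z.
Qed.

Lemma restrictsE s r : Zp r ->
  restricts_to p lam s r <-> forall t, s (lam t) = lam (r * t).
Proof. by move=> hr; split=> H t; have := H t; rewrite zexpE. Qed.

Lemma lam_scale_inj r r' : (forall t, lam (r * t) = lam (r' * t)) -> r = r'.
Proof.
move=> H; apply/eqP; rewrite -subr_eq0; apply/negPn/negP => d0.
have [t0 ht0] := lam_nontriv; apply: ht0.
rewrite -[t0](mulVKf d0) mulrBl lamM1 lamN // H mulfV //.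
exact: lam_neq0.
Qed.

(** Multiply a point where [lam] is nontrivial by p as long as the value stays different from 1; the
    last such value has order p. *)
Lemma lam_prim_ex : exists t1, p.-primitive_root (lam t1).
Proof.
have [t0 ht0] := lam_nontriv; case: (ex_minnP (_ : exists k, lam ((p ^ k)%:R * t0) == 1)).
  by have [k hk] := lam_ppow t0; exists k; exact/eqP.
case=> [|k] /eqP hk kmin; first by case: ht0; rewrite -hk expn0 mul1r.
exists ((p ^ k)%:R * t0); set z := lam _.
have zp : z ^+ p = 1 by rewrite -lam_natX mulrA -natrM -expnS.
have [m zm /(primeP p_pr).2/orP[/eqP m1|/eqP<-//]] := prim_order_exists (prime_gt0 p_pr) zp.
have := prim_expr_order zm; rewrite m1 expr1 => /eqP /kmin.
by rewrite ltnn.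
Qed.

Lemma Ef : is_subfield E. Proof. exact: field_gen_subfield. Qed.

Lemma E_lam t : E (lam t).
Proof. by apply: field_gen_sub; left; apply: field_gen_sub; exists t. Qed.

Lemma E_i : E 'i. Proof. by apply: field_gen_sub; right. Qed.

Lemma quadf : is_subfield quad. Proof. exact: field_gen_subfield. Qed.

Lemma Hgal_hom s : Hgal p lam s -> homon E s.
Proof. exact/Gal_hom/quadf. Qed.

Lemma Hgal_fix s x : Hgal p lam s -> quad x -> s x = x.
Proof. by case=> _ _ _ fx _; exact: fx. Qed.

Lemma Hgal_in s x : Hgal p lam s -> E x -> E (s x).
Proof. by case=> -[h1 _ _] _ _ _ _; exact: h1. Qed.

Lemma Hgal_comp s t : Hgal p lam s -> Hgal p lam t -> Hgal p lam (s \o t).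
Proof.
move=> hs ht; have [bs Ds Ms Fs Os] := hs; have [bt Dt Mt Ft Ot] := ht.
split=> [|x y Lx Ly|x y Lx Ly|x Kx|x nLx] /=.
- exact: (set_bij_comp bt bs).
- by rewrite Dt // Ds //; exact: Hgal_in.
- by rewrite Mt // Ms //; exact: Hgal_in.
- by rewrite Ft // Fs.
- by rewrite Ot // Os.
Qed.

Lemma Zp_nat s : Zp s -> exists e : nat, fball 1 (s - e%:R).
Proof.
move=> hs; have [m hm] := (ZpP s).1 hs 1%N.
have p0 : (p%:Z != 0) by rewrite eqz_nat -lt0n prime_gt0.
have m0 := modz_ge0 m p0.
exists `|(m %% p)%Z|%N; have -> : `|(m %% p)%Z|%N%:R = (m %% p)%Z%:~R :> F.
  by rewrite pmulrn abszE ger0_norm.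
rewrite -[s](subrK m%:~R) -addrA; apply: fballD => //.
rewrite -rmorphB /=; apply/(fball1_int p_res).
by rewrite {1}(divz_eq m p) addrK dvdz_mull.
Qed.

Lemma fball1_nat_Fp (a b : nat) : fball 1 (a%:R - b%:R : F) <-> a%:R = b%:R :> 'F_p.
Proof.
have -> : a%:R - b%:R = (a%:Z - b%:Z)%:~R :> F by rewrite rmorphB /= -!pmulrn.
have H : (p %| a%:Z - b%:Z)%Z = (a%:R == b%:R :> 'F_p).
  by rewrite -eqz_mod_dvd !modz_nat eqz_nat -val_eqE /= !val_Fp_nat.
by split=> [/(fball1_int p_res)|]; [rewrite H => /eqP|move=> /eqP; rewrite -H => /(fball1_int p_res)].
Qed.

Variable eps : F.
Hypotheses (eps_unit : prime_units eps) (eps_root : p.-1.-primitive_root eps).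

Lemma Zp_eps : Zp eps. Proof. by case: eps_unit. Qed.

Lemma absv_eps : absv eps = 1.
Proof.
apply: (@absv_root_unity _ _ _ p.-1); last exact: prim_expr_order eps_root.
by rewrite -subn1 subn_gt0 prime_gt1.
Qed.

Lemma p1_unit : ~ fball 1 (p.-1%:R : F).
Proof.
have -> : p.-1%:R = (p.-1%:Z)%:~R :> F by rewrite pmulrn.
move=> /(fball1_int p_res); rewrite dvdzE /= gtnNdvd //.
  by rewrite -subn1 subn_gt0 prime_gt1.
by rewrite prednK // prime_gt0.
Qed.

Lemma eps_near1 j : fball 1 (eps ^+ j - 1) -> eps ^+ j = 1.
Proof.
move=> h1; apply: (root_unity_near1 h1 _ p1_unit).
by rewrite -exprM mulnC exprM (prim_expr_order eps_root) expr1n.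
Qed.

Lemma near_exp (x y : F) n : fball 0 x -> fball 0 y -> fball 1 (x - y) -> fball 1 (x ^+ n - y ^+ n).
Proof.
move=> x0 y0 xy; elim: n => [|n IH]; first by rewrite !expr0 subrr; exact: fball0.
have -> : x ^+ n.+1 - y ^+ n.+1 = (x - y) * x ^+ n + y * (x ^+ n - y ^+ n) by rewrite !exprS; ring.
have X0 : fball 0 (x ^+ n).
  by elim: (n) => [|k IHk]; [exact: fball1|rewrite exprS; apply: fball0M].
apply: fballD; first exact: (@fballM0 _ _ 1).
exact: (@fball0M _ _ 1).
Qed.

(** Reduction modulo the maximal ideal is injective on powers of [eps] by [eps_near1], so [eps]
    reduces to a primitive root modulo p. This links the index in F with the Gauss sum argument over
    F_p. *)
Lemma eps_int : exists e : nat, fball 1 (eps - e%:R) /\ p.-1.-primitive_root (e%:R : 'F_p).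
Proof.
have [e he] := Zp_nat Zp_eps; exists e; split=> //.
have e0 : fball 0 (e%:R : F) by rewrite pmulrn; exact: fball_int.
have pow j : (e%:R : 'F_p) ^+ j = 1 <-> eps ^+ j = 1.
  have near := near_exp j (Zp_fball0 Zp_eps) e0 he.
  split=> [E1|E1].
    have : (e ^ j)%:R = 1%:R :> 'F_p by rewrite natrX E1.
    move=> /fball1_nat_Fp; rewrite natrX => H.
    apply: eps_near1; rewrite -(subrKA (e%:R ^+ j)); exact: fballD.
  suff : (e ^ j)%:R = 1%:R :> 'F_p by rewrite natrX.
  apply/fball1_nat_Fp; rewrite natrX (_ : 1%:R = eps ^+ j); last by rewrite E1.
  exact: fballBC.
have /pow E1 := prim_expr_order eps_root.
have p1 : (0 < p.-1)%N by rewrite -subn1 subn_gt0 prime_gt1.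
have [m em dvd_m] := prim_order_exists p1 E1.
suff -> : p.-1 = m by [].
apply/eqP; rewrite eqn_dvd dvd_m andbT (prim_order_dvd eps_root).
by apply/eqP/pow; exact: prim_expr_order em.
Qed.

Lemma lam_near_nat t r k : lam (p%:R * t) = 1 -> Zp r -> fball 1 (r - k%:R) -> lam (r * t) = lam t ^+ k.
Proof.
move=> pt hr hk; have [z hz ->] := Zp_near_int p_res hr (m := k) hk.
have E1 : lam (p%:R * z * t) = 1 by rewrite [_ * z]mulrC -mulrA; exact: lam_Zp.
by rewrite mulrDl lamM1 E1 mulr1 lamMz.
Qed.

Lemma prim_pt t : p.-primitive_root (lam t) -> lam (p%:R * t) = 1.
Proof. by move=> ht; rewrite lam_natX (prim_expr_order ht). Qed.

(** On values killed by p^k, which form a cyclic group, s is a power map with an integer exponent.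
    [Zp_nested] assembles the exponents for all k into one element. *)
Lemma Hgal_scale s : Hgal p lam s -> exists2 r, Zp r & forall t, s (lam t) = lam (r * t).
Proof.
move=> hs; have s_hom := Hgal_hom hs.
have [|||r hr rP] := @Zp_nested _ F (fun k r => forall t, lam t ^+ (p ^ k) = 1 -> s (lam t) = lam (r * t)).
- move=> k; suff [m hm] : exists m : nat, forall t, lam t ^+ (p ^ k) = 1 -> s (lam t) = lam t ^+ m.
    exists (m%:~R); first exact: Zp_int.
    by move=> t /hm ->; rewrite lamMz.
  elim: k => [|k [m hm]].
    by exists 0%N => t; rewrite expr1 => ->; rewrite (hom1 s_hom).
  (* Either some value has exact order p^(k+1) and generates all values at this level, or the level
     brings nothing new and the previous exponent still serves. *)
  have [[t [tk tk']]|nt] := pselect (exists t, lam t ^+ (p ^ k.+1) = 1 /\ lam t ^+ (p ^ k) <> 1).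
    have prim : (p ^ k.+1).-primitive_root (lam t).
      have pk0 : (0 < p ^ k.+1)%N by rewrite expn_gt0 prime_gt0.
      have [n hn /(dvdn_pfactor _ _ p_pr)[j jk nE]] := prim_order_exists pk0 tk.
      suff -> : k.+1 = j by rewrite -nE.
      apply/eqP; rewrite eqn_leq jk andbT ltnNge; apply/negP => jk'; apply: tk'.
      by apply/eqP; rewrite -(prim_order_dvd hn) nE dvdn_exp2l.
    have sE : s (lam t) ^+ (p ^ k.+1) = 1 by rewrite -(homX Ef s_hom) ?tk ?(hom1 s_hom) //; exact: E_lam.
    have [j sj] := prim_rootP prim sE; exists (nat_of_ord j) => t' tk1.
    have [i ->] := prim_rootP prim tk1.
    by rewrite (homX Ef s_hom i (E_lam t)) sj -!exprM mulnC.
  exists m => t tk; apply: hm; apply: contrapT => tk'; apply: nt; exists t; split=> //.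
- by move=> k r H t tk; apply: H; rewrite expnSr exprM tk expr1n.
- move=> k r nP.
  have [t [tk st]] : exists t, lam t ^+ (p ^ k) = 1 /\ s (lam t) <> lam (r * t).
    apply: contrapT => H; apply: nP => t tk; apply: contrapT => H'; apply: H; exists t; split=> //.
  (* The condition is closed: a small change of [r] leaves [lam (r * t)] unchanged. *)
  have [K hK] := lam_trivial_nbhs lam_char; have [M hM] := fball_exP t.
  exists (K + M)%N => d hd H; apply: st; rewrite H // mulrDl lamM1 (hK (d * t)) ?mulr1 //.
  have -> : K%:Z = (K + M)%N%:Z + - M%:Z by rewrite PoszD addrK.
  exact: fballM.
exists r => // t; have [k hk] := lam_ppow t; apply: (rP k).
by rewrite -lam_natX.
Qed.

Definition index_spec (s : R[i] -> R[i]) (c : nat * F) := [/\ (1 <= c.1 <= h)%N, U1 p c.2 &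
  forall t, s (lam t) = lam (eps ^+ (2 * c.1) * c.2 ^+ 2 * t)].

Lemma U1_props s : U1 p s -> [/\ Zp s, fball 1 (s - 1) & absv s = 1].
Proof.
move=> [z hz ->]; have Zz : Zp (1 + p%:R * z).
  apply: ZpD; first exact: Zp1.
  by apply: ZpM => //; rewrite pmulrn; exact: Zp_int.
have near : fball 1 (1 + p%:R * z - 1).
  rewrite addrC addKr; apply: (@fballM0 _ _ 1); first exact: fball1_p.
  exact: Zp_fball0.
split=> //; apply/eqP; rewrite eq_le; apply/andP; split.
  by have := Zp_fball0 Zz; rewrite /fball /= oppr0 expr0z.
rewrite leNgt; apply/negP => lt1; apply: (@fball1_1 _ F).
rewrite -[X in fball _ X](subKr (1 + p%:R * z)); apply: fballB => //.
by rewrite -[X in fball X _](add0r 1) -fballS oppr0 expr0z.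
Qed.

Lemma eps_h : eps ^+ (2 * h) = 1.
Proof. by rewrite half_predK (prim_expr_order eps_root). Qed.

Lemma h_gt0 : (0 < h)%N.
Proof. by rewrite -(ltn_pmul2l (ltn0Sn 1)) muln0 half_predK -subn1 subn_gt0 prime_gt1. Qed.

Lemma Zp_index i s : U1 p s -> Zp (eps ^+ i * s ^+ 2).
Proof.
by move=> /U1_props[hs _ _]; apply: ZpM; apply: ZpX => //; exact: Zp_eps.
Qed.

(** The scaling factor r of s is congruent to an even power of [eps]. Dividing by that power leaves
    an element congruent to 1, which has a square root in [U1]. *)
Lemma index_ex s : Hgal p lam s -> exists c, index_spec s c.
Proof.
move=> hs; have [r hr sE] := Hgal_scale hs; have [t1 ht1] := lam_prim_ex.
have [e [he gam_prim]] := eps_int; have [k hk] := Zp_nat hr.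
have s1 : s (lam t1) = lam t1 ^+ k by rewrite sE; apply: lam_near_nat => //; exact: prim_pt.
have [l [lh kE]] := fix_quad_square p_pr p_odd ht1 gam_prim Ef (Hgal_hom hs) (E_lam t1) (fun x => Hgal_fix hs) s1.
have e0 : fball 0 (e%:R : F) by rewrite pmulrn; exact: fball_int.
have near : fball 1 (r - eps ^+ (2 * l)).
  have -> : r - eps ^+ (2 * l) = (r - k%:R) + (k%:R - e%:R ^+ (2 * l)) + (e%:R ^+ (2 * l) - eps ^+ (2 * l)) by ring.
  apply: fballD; first apply: fballD => //.
    by rewrite -natrX; apply/fball1_nat_Fp; rewrite natrX.
  by apply: near_exp => //; [exact/Zp_fball0/Zp_eps|exact: fballBC].
have eps0 : eps != 0 by rewrite -absv_eq0 absv_eps oner_neq0.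
pose e' := eps ^+ (2 * (h - l)).
have ee' : eps ^+ (2 * l) * e' = 1 by rewrite -exprD -mulnDr subnKC ?eps_h // ltnW.
have Ze' : Zp e' by apply/ZpX/Zp_eps.
have [||x Ux xE] := @Zp_sqrt _ F p p_res p_odd (r * e').
- exact: ZpM.
- rewrite -ee' -mulrBl; apply: (@fballM0 _ _ 1) => //; exact: Zp_fball0.
have rE : r = eps ^+ (2 * l) * x ^+ 2 by rewrite xE mulrCA ee' mulr1.
(* Here l lies in [0, h), while the index must lie in [1, h]; the value 0 is replaced by h, since
   eps^(2h) = 1. *)
case: l lh {kE near ee'} e' Ze' xE rE => [|l] lh e' Ze' xE rE.
  exists (h, x); split=> //=; first by rewrite h_gt0 leqnn.
  by move=> t; rewrite sE rE muln0 eps_h expr0.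
exists (l.+1, x); split=> //=; first exact: ltnW.
by move=> t; rewrite sE rE.
Qed.

Lemma eps_inj i j : (1 <= i <= h)%N -> (1 <= j <= h)%N -> eps ^+ (2 * i) = eps ^+ (2 * j) -> i = j.
Proof.
move=> /andP[i1 ih] /andP[j1 jh] /eqP; rewrite (eq_prim_root_expr eps_root) -half_predK.
rewrite -!muln_modr eqn_pmul2l //.
rewrite /= leq_eqVlt in ih; case/orP: ih => [/eqP->|ih].
  rewrite modnn; rewrite leq_eqVlt in jh; case/orP: jh => [/eqP->//|jh].
  by rewrite modn_small // eq_sym (gtn_eqF j1).
rewrite leq_eqVlt in jh; case/orP: jh => [/eqP->|jh].
  by rewrite modnn modn_small // (gtn_eqF i1).
by rewrite !modn_small // => /eqP.
Qed.

(** Reduction modulo the maximal ideal determines the power of [eps]. The remaining equation x^2 =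
    y^2 gives x = y, since x = -y would make 2 congruent to 0, both being congruent to 1. *)
Lemma index_uniq s c c' : index_spec s c -> index_spec s c' -> c = c'.
Proof.
case: c c' => i x [j y] [/= hi Ux ex] [/= hj Uy ey].
have E0 : eps ^+ (2 * i) * x ^+ 2 = eps ^+ (2 * j) * y ^+ 2.
  by apply: lam_scale_inj => t; rewrite -ex -ey.
have [Zx nx ax] := U1_props Ux; have [Zy ny ay] := U1_props Uy.
have eps0 n : eps ^+ n != 0 by rewrite expf_neq0 // -absv_eq0 absv_eps oner_neq0.
have sq1 z : Zp z -> fball 1 (z - 1) -> fball 1 (z ^+ 2 - 1).
  move=> Zz nz; rewrite -[1 in X in fball _ X](expr1n _ 2); apply: near_exp => //.
    exact: Zp_fball0.
  exact: fball1.
have Zi n : fball 0 (eps ^+ n) by apply/Zp_fball0/ZpX/Zp_eps.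
have near : fball 1 (eps ^+ (2 * i) - eps ^+ (2 * j)).
  have -> : eps ^+ (2 * i) - eps ^+ (2 * j) = eps ^+ (2 * j) * (y ^+ 2 - 1) - eps ^+ (2 * i) * (x ^+ 2 - 1).
    by rewrite !mulrBr E0 !mulr1; ring.
  by apply: fballB; apply: (@fball0M _ _ 1) => //; apply: sq1.
have epsE : eps ^+ (2 * i) = eps ^+ (2 * j).
  have jh : (j <= h)%N by case/andP: hj.
  have ee : eps ^+ (2 * j) * eps ^+ (2 * (h - j)) = 1 by rewrite -exprD -mulnDr subnKC ?eps_h.
  apply: (mulIf (eps0 (2 * (h - j))%N)); rewrite ee -exprD; apply: eps_near1.
  by rewrite exprD -ee -mulrBl; apply: (@fballM0 _ _ 1).
have ij := eps_inj hi hj epsE; congr pair => //.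
move: E0; rewrite epsE => /(mulfI (eps0 _)) /eqP; rewrite eqf_sqr => /orP[/eqP//|/eqP xy].
exfalso; have : fball 1 ((2%:Z)%:~R : F).
  have -> : (2%:Z)%:~R = - (x - 1) - (y - 1) :> F by rewrite xy -pmulrn; ring.
  by apply: fballB => //; exact: fballN.
move=> /(fball1_int p_res) /= p2; have /(_ p2) := @dvdn_leq p 2 isT.
by move=> le2; apply: p_odd; apply/eqP; rewrite eqn_leq le2 prime_gt1.
Qed.

Lemma gal_indexP s : Hgal p lam s -> index_spec s (gal_index eps p lam s).
Proof.
move=> /index_ex[c [c1 c2 c3]]; rewrite /gal_index; set A := [set _ | _].
have : A (xget (1%N, 1) A).
  by apply: xgetPex; exists c; split=> //; apply/restrictsE => //; exact: Zp_index.
move: (xget _ _) => d [d1 d2 /restrictsE d3]; split=> //; apply: d3; exact: Zp_index.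
Qed.

Lemma gal_indexE s c : Hgal p lam s -> index_spec s c -> gal_index eps p lam s = c.
Proof. by move=> hs; apply: index_uniq; exact: gal_indexP. Qed.

End GalIndex.

Local Open Scope classical_set_scope.

(** * Norms from the cyclotomic field *)

Section Norm.
Variables (R : realType) (F : nonArchLocalFieldType R) (p : nat).
Hypotheses (p_res : residue_char F p) (p_odd : p <> 2%N).
Variable lam : F -> R[i].
Hypotheses (lam_char : unitary_character lam) (lam_nontriv : exists t, lam t <> 1).
Variable eps : F.
Hypotheses (eps_unit : prime_units eps) (eps_root : p.-1.-primitive_root eps).
Variable eta : R[i] -> R[i].
Hypotheses (eta_gal : Hgal p lam eta) (eta_eps : restricts_to p lam eta (eps ^+ 2)).
Local Notation E := (Efield lam).
Local Notation quad := (@quad_field R p).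
Local Notation cyc := (@cyclo_field R p).
Local Notation h := p.-1./2.

Let p_pr : prime p. Proof. by case: p_res. Qed.

Lemma cycf : is_subfield cyc. Proof. exact: field_gen_subfield. Qed.

Lemma cyc_gen z : z ^+ p = 1 -> cyc z.
Proof. by move=> zp; apply: field_gen_sub; left. Qed.

Lemma cyc_i : cyc 'i. Proof. by apply: field_gen_sub; right. Qed.

Lemma cyc_E : cyc `<=` E.
Proof.
have [t1 ht1] := lam_prim_ex p_res lam_char lam_nontriv.
apply: field_gen_min; first exact: Ef.
move=> z [zp|->]; last exact: E_i.
by have [j ->] := prim_rootP ht1 zp; apply: (sfX (Ef lam)); exact: E_lam.
Qed.

Lemma eta_lam t : eta (lam t) = lam (eps ^+ 2 * t).
Proof. by move: t; apply/(restrictsE p_res lam_char) => //; apply/ZpX/Zp_eps. Qed.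

Lemma iter_eta_lam l t : iter l eta (lam t) = lam (eps ^+ (2 * l) * t).
Proof.
elim: l t => [|l IH] t; first by rewrite muln0 expr0 mul1r.
by rewrite iterS IH eta_lam mulrA -exprD mulnS.
Qed.

Lemma iter_eta_E l x : E x -> E (iter l eta x).
Proof. by move=> Ex; elim: l => //= l IH; apply: (Hgal_in eta_gal). Qed.

Lemma iter_eta_hom l : homon E (iter l eta).
Proof.
have [h1 hD hM] := Hgal_hom eta_gal.
split=> [|x y Ex Ey|x y Ex Ey]; elim: l => //= l ->; rewrite ?hD ?hM //; exact: iter_eta_E.
Qed.

Lemma iter_eta_quad l x : quad x -> iter l eta x = x.
Proof. by move=> qx; elim: l => //= l ->; apply: (Hgal_fix eta_gal). Qed.

Lemma iter_eta_cyc l x : cyc x -> cyc (iter l eta x).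
Proof.
elim: l => [//|l IH] cx; rewrite iterS; move: (IH cx); move: (iter l eta x) => {IH cx x l} x cx.
have eh := Hgal_hom eta_gal; have Lf := Ef lam.
suff [] : (E `&` [set x | cyc (eta x)]) x by [].
apply: cx; split.
  split=> [|y z [Ey /= cy] [Ez /= cz]|y z [Ey /= cy] [Ez /= cz]].
  - by split; [exact: (sf1 Lf)|rewrite /= (hom1 eh); exact: (sf1 cycf)].
  - by split; [exact: (sfB Lf)|rewrite /= (homB Lf eh) //; exact: (sfB cycf)].
  - have Ez' := sfV Lf Ez; split; first exact: (sfM Lf).
    by rewrite /= (homM eh Ey Ez') (homV Lf eh Ez); apply: (sfM cycf) => //; exact: (sfV cycf).
move=> y [yp|->]; split; [|rewrite /=|exact: E_i|rewrite /=].
- by apply: cyc_E; exact: cyc_gen.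
- apply: cyc_gen; rewrite -(homX Lf eh) ?yp ?(hom1 eh) //.
  by apply: cyc_E; exact: cyc_gen.
- by rewrite (Hgal_fix eta_gal) //; [exact: cyc_i|exact: i_in_quad].
Qed.

(** The [U1] component is congruent to 1 modulo p, so it acts trivially on p-th roots of unity and
    only the power of [eps] is seen. *)
Lemma sigma_eta s c x : Hgal p lam s -> index_spec p lam eps s c -> cyc x -> s x = iter c.1 eta x.
Proof.
case: c => i y hs [/= _ Uy sE] cx; have [t1 ht1] := lam_prim_ex p_res lam_char lam_nontriv.
have sh := Hgal_hom hs; have ih := iter_eta_hom i.
have [Zy ny _] := U1_props p_res Uy.
have s1 : s (lam t1) = iter i eta (lam t1).
  rewrite sE iter_eta_lam.
  have -> : eps ^+ (2 * i) * y ^+ 2 * t1 = eps ^+ (2 * i) * t1 + eps ^+ (2 * i) * (y ^+ 2 - 1) * t1 by ring.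
  rewrite (lamD lam_char) (_ : lam (eps ^+ (2 * i) * (y ^+ 2 - 1) * t1) = 1) ?mulr1 //.
  have ny2 : fball 1 (y ^+ 2 - 1).
    by have := near_exp 2 (Zp_fball0 Zy) (fball1 F) ny; rewrite expr1n.
  rewrite (lam_near_nat p_res lam_char (k := 0)) ?expr0 //.
  - exact: (prim_pt lam_char).
  - apply: ZpM; first by apply/ZpX/Zp_eps.
    by apply: ZpB; [exact: ZpX|exact: Zp1].
  - rewrite subr0; apply: (@fball0M _ _ 1) => //.
    by apply/Zp_fball0/ZpX/Zp_eps.
refine (hom_agree (Ef lam) sh ih cyc_E _ cx).
move=> z [zp|->].
    have [j ->] := prim_rootP ht1 zp.
    by rewrite (homX (Ef lam) sh) ?(homX (Ef lam) ih) ?s1 //; exact: E_lam.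
  have qi : quad 'i by exact: i_in_quad.
  by rewrite (Hgal_fix hs qi) iter_eta_quad.
Qed.

Lemma iter_eta_h x : cyc x -> iter h eta x = x.
Proof.
move=> cx; have [t1 ht1] := lam_prim_ex p_res lam_char lam_nontriv.
have ih := iter_eta_hom h.
have hid : homon E id by split.
refine (hom_agree (Ef lam) ih hid cyc_E _ cx).
move=> z [zp|->]; last by rewrite iter_eta_quad //; exact: i_in_quad.
  have [j ->] := prim_rootP ht1 zp.
  rewrite (homX (Ef lam) ih) ?iter_eta_lam ?(eps_h p_res p_odd eps_root) ?mul1r //; exact: E_lam.
Qed.

Lemma iter_eta_inj l x y : E x -> E y -> iter l eta x = iter l eta y -> x = y.
Proof.
have [[_ einj _] _ _ _ _] := eta_gal.
elim: l => [//|l IH] Ex Ey /= H; apply: IH => //.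
by apply: einj; rewrite ?inE //; exact: iter_eta_E.
Qed.

Variable u : R[i].
Hypotheses (u_cyc : cyc u) (u_norm : gal_norm cyc quad u = -1).

Definition eta_prod i := \prod_(0 <= l < i) iter l eta u.

(** The restriction of eta^l to the cyclotomic field, extended by the identity as [Gal] prescribes,
    so that automorphisms can be compared as functions. *)
Let f l x := if `[< cyc x >] then iter l eta x else x.

Let f_in l x : cyc x -> f l x = iter l eta x.
Proof. by move=> cx; rewrite /f; case: asboolP. Qed.

Let f_out l x : ~ cyc x -> f l x = x.
Proof. by move=> cx; rewrite /f; case: asboolP. Qed.

(** An automorphism fixing ['i] is determined by its exponent on a primitive p-th root of unity.
    [fix_quad_square] makes this exponent an even power of a primitive root modulo p, as it is for a
    power of eta. *)
Lemma Gal_cyc : Gal cyc quad = f @` `I_h.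
Proof.
have [t1 ht1] := lam_prim_ex p_res lam_char lam_nontriv.
have c1 : cyc (lam t1) by apply: cyc_gen; exact: prim_expr_order ht1.
have [e [he gam_prim]] := eps_int p_res eps_unit eps_root.
have f1 l : f l (lam t1) = lam t1 ^+ (e ^ (2 * l)).
  rewrite f_in // iter_eta_lam; apply: (lam_near_nat p_res lam_char) => //; first exact: (prim_pt lam_char).
    by apply/ZpX/Zp_eps.
  rewrite natrX; apply: near_exp => //; first exact/Zp_fball0/Zp_eps.
  by rewrite pmulrn; exact: fball_int.
apply/seteqP; split=> [s hs|_ [l lh <-]].
  have [_ hD hM hK hO] := hs; have sh := Gal_hom (quadf R p) hs.
  have sp : s (lam t1) ^+ p = 1.
    by rewrite -(homX cycf sh) // (prim_expr_order ht1) (hom1 sh).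
  have [k sk] := prim_rootP ht1 sp.
  have [l [lh kE]] := fix_quad_square p_pr p_odd ht1 gam_prim cycf sh c1 hK sk.
  exists l => //; apply/funext => x; have [cx|cx] := pselect (cyc x); last by rewrite f_out // hO.
  have ih : homon cyc (iter l eta).
    by have [ih iD iM] := iter_eta_hom l; split=> // y z cy cz; [rewrite iD|rewrite iM] => //; exact: cyc_E.
  rewrite f_in //; symmetry; refine (hom_agree cycf sh ih (fun x h => h) _ cx).
  move=> z [zp|->]; last by rewrite hK ?iter_eta_quad //; exact: i_in_quad.
    have [j ->] := prim_rootP ht1 zp.
    rewrite (homX cycf sh) // (homX (Ef lam) (iter_eta_hom l)); last exact: E_lam.
    rewrite -(f_in l c1) f1 sk; congr (_ ^+ j).
    apply/eqP; rewrite (eq_prim_root_expr ht1) -!(val_Fp_nat p_pr); apply/eqP; congr val.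
    by rewrite kE natrX.
split=> [|x y cx cy|x y cx cy|x qx|x ncx].
- split=> [x cx|x y|y cy].
  + by rewrite f_in //; exact: iter_eta_cyc.
  + rewrite !inE => cx cy; rewrite !f_in //; apply: iter_eta_inj; exact: cyc_E.
  + exists (iter (h - l) eta y); first exact: iter_eta_cyc.
    rewrite f_in; last exact: iter_eta_cyc.
    by rewrite -iterD subnKC ?iter_eta_h // ltnW.
- rewrite !f_in //; last exact: (sfD cycf).
  by have [_ hD _] := iter_eta_hom l; rewrite hD //; exact: cyc_E.
- rewrite !f_in //; last exact: (sfM cycf).
  by have [_ _ hM] := iter_eta_hom l; rewrite hM //; exact: cyc_E.
- by have [cx|cx] := pselect (cyc x); [rewrite f_in // iter_eta_quad|rewrite f_out].
- exact: f_out.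
Qed.

(** The norm runs over distinct automorphisms, so identifying it with the indexed product requires
    the powers of eta below h to be different; they already differ on a primitive p-th root of
    unity. *)
Lemma eta_prod_h : eta_prod h = -1.
Proof.
rewrite -u_norm /gal_norm Gal_cyc fsbig_image; last first.
  move=> l l'; rewrite !inE /= => lh lh' fE.
  have [t1 ht1] := lam_prim_ex p_res lam_char lam_nontriv.
  have c1 : cyc (lam t1) by apply: cyc_gen; exact: prim_expr_order ht1.
  have : f l (lam t1) = f l' (lam t1) by rewrite fE.
  rewrite !f_in // !iter_eta_lam.
  have [e [he gam_prim]] := eps_int p_res eps_unit eps_root.
  have e1 l0 : lam (eps ^+ (2 * l0) * t1) = lam t1 ^+ (e ^ (2 * l0)).
    apply: (lam_near_nat p_res lam_char) => //; first exact: (prim_pt lam_char).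
      by apply/ZpX/Zp_eps.
    rewrite natrX; apply: near_exp => //; first exact/Zp_fball0/Zp_eps.
    by rewrite pmulrn; exact: fball_int.
  rewrite !e1 => /eqP; rewrite (eq_prim_root_expr ht1) -!(val_Fp_nat p_pr) => /eqP/val_inj.
  rewrite !natrX => /eqP; rewrite (eq_prim_root_expr gam_prim) -(half_predK p_res p_odd).
  by rewrite -!muln_modr eqn_pmul2l // !modn_small // => /eqP.
rewrite -(fsbig_ord _ h (fun l => f l u)) /eta_prod big_mkord.
by apply: eq_bigr => l _; rewrite f_in.
Qed.

Lemma u_neq0 : u != 0.
Proof.
apply/negP => /eqP u0; have := eta_prod_h; rewrite /eta_prod.
rewrite -(prednK (h_gt0 p_res p_odd)) big_nat_recl //= u0 mul0r => /eqP.
by rewrite eq_sym oppr_eq0 oner_eq0.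
Qed.

Lemma eta_prod_cyc i : cyc (eta_prod i).
Proof. by apply: (sf_prod cycf) => l _; exact: iter_eta_cyc. Qed.

Lemma eta_prod_neq0 i : eta_prod i != 0.
Proof.
rewrite /eta_prod prodf_seq_neq0; apply/allP => l _ /=.
apply/negP => /eqP; rewrite -(hom0 (Ef lam) (iter_eta_hom l)) => /iter_eta_inj u0.
by have := u_neq0; rewrite u0 ?eqxx //; [exact: cyc_E|exact: (sf0 (Ef lam))].
Qed.

Lemma eta_prodD i j : eta_prod (i + j) = eta_prod i * iter i eta (eta_prod j).
Proof.
rewrite /eta_prod (big_cat_nat (n := i)) ?leq_addr //=; congr (_ * _).
rewrite (hom_prod (Ef lam) (iter_eta_hom i)); last first.
  by move=> l _; apply: cyc_E; exact: iter_eta_cyc.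
rewrite -[X in index_iota X _]add0n big_addn addKn; apply: eq_bigr => l _.
by rewrite -iterD addnC.
Qed.

Lemma sqrt_p_E : E (sqrtC p%:R).
Proof.
have [t1 ht1] := lam_prim_ex p_res lam_char lam_nontriv.
have [e [_ hg]] := eps_int p_res eps_unit eps_root.
by refine (sqrt_p_in p_pr p_odd ht1 hg (Ef lam) _ _); [exact: E_lam|exact: E_i].
Qed.

End Norm.

Local Open Scope classical_set_scope.

(** * Bruhat decomposition *)

Section Bruhat.
Variables (R : realType) (F : nonArchLocalFieldType R) (V : vectType F) (n : nat).
Variable D : polarized_space V n.
Local Notation X := (spX D).
Local Notation Y := (spY D).
Local Notation "<< v , w >>" := (sform D v w).
Local Notation x_ j := ((bX D)`_(nat_of_ord j)).
Local Notation y_ j := ((bY D)`_(nat_of_ord j)).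

Lemma sformN v w : <<v, w>> = - <<w, v>>.
Proof.
have := sform_alt D (v + w); rewrite linearDl !linearDr !sform_alt add0r addr0.
by move=> /eqP; rewrite addr_eq0 => /eqP.
Qed.

Lemma mem_x (j : 'I_n) : x_ j \in X.
Proof. by apply: (basis_mem (bX_basis D)); rewrite mem_nth ?size_tuple. Qed.

Lemma mem_y (j : 'I_n) : y_ j \in Y.
Proof. by apply: (basis_mem (bY_basis D)); rewrite mem_nth ?size_tuple. Qed.

Lemma sformXX v w : v \in X -> w \in X -> <<v, w>> = 0.
Proof. by have [h _] := spX_max D; exact: h. Qed.

Lemma sformYY v w : v \in Y -> w \in Y -> <<v, w>> = 0.
Proof. by have [h _] := spY_max D; exact: h. Qed.

Lemma sformyx (i j : 'I_n) : <<y_ i, x_ j>> = - (i == j)%:R.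
Proof. by rewrite sformN sform_dual eq_sym. Qed.

Lemma spX_expand v : v \in X -> v = \sum_(j < n) <<v, y_ j>> *: x_ j.
Proof.
move=> vX; rewrite {1}(coord_basis (bX_basis D) vX); apply: eq_bigr => j _; congr (_ *: _).
rewrite [in RHS](coord_basis (bX_basis D) vX) linear_sumlz (bigD1 j) //= big1 ?addr0 => [|k kj].
  by rewrite linearZl_LR /= sform_dual eqxx mulr1.
by rewrite linearZl_LR /= sform_dual (negPf kj) mulr0.
Qed.

Lemma spY_expand v : v \in Y -> v = \sum_(j < n) <<x_ j, v>> *: y_ j.
Proof.
move=> vY; rewrite {1}(coord_basis (bY_basis D) vY); apply: eq_bigr => j _; congr (_ *: _).
rewrite [in RHS](coord_basis (bY_basis D) vY) linear_sumr (bigD1 j) //= big1 ?addr0 => [|k kj].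
  by rewrite linearZr_LR /= sform_dual eqxx mulr1.
by rewrite linearZr_LR /= sform_dual eq_sym (negPf kj) mulr0.
Qed.

Lemma prX_in v : prX D v \in X. Proof. exact: memv_pi. Qed.
Lemma prY_in v : prY D v \in Y. Proof. exact: memv_pi. Qed.

Lemma prXY v : prX D v + prY D v = v.
Proof. by apply: daddv_pi_add; rewrite ?spXY_cap ?spXY_sum ?memvf. Qed.

Lemma prX_id v : v \in X -> prX D v = v.
Proof. by apply: daddv_pi_id; rewrite spXY_cap. Qed.

Lemma prY_id v : v \in Y -> prY D v = v.
Proof. by apply: daddv_pi_id; rewrite capvC spXY_cap. Qed.

Lemma prY_X v : v \in X -> prY D v = 0.
Proof. by move=> /prX_id h; apply: (addrI v); rewrite addr0 -{1}h prXY. Qed.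

Lemma prX_Y v : v \in Y -> prX D v = 0.
Proof. by move=> /prY_id h; apply: (addIr v); rewrite add0r -{2}h prXY. Qed.

Lemma prXE v : prX D v = \sum_(j < n) <<v, y_ j>> *: x_ j.
Proof.
rewrite {1}(spX_expand (prX_in v)); apply: eq_bigr => j _; congr (_ *: _).
by rewrite -{2}(prXY v) linearDl [<<prY D v, _>>]sformYY ?addr0 ?prY_in ?mem_y.
Qed.

Lemma prYE v : prY D v = \sum_(j < n) <<x_ j, v>> *: y_ j.
Proof.
rewrite {1}(spY_expand (prY_in v)); apply: eq_bigr => j _; congr (_ *: _).
by rewrite -{2}(prXY v) linearDr [<<_, prX D v>>]sformXX ?add0r ?prX_in ?mem_x.
Qed.

Lemma polar_expand v :
  v = \sum_(j < n) <<v, y_ j>> *: x_ j + \sum_(j < n) <<x_ j, v>> *: y_ j.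
Proof. by rewrite -prXE -prYE prXY. Qed.

Lemma Y_mem v : (forall j : 'I_n, <<v, y_ j>> = 0) -> v \in Y.
Proof.
by move=> h; rewrite -(prXY v) prXE big1 ?add0r ?prY_in // => j _; rewrite h scale0r.
Qed.

(** The map sending x_j to [f j] and y_j to [e j]; the form supplies the coordinates of [v]. *)
Definition Lfe_fun (f e : 'I_n -> V) (v : V) : V :=
  \sum_(j < n) <<v, y_ j>> *: f j + \sum_(j < n) <<x_ j, v>> *: e j.

Fact Lfe_linear f e : linear (Lfe_fun f e).
Proof.
move=> a v w; rewrite /Lfe_fun scalerDr addrACA.
by congr (_ + _); rewrite scaler_sumr -big_split; apply: eq_bigr => j _ /=; rewrite ?linearPl ?linearPr /= scalerDl scalerA.
Qed.
HB.instance Definition _ f e := GRing.isLinear.Build F V V _ (Lfe_fun f e) (Lfe_linear f e).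

Definition Lfe f e : 'End(V) := linfun (Lfe_fun f e).

Lemma LfeE f e v : Lfe f e v = \sum_(j < n) <<v, y_ j>> *: f j + \sum_(j < n) <<x_ j, v>> *: e j.
Proof. by rewrite lfunE. Qed.

Lemma Lfe_x f e (j : 'I_n) : Lfe f e (x_ j) = f j.
Proof.
rewrite LfeE [X in _ + X]big1 => [|k _]; last by rewrite sformXX ?mem_x // scale0r.
rewrite addr0 (bigD1 j) //= sform_dual eqxx scale1r big1 ?addr0 // => k kj.
by rewrite sform_dual eq_sym (negPf kj) scale0r.
Qed.

Lemma Lfe_y f e (j : 'I_n) : Lfe f e (y_ j) = e j.
Proof.
rewrite LfeE [X in X + _]big1 => [|k _]; last by rewrite sformYY ?mem_y // scale0r.
rewrite add0r (bigD1 j) //= sform_dual eqxx scale1r big1 ?addr0 // => k kj.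
by rewrite sform_dual (negPf kj) scale0r.
Qed.

Lemma End_eq (g g' : 'End(V)) : (forall j : 'I_n, g (x_ j) = g' (x_ j)) ->
  (forall j : 'I_n, g (y_ j) = g' (y_ j)) -> g = g'.
Proof.
move=> gx gy; apply/lfunP => v; rewrite (polar_expand v) !linearD !linear_sum /=.
by congr (_ + _); apply: eq_bigr => j _; rewrite !linearZ /= ?gx ?gy.
Qed.

Definition sbasis (f e : 'I_n -> V) := [/\ forall j k, <<f j, e k>> = (j == k)%:R,
  forall j k, <<f j, f k>> = 0 & forall j k, <<e j, e k>> = 0].

Lemma Lfe_form f e v w : sbasis f e -> << Lfe f e v, Lfe f e w >> =
  \sum_(j < n) (<<v, y_ j>> * <<x_ j, w>> - <<x_ j, v>> * <<w, y_ j>>).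
Proof.
move=> [fe ff ee].
have ef j k : <<e j, f k>> = - (j == k)%:R by rewrite sformN fe eq_sym.
rewrite !LfeE linearDl linear_sumlz [X in _ + X]linear_sumlz -big_split; apply: eq_bigr => j _ /=.
rewrite !linearZl_LR /= !linearDr !linear_sumr /= (bigD1 j) //= big1 => [|k kj]; last first.
  by rewrite linearZr_LR /= ff mulr0.
rewrite linearZr_LR /= ff mulr0 addr0 add0r.
rewrite (bigD1 j) //= big1 => [|k kj]; last by rewrite linearZr_LR /= fe eq_sym (negPf kj) mulr0.
rewrite linearZr_LR /= fe eqxx mulr1 addr0; congr (_ + _).
rewrite [X in _ * (_ + X)]big1 => [|k _]; last by rewrite linearZr_LR /= ee mulr0.
rewrite addr0 (bigD1 j) //= big1 => [|k kj]; last by rewrite linearZr_LR /= ef eq_sym (negPf kj) oppr0 mulr0.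
by rewrite linearZr_LR /= ef eqxx addr0 mulrN1 mulrN.
Qed.

Lemma sbasis_xy : sbasis (fun j => x_ j) (fun j => y_ j).
Proof.
by split=> j k; [exact: sform_dual|rewrite sformXX ?mem_x|rewrite sformYY ?mem_y].
Qed.

Lemma Lfe_Sp f e : sbasis f e -> Sp D (Lfe f e).
Proof.
move=> fe v w; rewrite Lfe_form // -(Lfe_form _ _ sbasis_xy).
have -> : Lfe (fun j => x_ j) (fun j => y_ j) = \1%VF.
  by apply: End_eq => j; rewrite ?Lfe_x ?Lfe_y lfunE.
by rewrite !lfunE.
Qed.

Lemma Sp_lker0 g : Sp D g -> lker g == 0%VS.
Proof.
move=> gS; rewrite -subv0; apply/subvP => v; rewrite memv_ker memv0 => /eqP gv.
by apply/eqP/(sform_nondeg (p := D)) => w; rewrite -gS gv linear0l.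
Qed.

Lemma Sp_inv g : Sp D g -> Sp D g^-1%VF.
Proof.
by move=> gS v w; rewrite -gS !lker0_lfunVK // Sp_lker0.
Qed.

Lemma parabolicP g : Sp D g -> (forall j : 'I_n, g (y_ j) \in Y) -> parabolic D g.
Proof.
move=> gS gy; split=> //; apply/eqP; rewrite eqEdim; apply/andP; split.
  apply/subvP => _ /memv_imgP[v vY ->]; rewrite (spY_expand vY) linear_sum.
  by apply: memv_suml => j _ /=; rewrite linearZ; apply: memvZ; exact: gy.
by rewrite limg_dim_eq // (eqP (Sp_lker0 gS)) capv0.
Qed.

Lemma parabolic_inv g : parabolic D g -> parabolic D g^-1%VF.
Proof.
move=> [gS gY]; split; first exact: Sp_inv.
rewrite -{1}gY -limg_comp (_ : (_ \o _)%VF = \1%VF); first by rewrite lim1g.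
by apply/lfunP => v; rewrite !lfunE /= lker0_lfunK // Sp_lker0.
Qed.

Lemma tau_ex i : exists t, is_tau D i t /\ Sp D t.
Proof.
pose f (j : 'I_n) := if (j < i)%N then - y_ j else x_ j.
pose e (j : 'I_n) := if (j < i)%N then x_ j else y_ j.
exists (Lfe f e); split=> [j|]; first by rewrite Lfe_x Lfe_y.
have neq (j k : 'I_n) : (j < i)%N -> (k < i)%N = false -> (j == k) = false.
  by move=> ji ki; apply/eqP => jk; rewrite jk ki in ji.
apply: Lfe_Sp; split=> j k; rewrite /f /e; case: (ltnP j i) => ji; case: (ltnP k i) => ki.
- by rewrite linearNl sformyx opprK.
- by rewrite linearNl sformYY ?mem_y // oppr0 neq // ltnNge ki.
- by rewrite sformXX ?mem_x // eq_sym neq // ltnNge ji.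
- by rewrite sform_dual.
- by rewrite linearNl linearNr sformYY ?mem_y // !oppr0.
- by rewrite linearNl sformyx neq ?oppr0 // ltnNge ki.
- by rewrite linearNr sform_dual eq_sym neq ?oppr0 // ltnNge ji.
- by rewrite sformXX ?mem_x.
- by rewrite sformXX ?mem_x.
- by rewrite sform_dual neq // ltnNge ki.
- by rewrite sformyx eq_sym neq ?oppr0 // ltnNge ji.
- by rewrite sformYY ?mem_y.
Qed.

Lemma mem_ker_c g v : (v \in ker_c D g) = (v \in Y) && (g v \in Y).
Proof.
rewrite /ker_c memv_cap memv_ker lfunE /=; congr (_ && _).
apply/eqP/idP => [h|]; last exact: prX_Y.
by rewrite -(prXY (g v)) h add0r prY_in.
Qed.

Lemma dim_Y : \dim Y = n. Proof. exact: size_basis (bY_basis D). Qed.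

Lemma dim_Yq_le g : (dim_Yq D g <= n)%N.
Proof. by rewrite /dim_Yq dim_Y leq_subr. Qed.

(** A basis of a complement of ker c in Y followed by a basis of ker c. The order matches tau_i,
    which exchanges the first i pairs and fixes the others. *)
Lemma adapted_basis g : exists e : 'I_n -> V, [/\ forall j, e j \in Y,
  forall v : 'I_n -> F, \sum_j v j *: e j = 0 -> forall j, v j = 0,
  forall j : 'I_n, (dim_Yq D g <= j)%N -> e j \in ker_c D g &
  forall v : 'I_n -> F, (forall j : 'I_n, (dim_Yq D g <= j)%N -> v j = 0) ->
    \sum_j v j *: e j \in ker_c D g -> forall j, v j = 0].
Proof.
set K := ker_c D g; set C := (Y :\: K)%VS.
have KY : (K <= Y)%VS by exact: capvSl.
have CKY : (C + K)%VS = Y by rewrite addv_diff; apply/addv_idPl.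
have CK0 : (C :&: K = 0)%VS by exact: capv_diff.
have dimC : \dim C = dim_Yq D g.
  by rewrite /dim_Yq -(dimv_cap_compl Y K) (capv_idPr KY) addKn.
pose s := vbasis C ++ vbasis K.
have s_size : size s = n.
  by rewrite size_cat !size_tuple -dim_Y -CKY dimv_disjoint_sum.
have s_basis : basis_of Y s.
  by rewrite -CKY cat_basis ?vbasisP //; apply/directv_addP.
have s_free := basis_free s_basis.
pose e (j : 'I_n) := s`_j.
have e_free (v : 'I_n -> F) : \sum_j v j *: e j = 0 -> forall j, v j = 0.
  move=> h j; have js : (j < size s)%N by rewrite s_size.
  have H := elimT (@freeP _ _ _ (in_tuple s)) s_free.
  pose w (i : 'I_(size s)) := v (cast_ord s_size i).
  have -> : v j = w (Ordinal js) by congr v; exact: val_inj.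
  apply: H; rewrite -[RHS]h (reindex (cast_ord s_size)) /=; last first.
    by exists (cast_ord (esym s_size)) => i _; exact: val_inj.
  by apply: eq_bigr.
have szC : size (vbasis C) = dim_Yq D g by rewrite size_tuple dimC.
have tailK (j : 'I_n) : (dim_Yq D g <= j)%N -> e j \in K.
  move=> ij; rewrite /e nth_cat szC ltnNge ij /=.
  apply: vbasis_mem; apply: mem_nth; rewrite size_tuple ltn_subLR //.
  by rewrite -dimC -dimv_disjoint_sum // CKY dim_Y.
have headC (j : 'I_n) : (j < dim_Yq D g)%N -> e j \in C.
  move=> ij; rewrite /e nth_cat szC ij.
  by apply: vbasis_mem; apply: mem_nth; rewrite szC.
exists e; split=> // [j|v hv vK].
  by apply: (basis_mem s_basis); rewrite mem_nth ?s_size.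
apply: e_free; apply/eqP; rewrite -memv0 -CK0 memv_cap vK andbT.
apply: memv_suml => j _; case: (ltnP j (dim_Yq D g)) => ij; first exact/memvZ/headC.
by rewrite hv // scale0r mem0v.
Qed.

Lemma dual_in_X (e : 'I_n -> V) : (forall j, e j \in Y) ->
  (forall v : 'I_n -> F, \sum_j v j *: e j = 0 -> forall j, v j = 0) ->
  exists f : 'I_n -> V, (forall j, f j \in X) /\ forall j k, <<f j, e k>> = (j == k)%:R.
Proof.
move=> eY e_free; pose A : 'M[F]_n := \matrix_(l, k) <<x_ l, e k>>.
have A_unit : A \in unitmx.
  rewrite -unitmx_tr -row_free_unit; apply: inj_row_free => v vA.
  have : \sum_k v ord0 k *: e k = 0.
    have vY : \sum_k v ord0 k *: e k \in Y by apply: memv_suml => k _; exact/memvZ/eY.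
    rewrite (spY_expand vY) big1 // => l _; rewrite linear_sumr.
    move/rowP: vA => /(_ l); rewrite !mxE => vAl.
    have -> : \sum_k <<x_ l, v ord0 k *: e k>> = 0; last by rewrite scale0r.
    rewrite -[RHS]vAl; apply: eq_bigr => k _.
    by rewrite linearZr_LR /= !mxE.
  by move=> /e_free v0; apply/rowP => k; rewrite mxE (v0 k).
exists (fun j => \sum_l invmx A j l *: x_ l); split=> [j|j k].
  by apply: memv_suml => l _; exact/memvZ/mem_x.
have : (invmx A *m A) j k = (j == k)%:R by rewrite mulVmx // mxE.
move=> <-; rewrite mxE linear_sumlz; apply: eq_bigr => l _.
by rewrite linearZl_LR /= mxE.
Qed.

(** Since Y is its own orthogonal, a vector of Y orthogonal to g^-1 Y lies in ker c. The Gram matrix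
    [N] between g^-1 Y and the first i vectors therefore has full column rank, and a left inverse of
    it provides the dual vectors. *)
Lemma dual_in_gY g (i : nat) (e : 'I_n -> V) : Sp D g -> (forall j, e j \in Y) -> (i <= n)%N ->
  (forall v : 'I_n -> F, (forall j : 'I_n, (i <= j)%N -> v j = 0) ->
    \sum_j v j *: e j \in ker_c D g -> forall j, v j = 0) ->
  exists f : 'I_n -> V, (forall j, g (f j) \in Y) /\
    forall j k : 'I_n, (j < i)%N -> (k < i)%N -> <<f j, e k>> = (j == k)%:R.
Proof.
move=> gS eY i_le e_ind; pose wid := widen_ord i_le.
pose N : 'M[F]_(n, i) := \matrix_(l, k) <<g^-1%VF (y_ l), e (wid k)>>.
have gV v : g (g^-1%VF v) = v by rewrite lker0_lfunVK // Sp_lker0.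
have N_full : row_full N.
  rewrite /row_full -mxrank_tr -[_ == _]/(row_free N^T); apply: inj_row_free => v vN.
  pose w (j : 'I_n) : F := if insub (nat_of_ord j) is Some k then v ord0 k else 0.
  have wE (k : 'I_i) : w (wid k) = v ord0 k.
    by rewrite /w (_ : nat_of_ord (wid k) = val k) // valK.
  have w0 (j : 'I_n) : (i <= j)%N -> w j = 0.
    by move=> ij; rewrite /w insubF // ltnNge ij.
  have sumE : \sum_j w j *: e j = \sum_(k < i) v ord0 k *: e (wid k).
    rewrite (bigID (fun j : 'I_n => (j < i)%N)) /= [X in _ + X]big1 => [|j]; last first.
      by rewrite -leqNgt => /w0->; rewrite scale0r.
    rewrite addr0 (big_ord_narrow i_le) /=; apply: eq_bigr => k _.
    by rewrite -wE.
  have /(_ _) w_0 := e_ind w w0.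
  apply/rowP => k; rewrite mxE -wE; apply: w_0.
  rewrite mem_ker_c; apply/andP; split; first by apply: memv_suml => j _; exact/memvZ/eY.
  apply: Y_mem => l; rewrite sumE sformN -[y_ l]gV gS linear_sumr /=.
  move/rowP: vN => /(_ l); rewrite !mxE => vNl.
  rewrite -[RHS]oppr0 -[in RHS]vNl; congr (- _); apply: eq_bigr => m _.
  by rewrite linearZr_LR /= !mxE.
pose M := pinvmx N.
have MN : M *m N = 1%:M by exact: mulVpmx.
exists (fun j => if insub (nat_of_ord j) is Some k then \sum_l M k l *: g^-1%VF (y_ l) else 0).
split=> [j|j k ji ki].
  case: insubP => [m _ _|_]; last by rewrite linear0 mem0v.
  by rewrite linear_sum; apply: memv_suml => l _ /=; rewrite linearZ /= gV; exact/memvZ/mem_y.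
rewrite (@insubT _ (fun x => x < i)%N _ _ ji) /=.
have <- : (M *m N) (Ordinal ji) (Ordinal ki) = (j == k)%:R by rewrite MN mxE.
rewrite mxE linear_sumlz; apply: eq_bigr => l _; rewrite linearZl_LR /=.
have -> : N l (Ordinal ki) = <<g^-1%VF (y_ l), e k>> by rewrite mxE; congr (<<_, e _>>); exact: val_inj.
by congr (M _ _ * _); exact: val_inj.
Qed.

(** Existence guarantees that the pair chosen by [decomp] really decomposes g. A symplectic basis
    (f, e) adapted to ker c is built so that g maps it, up to the exchange by tau_i, to a symplectic
    basis whose second half lies in Y; these two bases define p1^-1 and p2. *)
Lemma bruhat g : Sp D g -> exists p : 'End(V) * 'End(V),
  [/\ parabolic D p.1, parabolic D p.2 &
     exists2 t, is_tau D (dim_Yq D g) t & g = (p.2 \o (t \o p.1))%VF].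
Proof.
move=> gS; set i := dim_Yq D g.
have [e [eY e_free eK e_ind]] := adapted_basis g.
have [f' [f'X f'e]] := dual_in_X eY e_free.
have [f0 [f0Y f0e]] := dual_in_gY gS eY (dim_Yq_le g) e_ind.
pose low (j : 'I_n) := (j < i)%N.
(* For j >= i the correction by the low [e l] makes f j orthogonal to the f0 l, and it keeps the
   duality with [e] because Y is isotropic. *)
pose f j := if low j then f0 j else f' j + \sum_(l < n | low l) <<f' j, f0 l>> *: e l.
have geY (j : 'I_n) : low j = false -> g (e j) \in Y.
  by move/negbT; rewrite -leqNgt => /eK; rewrite mem_ker_c => /andP[].
have f0e_all (j k : 'I_n) : low j -> <<f0 j, e k>> = (j == k)%:R.
  move=> ji; case ki : (low k); first exact: f0e.
  have -> : (j == k) = false by apply/eqP => jk; rewrite jk ki in ji.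
  by rewrite -gS sformYY ?geY.
have fe j k : <<f j, e k>> = (j == k)%:R.
  rewrite /f; case: ifP => [ji|_]; first exact: f0e_all.
  rewrite linearDl f'e linear_sumlz big1 ?addr0 // => l _.
  by rewrite linearZl_LR /= [<<e l, _>>]sformYY ?mulr0.
have f0f0 (j k : 'I_n) : <<f0 j, f0 k>> = 0 by rewrite -gS sformYY.
have ff_mixed (j k : 'I_n) : low j -> low k = false -> <<f j, f k>> = 0.
  move=> ji ki; rewrite /f ji ki linearDr linear_sumr (bigD1 j) //= big1 => [|l /andP[_ lj]].
    by rewrite linearZr_LR /= f0e_all // eqxx mulr1 addr0 [<<f0 j, f' k>>]sformN addNr.
  by rewrite linearZr_LR /= f0e_all // eq_sym (negPf lj) mulr0.
have ff j k : <<f j, f k>> = 0.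
  case ji : (low j); case ki : (low k).
  - by rewrite /f ji ki.
  - exact: ff_mixed.
  - by rewrite sformN ff_mixed // oppr0.
  pose S m := \sum_(l < n | low l) <<f' m, f0 l>> *: e l.
  have SY m : S m \in Y by apply: memv_suml => l _; exact/memvZ/eY.
  have f'S m m' : low m = false -> <<f' m, S m'>> = 0.
    move=> mi; rewrite linear_sumr big1 // => l li.
    rewrite linearZr_LR /= f'e (_ : (m == l) = false) ?mulr0 //.
    by apply/eqP => ml; rewrite -ml mi in li.
  rewrite /f ji ki linearDl !linearDr sformXX // f'S // [<<S j, f' k>>]sformN f'S //.
  rewrite sformYY; [by rewrite oppr0 !addr0|exact: SY|exact: SY].
have ee j k : <<e j, e k>> = 0 by rewrite sformYY.
have fgY (j : 'I_n) : low j -> g (f j) \in Y by move=> ji; rewrite /f ji.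
have sfe : sbasis f e by split.
have qS := Lfe_Sp sfe; set q := Lfe f e in qS.
have [t [t_tau tS]] := tau_ex i.
(* On low indices the images of the two halves are exchanged, with a sign in [e2], to absorb
   tau_i. *)
pose f2 j := if low j then g (e j) else g (f j).
pose e2 j := if low j then - g (f j) else g (e j).
have neq (j k : 'I_n) : low j -> low k = false -> (j == k) = false.
  by move=> ji ki; apply/eqP => jk; rewrite jk ki in ji.
have ef j k : <<e j, f k>> = - (j == k)%:R by rewrite sformN fe eq_sym.
have s2 : sbasis f2 e2.
  split=> j k; rewrite /f2 /e2; case ji : (low j); case ki : (low k);
    rewrite ?linearNl ?linearNr gS ?fe ?ef ?ff ?ee ?oppr0 ?opprK //;
    first [by rewrite neq // ?oppr0 | by rewrite eq_sym neq // ?oppr0].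
exists (q^-1%VF, Lfe f2 e2); split=> /=.
- apply: parabolic_inv; apply: parabolicP => // j.
  by rewrite Lfe_y.
- apply: parabolicP; first exact: Lfe_Sp.
  move=> j; rewrite Lfe_y /e2; case: ifP => ji; first by rewrite memvN fgY.
  exact: geY.
exists t => //.
have qK : cancel q q^-1%VF by apply: lker0_lfunK; exact: Sp_lker0.
have gq : (g \o q)%VF = (Lfe f2 e2 \o t)%VF.
  apply: End_eq => j; rewrite !lfunE /= /q ?Lfe_x ?Lfe_y; have [tx ty] := t_tau j.
    rewrite tx; case: ifP => ji; last by rewrite Lfe_x /f2 /low ji.
    by rewrite linearN /= Lfe_y /e2 /low ji opprK.
  rewrite ty; case: ifP => ji; first by rewrite Lfe_x /f2 /low ji.
  by rewrite Lfe_y /e2 /low ji.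
rewrite comp_lfunA -gq -comp_lfunA lker0_compfV ?comp_lfun1r //.
exact: Sp_lker0.
Qed.

Section Decomp.
Variable g : 'End(V).
Hypothesis gS : Sp D g.
Local Notation i := (dim_Yq D g).
Let p1 := (decomp D g).1.
Let p2 := (decomp D g).2.

Lemma decompP : [/\ parabolic D p1, parabolic D p2 &
     exists2 t, is_tau D i t & g = (p2 \o (t \o p1))%VF].
Proof. by have := xgetPex (\1%VF, \1%VF) (bruhat gS). Qed.

Definition hY (y : V) : 'rV[F]_i := \row_(k < i) << x_ k, p1 y >>.

(** A linear section of [hY]; it picks the representatives of Y_g at which integrands are
    evaluated. *)
Definition ysec (v : 'rV[F]_i) : V :=
  p1^-1%VF (\sum_(k < i) v ord0 k *: y_ k).

Let y_mem k : (k < i)%N -> (bY D)`_k \in Y.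
Proof. by move=> ki; exact: (mem_y (Ordinal (leq_trans ki (dim_Yq_le g)))). Qed.

Lemma p1Y v : (p1 v \in Y) = (v \in Y).
Proof.
have [[p1S p1Yv] _ _] := decompP.
apply/idP/idP => [|vY]; last by rewrite -p1Yv memv_img.
by rewrite -{1}p1Yv => /memv_imgP[w wY /(lker0P (Sp_lker0 p1S)) ->].
Qed.

Lemma ysec_Y v : ysec v \in Y.
Proof.
have [[p1S _] _ _] := decompP.
rewrite -p1Y lker0_lfunVK ?Sp_lker0 //; apply: memv_suml => k _; exact/memvZ/y_mem.
Qed.

Lemma hY_ysec v : hY (ysec v) = v.
Proof.
have [[p1S _] _ _] := decompP.
apply/rowP => k; rewrite mxE lker0_lfunVK ?Sp_lker0 // linear_sumr (bigD1 k) //=.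
pose w (l : 'I_i) := widen_ord (dim_Yq_le g) l.
have xy (l : 'I_i) : <<x_ k, y_ l>> = (k == l)%:R by exact (@sform_dual _ _ _ D (w k) (w l)).
rewrite linearZr_LR /= xy eqxx mulr1 big1 ?addr0 // => l lk.
by rewrite linearZr_LR /= xy eq_sym (negPf lk) mulr0.
Qed.

(** As p1 and p2 preserve Y, the vector g y lies in Y exactly when tau_i (p1 y) does, that is, when
    the first i coordinates of p1 y vanish. Hence [hY] identifies Y_g with F^i. *)
Lemma hY_ker y : y \in Y -> (hY y == 0) = (y \in ker_c D g).
Proof.
move=> yY; have [[p1S _] [p2S p2Yv] [t t_tau gE]] := decompP.
have p1yY : p1 y \in Y by rewrite p1Y.
have p2Y v : (p2 v \in Y) = (v \in Y).
  apply/idP/idP => [|vY]; last by rewrite -p2Yv memv_img.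
  by rewrite -{1}p2Yv => /memv_imgP[w wY /(lker0P (Sp_lker0 p2S)) ->].
have gy : g y = p2 (t (p1 y)) by move/lfunP: gE => /(_ y); rewrite !lfunE /= lfunE.
rewrite mem_ker_c yY gy p2Y /=.
have tE : t (p1 y) = \sum_(j < n) <<x_ j, p1 y>> *: (if (j < i)%N then x_ j else y_ j).
  rewrite {1}(spY_expand p1yY) linear_sum; apply: eq_bigr => j _ /=.
  by rewrite linearZ; congr (_ *: _); have [_] := t_tau j.
apply/eqP/idP => [h0|tY].
  rewrite tE; apply: memv_suml => j _; case: ifP => ji; last exact/memvZ/mem_y.
  by move/rowP: h0 => /(_ (Ordinal ji)); rewrite !mxE /= => ->; rewrite scale0r mem0v.
apply/rowP => k; rewrite !mxE; pose j := widen_ord (dim_Yq_le g) k.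
have := sformYY tY (mem_y j); rewrite tE linear_sumlz (bigD1 j) //= ltn_ord linearZl_LR /=.
rewrite (@sform_dual _ _ _ D j j) eqxx mulr1 big1 ?addr0 // => l lj; rewrite linearZl_LR /=.
case: ifP => _; first by rewrite (@sform_dual _ _ _ D l j) (negPf lj) mulr0.
by rewrite [<<y_ l, _>>]sformYY ?mulr0 ?mem_y //; exact: (mem_y j).
Qed.

End Decomp.

End Bruhat.

Local Open Scope classical_set_scope.

Local Open Scope quotient_scope.

(** * Integration over the quotient of Y *)

Section RowTransversal.
Variables (R : realType) (F : nonArchLocalFieldType R) (d : nat).

Definition transvR (I : finType) (rho : I -> 'rV[F]_d) (a b : int) :=
  (forall i, rball a (rho i)) /\
  forall v, rball a v -> exists! i, rball b (v - rho i).

Lemma transvR_ex (a : int) (n : nat) : exists (I : finType) (rho : I -> 'rV[F]_d),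
  transvR rho a (a + n%:Z).
Proof.
have [I [rho [_ [rho_in rho_ex]]]] := transv_ex F a n.
exists {ffun 'I_d -> I}, (fun s : {ffun 'I_d -> I} => \row_k rho (s k)); split=> [s k|v hv].
  by rewrite mxE.
have /choice[s hs] k : exists i, unique (fun i => fball (a + n%:Z) (v ord0 k - rho i)) i.
  by have [i hi] := rho_ex _ (hv k); exists i.
exists [ffun k => s k]; split=> [k|s' hs'].
  by rewrite !mxE ffunE; have [] := hs k.
apply/ffunP => k; rewrite ffunE; have [_ sU] := hs k; apply: sU.
by have := hs' k; rewrite !mxE.
Qed.

Lemma transvR_shift (I : finType) (rho : I -> 'rV[F]_d) a b t :
  transvR rho a b -> rball a t -> transvR (fun i => rho i + t) a b.
Proof.
move=> [rho_in rho_ex] ht; split=> [i|x hx]; first exact: rballD.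
have [i [hi iU]] := rho_ex (x - t) (rballB hx ht).
exists i; split=> [|j hj]; first by rewrite opprD addrA addrAC.
by apply: iU; move: hj; rewrite opprD addrA addrAC.
Qed.

Lemma rball_unit m (t : F) v : absv t = 1 -> @rball _ F d m (t *: v) <-> rball m v.
Proof. by move=> t1; split=> hv k; have := hv k; rewrite mxE fball_unit. Qed.

Lemma transvR_scale (I : finType) (rho : I -> 'rV[F]_d) a b t :
  transvR rho a b -> absv t = 1 -> transvR (fun i => t *: rho i) a b.
Proof.
move=> [rho_in rho_ex] t1; have t0 : t != 0 by rewrite -absv_eq0 t1 oner_neq0.
split=> [i|x hx]; first exact/rball_unit.
have E i : x - t *: rho i = t *: (t^-1 *: x - rho i) by rewrite scalerBr scalerA mulfV // scale1r.
have [i [hi iU]] : exists! i, rball b (t^-1 *: x - rho i).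
  by apply: rho_ex; apply/rball_unit => //; rewrite absvV t1 invr1.
exists i; split=> [|j]; first by rewrite E; exact/rball_unit.
by rewrite E => /rball_unit h; apply: iU; exact: h.
Qed.

Definition rnice (m : nat) (H : 'rV[F]_d -> R[i]) :=
  (forall v h, rball m h -> H (v + h) = H v) /\ (forall v, H v != 0 -> rball (- m%:Z) v).

Lemma rnice_le (a b : nat) H : (a <= b)%N -> rnice a H -> rnice b H.
Proof.
move=> ab [inv supp]; split=> [x h hh|x /supp]; last by apply: rball_sub; rewrite lerN2.
by apply: inv; apply: rball_sub hh.
Qed.

Lemma row_linear_bounded (U : vectType F) (f : 'Hom('rV[F]_d, U)) :
  exists c : nat, forall (m : int) v, rball m v -> vball (m - c%:Z) (f v).
Proof.
have [c hc] := @sup_ball _ F _ (fun p : 'I_d * 'I_(dim U) => v2r (f (delta_mx ord0 p.1)) ord0 p.2).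
exists c => m v hv k; rewrite [v]row_sum_delta linear_sum raddf_sum summxE.
apply: fball_sum => i _ /=; rewrite !linearZ mxE.
by apply: fballM => //; exact: (hc (i, k)).
Qed.

Lemma linear_row_bounded (U : vectType F) (f : 'Hom(U, 'rV[F]_d)) :
  exists c : nat, forall (m : int) v, vball m v -> rball (m - c%:Z) (f v).
Proof.
pose e i : U := r2v (delta_mx ord0 i).
have [c hc] := @sup_ball _ F _ (fun p : 'I_(dim U) * 'I_d => f (e p.1) ord0 p.2).
exists c => m v hv k; rewrite [v]vect_expand linear_sum summxE.
apply: fball_sum => i _ /=; rewrite linearZ mxE.
by apply: fballM => //; exact: (hc (i, k)).
Qed.

End RowTransversal.

Section YqIntegral.
Variables (R : realType) (F : nonArchLocalFieldType R) (V : vectType F) (n : nat).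
Variable D : polarized_space V n.
Local Notation Y := (spY D).
Variable mu : {measure set (borel F) -> \bar R}.
Hypothesis mu_haar : haar_measure mu.
Variable muX : forall i : nat, {measure set (borel 'rV[F]_i) -> \bar R}.
Hypothesis muX_prod : forall i : nat, product_haar mu (muX i).

Lemma borel_continuous (T T' : ptopologicalType) (f : T -> T') :
  continuous f -> @measurable_fun _ _ (borel T) (borel T') setT f.
Proof.
move=> f_cont; apply: (@measurability _ _ (borel T) (borel T') setT f (@open T')) => //.
move=> _ [B B_open <-]; rewrite setTI; apply: borel_open.
by move/continuousP: f_cont; apply.
Qed.

Lemma muX_rball i (v : 'rV[F]_i) (m : int) :
  muX i [set w | rball m (w - v)] = (vol mu m ^+ i)%:E.
Proof.
have := @muX_prod i (fun k => [set t : F | fball m (t - v ord0 k)]) _.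
rewrite (_ : [set t | _] = [set w | rball m (w - v)]); last first.
  by apply/seteqP; split=> w hw k; have := hw k; rewrite /= !mxE.
move=> -> => [|k]; last by apply: (@borel_open F); exact: ball_open.
rewrite (eq_bigr (fun=> (vol mu m)%:E)) => [|k _]; last exact: mu_ball.
by rewrite big_const card_ord /= -[RHS]/((vol mu m ^+ i)%:E); elim: i {v} => [|j IH] //=; rewrite IH exprS EFinM.
Qed.

Variable g : 'End(V).
Hypothesis gS : Sp D g.
Local Notation i := (dim_Yq D g).
Local Notation Yq := (Yq D g).
Local Notation ys := (@ysec R F V n D g).

Definition Yrep (w : Yq) : V := vsval (generic_quotient.repr w : subvs_of Y).

Lemma Yrep_Y w : Yrep w \in Y. Proof. exact: subvsP. Qed.

Definition Ypi (y : V) : Yq := \pi_Yq (vsproj Y y : fdtop (subvs_of Y)).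

Lemma pi_YqP (a b : fdtop (subvs_of Y)) : \pi_Yq a = \pi_Yq b <-> mod_ker_c g a b.
Proof.
split=> [h|h]; last exact: (elimT (@eqmodP _ (mod_ker_c_equiv D g) a b) h).
exact: (introT (@eqmodP _ (mod_ker_c_equiv D g) a b) h).
Qed.

Lemma Yrep_pi y : y \in Y -> Yrep (Ypi y) - y \in ker_c D g.
Proof.
move=> yY; have /pi_YqP : \pi_Yq (generic_quotient.repr (Ypi y)) = Ypi y by rewrite reprK.
by rewrite /mod_ker_c vsprojK.
Qed.

Lemma Ypi_Yrep w : Ypi (Yrep w) = w.
Proof. by rewrite /Ypi vsvalK reprK. Qed.

Lemma Ypi_eq y y' : y \in Y -> y' \in Y -> y - y' \in ker_c D g -> Ypi y = Ypi y'.
Proof. by move=> yY y'Y h; apply/pi_YqP; rewrite /mod_ker_c !vsprojK. Qed.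

Fact hY_linear : linear (@hY R F V n D g).
Proof. by move=> a v w; apply/rowP => k; rewrite !mxE linearP linearPr. Qed.

Fact ysec_linear : linear (@ysec R F V n D g).
Proof.
move=> a v w; rewrite /ysec -linearP /= scaler_sumr -big_split /=; congr (_ _).
by apply: eq_bigr => k _; rewrite !mxE scalerDl scalerA.
Qed.

HB.instance Definition _ := GRing.isLinear.Build F V 'rV[F]_i _ (@hY R F V n D g) hY_linear.
HB.instance Definition _ := GRing.isLinear.Build F 'rV[F]_i V _ (@ysec R F V n D g) ysec_linear.

Definition hYL : 'Hom(V, 'rV[F]_i) := linfun (@hY R F V n D g).
Definition ysecL : 'Hom('rV[F]_i, V) := linfun (@ysec R F V n D g).

Lemma hYLE v : hYL v = hY D g v. Proof. by rewrite lfunE. Qed.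
Lemma ysecLE v : ysecL v = ys v. Proof. by rewrite lfunE. Qed.

Lemma hY_mod y y' : y \in Y -> y - y' \in ker_c D g -> hY D g y = hY D g y'.
Proof.
move=> yY yy'; have dY : y - y' \in Y by move: yy'; rewrite mem_ker_c => /andP[].
apply/eqP; rewrite -subr_eq0 -!hYLE -linearB /= hYLE hY_ker //.
Qed.

Let hinv (v : 'rV[F]_i) : Yq := Ypi (ys v).

Let hYK v : hY D g (Yrep (hinv v)) = v.
Proof.
rewrite -[RHS](hY_ysec gS); apply: hY_mod; first exact: Yrep_Y.
exact/Yrep_pi/ysec_Y.
Qed.

Let hinvK w : hinv (hY D g (Yrep w)) = w.
Proof.
rewrite -[RHS]Ypi_Yrep; apply: Ypi_eq; [exact: ysec_Y|exact: Yrep_Y|].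
rewrite -hY_ker //; last by rewrite rpredB ?ysec_Y ?Yrep_Y.
by rewrite -hYLE linearB /= !hYLE hY_ysec // subrr.
Qed.

Lemma Yq_open (A : set Yq) : (forall y : V, y \in Y -> A (Ypi y) ->
  exists m : nat, forall y', y' \in Y -> vball m y' -> A (Ypi (y + y'))) -> open A.
Proof.
move=> h; have [c hc] := hom_bounded (linfun (@vsval F V Y)).
suff : open ((\pi_Yq : fdtop (subvs_of Y) -> Yq) @^-1` A) by [].
rewrite openE => y Ay; apply/nbhs_vball.
have [|m hm] := h (vsval (y : subvs_of Y)) (subvsP _); first by rewrite /Ypi vsvalK.
exists (m + c)%N => k hk; have := hm (vsval k) (subvsP k) _.
rewrite /Ypi linearD /= !vsvalK; apply.
have := hc _ _ hk; rewrite lfunE PoszD addrK; apply.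
Qed.

Let hinv_cont : continuous hinv.
Proof.
have [c hc] := row_linear_bounded (linfun (vsproj Y) \o ysecL)%VF.
have : continuous (fun v : 'rV[F]_i => vsproj Y (ys v) : fdtop (subvs_of Y)).
  move=> v A /nbhs_vball[m hm]; apply/nbhs_rball; exists (m + c)%N => k hk /=.
  rewrite -ysecLE linearD linearD /= !ysecLE; apply: hm.
  have := hc _ _ hk; rewrite PoszD addrK comp_lfunE ysecLE lfunE /=; exact.
move=> f_cont v.
apply: (@continuous_comp _ _ _ (fun v : 'rV[F]_i => vsproj Y (ys v) : fdtop (subvs_of Y))
  (\pi_Yq : fdtop (subvs_of Y) -> Yq) v (f_cont v)).
exact: pi_continuous.
Qed.

Definition Yq_const : R := (Num.sqrt (absv (detY D ((decomp D g).2 \o (decomp D g).1)%VF)))^-1.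

Let cg_ge0 : 0 <= Yq_const. Proof. by rewrite invr_ge0 sqrtr_ge0. Qed.

(** [mu_Yq] is only a set function, defined by direct images. It is recognised as a measure by
    writing it as the scaled pushforward of [muX] along the inverse of the coordinate map. *)
Let nu1 : {measure set (borel Yq) -> \bar R} :=
  measure_function_pushforward__canonical__measure_function_Measure (muX i)
    (borel_continuous hinv_cont).

Let nu := mscale (NngNum cg_ge0) nu1.

Let mu_YqE : mu_Yq muX (g := g) = nu.
Proof.
apply/funext => O; rewrite /mu_Yq /nu /mscale /nu1 /= /pushforward; congr (_ * muX i _)%E.
apply/seteqP; split=> [_ [w Ow <-]|v Ov] /=.
  by change (O (hinv (hY D g (Yrep w)))); rewrite hinvK.
by exists (hinv v) => //; exact: hYK.
Qed.

(** The representatives are left free, so that translated or rescaled ones may be used for the same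
    integral. *)
Lemma Yq_formula (G : V -> R[i]) (m : nat) (I : finType) (rho : I -> 'rV[F]_i) :
  (forall y k, y \in Y -> k \in ker_c D g -> G (y + k) = G y) ->
  rnice m (fun v => G (ys v)) -> transvR rho (- m%:Z) m ->
  @cintegral R _ (borel Yq) (mu_Yq muX (g := g)) (fun w : Yq => G (Yrep w)) =
  (\sum_a G (ys (rho a))) * (Yq_const * vol mu m ^+ i)%:C.
Proof.
move=> G_ker [G_inv G_supp] [rho_in rho_ex].
have GE w : G (Yrep w) = G (ys (hY D g (Yrep w))).
  rewrite -[Yrep w](subrKC (ys (hY D g (Yrep w)))) G_ker ?ysec_Y //.
    by rewrite addrC subrK.
  rewrite -hY_ker //; last by rewrite rpredB ?ysec_Y ?Yrep_Y.
  by rewrite -hYLE linearB /= !hYLE hY_ysec // subrr.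
rewrite mu_YqE.
pose A (a : I) : set Yq := [set w | rball m (hY D g (Yrep w) - rho a)].
have mle : - m%:Z <= m%:Z by lia.
have A_meas a : @measurable _ (borel Yq) (A a).
  apply: borel_open; apply: Yq_open => y yY; rewrite /A /=.
  rewrite (hY_mod (Yrep_Y _) (Yrep_pi yY)) => hy.
  have [c hc] := linear_row_bounded hYL; exists (m + c)%N => y' y'Y hy'.
  rewrite (hY_mod (Yrep_Y _) (Yrep_pi _)); last by rewrite rpredD.
  rewrite -hYLE linearD /= !hYLE addrAC; apply: rballD => //.
  by have := hc _ _ hy'; rewrite PoszD addrK hYLE.
apply: (@cintegral_step _ (borel Yq) R _ I A (Yq_const * vol mu m ^+ i) A_meas).
- move=> a b w /= ha hb.
  have [e [_ eU]] : exists! e, rball m (hY D g (Yrep w) - rho e).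
    apply: rho_ex; rewrite -[hY D g _](subrK (rho a)); apply: rballD => //.
    by apply: rball_sub ha.
  by rewrite -(eU a) // (eU b).
- move=> a; rewrite /nu /mscale /nu1 /= /pushforward EFinM; congr (_ * _)%E.
  rewrite -(muX_rball (rho a)); congr (muX i _).
  by apply/seteqP; split=> v; rewrite /A /= hYK.
- move=> a w /= hw; rewrite GE -[hY D g _](subrK (rho a)) addrC.
  by rewrite (G_inv _ _ hw).
- move=> w nA; rewrite GE; apply/eqP/negPn/negP => /G_supp.
  by move=> /rho_ex[a [ha _]]; exact: (nA a).
Qed.

End YqIntegral.

Local Open Scope classical_set_scope.

(** * Integrals over Y_g as finite sums: linearity, Galois action, translation, scaling *)

Section IntegralRules.
Variables (R : realType) (F : nonArchLocalFieldType R) (p : nat).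
Hypotheses (p_res : residue_char F p).
Variable lam : F -> R[i].
Hypotheses (lam_char : unitary_character lam) (lam_nontriv : exists t, lam t <> 1).
Variable mu : {measure set (borel F) -> \bar R}.
Hypotheses (mu_haar : haar_measure mu) (mu_dual : self_dual lam mu).
Variable muX : forall i : nat, {measure set (borel 'rV[F]_i) -> \bar R}.
Hypothesis muX_prod : forall i : nat, product_haar mu (muX i).
Variables (V : vectType F) (n : nat) (D : polarized_space V n).
Local Notation Y := (spY D).
Local Notation quad := (@quad_field R p).
Local Notation q := (@residue_order R F).

Lemma quad_sqrt_pow (r : R) (j : int) : r ^+ 2 = p%:R ^ j -> quad r%:C.
Proof.
move=> rE; have qf := quadf R p.
have sp : quad (sqrtC p%:R) by apply: field_gen_sub; left.
apply: (@sf_sqrt _ _ qf (sqrtC p%:R ^ j)); first exact: (sfZ qf).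
rewrite -rmorphXn /= rE exprnP exprz_exp mulrC -exprz_exp -exprnP sqrtCK.
by case: j {rE} => j; rewrite ?NegzE -?exprnN -?exprnP ?fmorphV rmorphXn /= rmorph_nat.
Qed.

Lemma quad_sqrt_q (r : R) (j : int) : r ^+ 2 = q%:R ^ j -> quad r%:C.
Proof.
have [f _ qE] := residue_order_pow p_res; rewrite qE natrX exprnP exprz_exp => rE.
exact: (quad_sqrt_pow rE).
Qed.

Lemma quad_vol m : quad (vol mu m)%:C.
Proof.
have [c hc] := vol_sq lam_char lam_nontriv mu_haar mu_dual.
apply: (@quad_sqrt_q _ (- m + - m + c)).
have q0 : q%:R != 0 :> R by rewrite pnatr_eq0 -lt0n ltnW ?residue_order_gt1.
by rewrite (volE mu_haar) exprMn hc expr2 !expfzDr.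
Qed.

Lemma quad_Yq_const g : quad (Yq_const D g)%:C.
Proof.
rewrite /Yq_const; set d := detY _ _.
(* A zero determinant would give the default 0^-1 = 0, which also lies in the field. *)
have [->|/absv_value[v vE]] := eqVneq d 0.
  by rewrite absv0 sqrtr0 invr0; exact: (sf0 (quadf R p)).
apply: (@quad_sqrt_q _ v); rewrite exprVn sqr_sqrtr ?absv_ge0 // vE.
by rewrite invr_expz opprK.
Qed.

Variable g : 'End(V).
Hypothesis gS : Sp D g.
Local Notation i := (dim_Yq D g).
Local Notation ys := (@ysec R F V n D g).
Implicit Types G : V -> R[i].

Definition Yint G : R[i] := @cintegral R _ (borel (Yq D g)) (@mu_Yq R F V n D muX g)
  (fun w : Yq D g => G (Yrep w)).

Definition Yinv G := forall y k, y \in Y -> k \in ker_c D g -> G (y + k) = G y.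

Definition Ynice (m : nat) G := Yinv G /\ rnice m (fun v => G (ys v)).

Lemma Ynice_le a b G : (a <= b)%N -> Ynice a G -> Ynice b G.
Proof. by move=> ab [hi hr]; split=> //; exact: rnice_le hr. Qed.

Let K m := (Yq_const D g * vol mu m ^+ i)%:C.

Let quadK m : quad (K m).
Proof.
have qf := quadf R p; rewrite /K rmorphM rmorphXn /=.
apply: (sfM qf); first exact: quad_Yq_const.
by apply: (sfX qf); exact: quad_vol.
Qed.

Lemma YintE m G (I : finType) (rho : I -> 'rV[F]_i) : Ynice m G -> transvR rho (- m%:Z) m ->
  Yint G = (\sum_a G (ys (rho a))) * K m.
Proof. by move=> [G_inv G_nice] rhoT; exact: (Yq_formula mu_haar muX_prod gS G_inv G_nice rhoT). Qed.

Lemma transv_sym (m : nat) : exists (I : finType) (rho : I -> 'rV[F]_i), transvR rho (- m%:Z) m.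
Proof.
have [I [rho rhoT]] := transvR_ex F i (- m%:Z) (m + m); exists I, rho.
by rewrite PoszD addKr in rhoT.
Qed.

Lemma Yint_eq G G' : (forall y, y \in Y -> G y = G' y) -> Yint G = Yint G'.
Proof. by move=> h; congr cintegral; apply/funext => w; apply: h; exact: Yrep_Y. Qed.

Lemma Yint_lin m a b G G' : Ynice m G -> Ynice m G' ->
  Yint (fun y => a * G y + b * G' y) = a * Yint G + b * Yint G'.
Proof.
move=> nG nG'; have [I [rho rhoT]] := transv_sym m.
have nS : Ynice m (fun y => a * G y + b * G' y).
  case: nG nG' => [G_inv [G_h G_s]] [G'_inv [G'_h G'_s]].
  split=> [y k yY kK|]; first by rewrite G_inv ?G'_inv.
  split=> [v h hh|v]; first by rewrite G_h ?G'_h.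
  have [G0|/G_s//] := eqVneq (G (ys v)) 0.
  have [G'0|/G'_s//] := eqVneq (G' (ys v)) 0.
  by rewrite G0 G'0 !mulr0 addr0 eqxx.
rewrite (YintE nS rhoT) (YintE nG rhoT) (YintE nG' rhoT).
by rewrite big_split /= -!mulr_sumr mulrDl !mulrA.
Qed.

Lemma Yint_in L m G : is_subfield L -> quad `<=` L -> Ynice m G ->
  (forall y, y \in Y -> L (G y)) -> L (Yint G).
Proof.
move=> Lf qL nG GL; have [I [rho rhoT]] := transv_sym m.
rewrite (YintE nG rhoT); apply: (sfM Lf); last exact: (qL _ (quadK m)).
by apply: (sf_sum Lf) => a _; apply: GL; exact: ysec_Y.
Qed.

(** Because s 0 = 0, the conjugate integrand has the same radii as [G]; one set of sample points
    computes both integrals, and the volume factor is fixed by s. *)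
Lemma Yint_hom L (s : R[i] -> R[i]) m G : is_subfield L -> quad `<=` L -> homon L s ->
  (forall x, quad x -> s x = x) -> Ynice m G ->
  (forall y, y \in Y -> L (G y)) -> Yint (fun y => s (G y)) = s (Yint G).
Proof.
move=> Lf qL sh s_fix nG GL; have [I [rho rhoT]] := transv_sym m.
have nS : Ynice m (fun y => s (G y)).
  case: nG => [G_inv [G_h G_s]]; split=> [y k yY kK|]; first by rewrite G_inv.
  split=> [v h hh|v]; first by rewrite G_h.
  by have [->|/G_s//] := eqVneq (G (ys v)) 0; rewrite (hom0 Lf sh) eqxx.
have GLr a : L (G (ys (rho a))) by apply: GL; exact: ysec_Y.
have LS : L (\sum_a G (ys (rho a))) by apply: (sf_sum Lf).
rewrite (YintE nS rhoT) (YintE nG rhoT) (homM sh LS (qL _ (quadK m))).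
by rewrite (hom_sum Lf sh) // (s_fix _ (quadK m)).
Qed.

Lemma Yinv_ys G v y : Yinv G -> y \in Y -> hY D g y = v -> G y = G (ys v).
Proof.
move=> G_inv yY <-.
rewrite -[y in LHS](subrKC (ys (hY D g y))) G_inv ?ysec_Y //.
rewrite -hY_ker //; last by rewrite rpredB ?ysec_Y.
by rewrite -hYLE linearB /= !hYLE hY_ysec // subrr.
Qed.

(** The radius is enlarged until the large ball contains the coordinates of y0; translation then
    carries one system of representatives to another. *)
Lemma Yint_shift m G y0 : Ynice m G -> y0 \in Y -> Yint (fun y => G (y + y0)) = Yint G.
Proof.
move=> nG y0Y; have [j hj] := rball_exP (hY D g y0).
have {}nG := Ynice_le (leq_maxl m j) nG; set M := maxn m j in nG.
have {}hj : rball (- M%:Z) (hY D g y0) by apply: rball_sub hj; rewrite /M; lia.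
have [I [rho rhoT]] := transv_sym M.
have [G_inv [G_h G_s]] := nG.
have shiftE v : G (ys v + y0) = G (ys (v + hY D g y0)).
  apply: Yinv_ys => //; first by rewrite rpredD ?ysec_Y.
  by rewrite -hYLE linearD /= !hYLE hY_ysec.
have nS : Ynice M (fun y => G (y + y0)).
  split=> [y k yY kK|]; first by rewrite addrAC G_inv // rpredD.
  split=> [v h hh|v]; first by rewrite (shiftE (v + h)) (shiftE v) addrAC (G_h _ _ hh).
  by rewrite shiftE => /G_s hv; rewrite -[v](addrK (hY D g y0)); apply: rballB.
rewrite (YintE nS rhoT) (YintE nG (transvR_shift rhoT hj)).
by congr (_ * _); apply: eq_bigr => a _; rewrite shiftE.
Qed.

Lemma Yint_scale m G t : Ynice m G -> absv t = 1 -> Yint (fun y => G (t *: y)) = Yint G.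
Proof.
move=> nG t1; have [I [rho rhoT]] := transv_sym m; have [G_inv [G_h G_s]] := nG.
have scaleE v : t *: ys v = ys (t *: v) by rewrite -!ysecLE linearZ.
have nS : Ynice m (fun y => G (t *: y)).
  split=> [y k yY kK|]; first by rewrite scalerDr G_inv ?memvZ.
  split=> [v h hh|v]; rewrite !scaleE; first by rewrite scalerDr G_h //; exact/rball_unit.
  by move=> /G_s /rball_unit; apply.
rewrite (YintE nS rhoT) (YintE nG (transvR_scale rhoT t1)).
by congr (_ * _); apply: eq_bigr => a _; rewrite scaleE.
Qed.

End IntegralRules.

Local Open Scope classical_set_scope.

(** * Weil operators *)

Section Weil.
Variables (R : realType) (F : nonArchLocalFieldType R) (p : nat).
Hypotheses (p_res : residue_char F p) (p_odd : p <> 2%N).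
Variable lam : F -> R[i].
Hypotheses (lam_char : unitary_character lam) (lam_nontriv : exists t, lam t <> 1).
Variable mu : {measure set (borel F) -> \bar R}.
Hypotheses (mu_haar : haar_measure mu) (mu_dual : self_dual lam mu).
Variable muX : forall i : nat, {measure set (borel 'rV[F]_i) -> \bar R}.
Hypothesis muX_prod : forall i : nat, product_haar mu (muX i).
Variables (V : vectType F) (n : nat) (D : polarized_space V n).
Local Notation X := (spX D).
Local Notation Y := (spY D).
Local Notation "<< v , w >>" := (sform D v w).
Local Notation x_ j := ((bX D)`_(nat_of_ord j)).
Local Notation y_ j := ((bY D)`_(nat_of_ord j)).

Lemma absv2 : absv (2%:R : F) = 1.
Proof.
apply/eqP; rewrite eq_le; apply/andP; split.
  by have := fball_int F 2; rewrite /fball /= oppr0 expr0z.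
rewrite leNgt; apply/negP => lt2; have [p_pr _] := p_res.
have : fball 1 ((2%:Z)%:~R : F) by rewrite -[X in fball X _](add0r 1) -fballS oppr0 expr0z.
move=> /(fball1_int p_res); rewrite dvdzE /= => /(dvdn_leq (isT : (0 < 2)%N)) le2.
by apply: p_odd; apply/eqP; rewrite eqn_leq le2 prime_gt1.
Qed.

Lemma two_neq0 : 2%:R != 0 :> F.
Proof. by rewrite -absv_eq0 absv2 oner_neq0. Qed.

Lemma fball_half m (z : F) : fball m (z / 2%:R) <-> fball m z.
Proof. by rewrite mulrC fball_unit // absvV absv2 invr1. Qed.

Variable g : 'End(V).
Hypothesis gS : Sp D g.
Local Notation i := (dim_Yq D g).
Local Notation ys := (@ysec R F V n D g).
Local Notation P := (blk_a D g).
Local Notation S := (blk_b D g).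
Local Notation Yint := (@Yint R F muX V n D g).
Local Notation Ynice := (@Ynice R F V n D g).
Implicit Types (Phi : V -> R[i]).

Lemma PS v : P v + S v = g v.
Proof. by rewrite !lfunE /= prXY. Qed.

Lemma P_X v : P v \in X. Proof. by rewrite lfunE prX_in. Qed.
Lemma S_Y v : S v \in Y. Proof. by rewrite lfunE prY_in. Qed.

Lemma gform v w : << P v, S w >> + << S v, P w >> = << v, w >>.
Proof.
rewrite -[RHS]gS -!PS linearDl !linearDr /=.
by rewrite [<<P v, P w>>]sformXX ?P_X // [<<S v, S w>>]sformYY ?S_Y // add0r addr0.
Qed.

Lemma YPS v w : v \in Y -> w \in Y -> <<P v, S w>> = <<P w, S v>>.
Proof.
move=> vY wY; have := gform v w; rewrite [RHS]sformYY // => /eqP.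
by rewrite addr_eq0 => /eqP->; rewrite -sformN.
Qed.

(** The argument of [lam] in the Weil integral: [P] is the block a on X and c on Y, while [S] is b
    on X and d on Y. *)
Definition wq (x y : V) : F := (<<P x, S x>> - 2%:R * <<S x, P y>> + <<P y, S y>>) / 2%:R.

Definition WG Phi (x y : V) : R[i] := lam (wq x y) * Phi (P x + P y).

Lemma weilE phi x : weil (D := D) lam muX g phi x = Yint (WG (phi \o vsproj X) (vsval x)).
Proof. by []. Qed.

Lemma wq_addy x y y' : y \in Y -> y' \in Y ->
  wq x (y + y') = wq x y + (<<P y', S y'>> / 2%:R - <<S x, P y'>> + <<P y, S y'>>).
Proof.
move=> yY y'Y; rewrite /wq !(linearD P) !(linearD S) /= !linearDr !linearDl /=.
by rewrite (YPS y'Y yY); field; exact: two_neq0.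
Qed.

Lemma wq_addx x h y : wq (x + h) y =
  wq x y + ((<<P x, S h>> + <<P h, S x>> + <<P h, S h>>) / 2%:R - <<S h, P y>>).
Proof.
rewrite /wq !(linearD P) !(linearD S) /= !linearDr !linearDl /=.
by field; exact: two_neq0.
Qed.

(** The increment is arranged so that x enters only through [P x + P y], which the support of Phi
    bounds, and through [<<x, y0>>], which oscillates for large x. *)
Lemma wq_osc x y y0 : y \in Y -> y0 \in Y ->
  wq x (y + y0) = wq x y + (<<P x + P y, S y0>> + <<P y0, S y0>> / 2%:R) - <<x, y0>>.
Proof.
move=> yY y0Y; rewrite wq_addy // -(gform x y0) linearDl /=.
by field; exact: two_neq0.
Qed.

Lemma wq_scale t x y : wq (t *: x) (t *: y) = t ^+ 2 * wq x y.
Proof.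
rewrite /wq !linearZ_LR /= ?(linearZl_LR, linearZr_LR) /=.
by field; exact: two_neq0.
Qed.

Lemma ker_cP k : k \in ker_c D g -> k \in Y /\ P k = 0.
Proof. by rewrite mem_ker_c lfunE /= => /andP[kY gkY]; split=> //; rewrite prX_Y. Qed.

Lemma WG_inv Phi x : Yinv D g (WG Phi x).
Proof.
move=> y k yY /ker_cP[kY Pk]; rewrite /WG wq_addy // (linearD P) /= Pk addr0.
by rewrite (YPS yY kY) Pk !linear0l linear0r mul0r subr0 !addr0.
Qed.

(** The support is bounded only inside X, since a function [phi \o vsproj X] is constant along the
    kernel of the projection. *)
Definition vnice (m : nat) Phi := (forall z h, vball m h -> Phi (z + h) = Phi z) /\
  (forall z, z \in X -> Phi z != 0 -> vball (- m%:Z) z).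

(** One loss of radius common to all the maps involved, which reduces the estimates that follow to
    linear arithmetic. *)
Definition weil_bound (c : nat) := [/\ forall m v, vball m v -> vball (m - c%:Z) (P v),
   forall m v, vball m v -> vball (m - c%:Z) (S v),
   forall a b v w, vball a v -> vball b w -> fball (a + b - c%:Z) <<v, w>>,
   forall m v, rball m v -> vball (m - c%:Z) (ys v) &
   (forall m v, vball m (P (ys v)) -> rball (m - c%:Z) v) /\
   (forall z, fball c z -> lam z = 1)].

Let PysL : 'Hom('rV[F]_i, V) := (P \o ysecL D g)%VF.

(** The block c is injective modulo ker c. Its bounded inverse lets the support of Phi control the
    integration variable. *)
Let Pys_inj : lker PysL == 0%VS.
Proof.
rewrite -subv0; apply/subvP => v; rewrite memv_ker memv0 !lfunE /= ysecLE => /eqP Pv0.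
have yv : ys v \in ker_c D g.
  rewrite mem_ker_c ysec_Y //= -(prXY D (g (ys v))).
  by have := Pv0; rewrite lfunE /= => ->; rewrite add0r prY_in.
by rewrite -[v](hY_ysec gS) hY_ker ?ysec_Y.
Qed.

Lemma weil_bound_ex : exists c, weil_bound c.
Proof.
have [c1 h1] := hom_bounded P; have [c2 h2] := hom_bounded S.
have [c3 h3] := form_bounded (sform D); have [c4 h4] := row_linear_bounded (ysecL D g).
have [c5 h5] := linear_row_bounded (PysL^-1)%VF.
have [c6 h6] := lam_trivial_nbhs lam_char.
exists (c1 + c2 + c3 + c4 + c5 + c6)%N; split.
- by move=> m v /h1; apply: vball_sub; lia.
- by move=> m v /h2; apply: vball_sub; lia.
- by move=> a b v w hv /(h3 _ _ _ _ hv); apply: fball_sub; lia.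
- by move=> m v /h4; rewrite ysecLE; apply: vball_sub; lia.
split=> [m v hv|z hz]; last by apply: h6; apply: fball_sub hz; lia.
have := h5 m (PysL v); rewrite lker0_lfunK // !lfunE /= ysecLE => /(_ hv).
by apply: rball_sub; lia.
Qed.

Lemma WG_nice m Phi (M : nat) : vnice m Phi -> exists m2 : nat, forall x,
  vball (- M%:Z) x -> Ynice m2 (WG Phi x).
Proof.
move=> [Phi_inv Phi_supp]; have [c [hP hS hB hy [hl hlam]]] := weil_bound_ex.
(* [m1] bounds the integration variable on the support; [m2] is then large enough for the phase
   increments to fall where [lam] is trivial. *)
pose m1 := (m + M + c + c)%N.
pose m2 := (m + M + m1 + 6 * c)%N.
exists m2 => x hx; split; first exact: WG_inv.
have hPx := hP _ _ hx; have hSx := hS _ _ hx.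
have supp v : Phi (P x + P (ys v)) != 0 -> rball (- m1%:Z) v.
  move=> h; have /Phi_supp/(_ h) hz : P x + P (ys v) \in X by rewrite rpredD ?P_X.
  have : vball (- (m + M + c)%N%:Z) (P (ys v)).
    rewrite -[P (ys v)](addKr (P x)); apply: vballD.
      by apply: vballN; apply: vball_sub hPx; lia.
    by apply: vball_sub hz; lia.
  by move=> /hl; apply: rball_sub; rewrite /m1; lia.
split=> [v h hh|v]; last first.
  move=> nz; apply: (@rball_sub _ _ _ _ (- m1%:Z)); first by rewrite /m2; lia.
  by apply: supp; apply: contra_neq nz => h0; rewrite /WG h0 mulr0.
have hyh := hy _ _ hh; have hPh := hP _ _ hyh; have hSh := hS _ _ hyh.
have ysD : ys (v + h) = ys v + ys h by rewrite -!ysecLE linearD.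
rewrite /WG ysD (linearD P) /= addrA Phi_inv; last by apply: vball_sub hPh; rewrite /m2; lia.
have [->|/supp hv] := eqVneq (Phi (P x + P (ys v))) 0; first by rewrite !mulr0.
have hyv := hy _ _ hv; have hPv := hP _ _ hyv.
rewrite wq_addy ?ysec_Y // (lamD lam_char) [X in _ * X * _ = _]hlam ?mulr1 //.
apply: fballD; first apply: fballB.
- by apply/fball_half; apply: fball_sub (hB _ _ _ _ hPh hSh); rewrite /m2 /m1; lia.
- by apply: fball_sub (hB _ _ _ _ hSx hPh); rewrite /m2 /m1; lia.
- by apply: fball_sub (hB _ _ _ _ hPv hSh); rewrite /m2 /m1; lia.
Qed.

Lemma WG_nice_at m Phi x : vnice m Phi -> exists m2, Ynice m2 (WG Phi x).
Proof.
move=> Phi_nice; have [M hM] := vball_exP x; have [m2 h] := WG_nice M Phi_nice.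
by exists m2; exact: h.
Qed.

Lemma X_bound : exists c : nat, forall (a : int) x, x \in X ->
  (forall j : 'I_n, fball a <<x, y_ j>>) -> vball (a - c%:Z) x.
Proof.
have /choice[f hf] (j : 'I_n) := vball_exP (x_ j).
exists (\max_j f j)%N => a x xX hx; rewrite (spX_expand xX).
move=> k; rewrite raddf_sum summxE; apply: fball_sum => j _; move: k.
by apply: vballZ => //; apply: vball_sub (hf j); rewrite lerN2 lez_nat; exact: leq_bigmax.
Qed.

(* Translating the integration variable by a small [y0] multiplies the integrand by
   [lam (- <<x, y0>>)], so the integral vanishes once this phase is nontrivial. *)
Lemma weil_support m Phi : vnice m Phi -> exists M : nat, forall x,
  x \in X -> Yint (WG Phi x) != 0 -> vball (- M%:Z) x.
Proof.
move=> Phi_nice; have [Phi_inv Phi_supp] := Phi_nice.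
have [c [hP hS hB hy [hl hlam]]] := weil_bound_ex.
have [cX hX] := X_bound; have [c0 hc0] := lam_conductor lam_char lam_nontriv.
have [w hw] := uniformizer_ex F.
have /choice[fy hfy] (j : 'I_n) := vball_exP (y_ j).
pose cy := (\max_j fy j)%N.
have hyj (j : 'I_n) : vball (- cy%:Z) (y_ j).
  apply: vball_sub (hfy j); rewrite lerN2 lez_nat; exact: leq_bigmax.
(* [M0] is the radius of admissible translations y0; scalars in [fball M1] bring every y_j into that
   radius. The conductor [c0] then bounds each [<<x, y_j>>], and [cX] converts this into a bound on
   x. *)
pose M0 := (m + 4 * c)%N; pose M1 := (M0 + cy)%N.
pose N : int := c0 - M1%:Z - cX%:Z.
exists (absz N) => x xX nz.
suff : vball N x by apply: vball_sub; lia.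
apply: hX => // j.
have phase y0 : y0 \in Y -> vball M0 y0 -> lam <<x, y0>> = 1.
  move=> y0Y hy0; have [m2 nG] := WG_nice_at x Phi_nice.
  have hP0 := hP _ _ hy0; have hS0 := hS _ _ hy0.
  have E : Yint (fun y => WG Phi x (y + y0)) = Yint (fun y => lam (- <<x, y0>>) * WG Phi x y + 0 * WG Phi x y).
    apply: Yint_eq => y yY; rewrite mul0r addr0 /WG (linearD P) /= addrA Phi_inv; last first.
      by apply: vball_sub hP0; rewrite /M0; lia.
    have [->|nz0] := eqVneq (Phi (P x + P y)) 0; first by rewrite !mulr0.
    have hz : vball (- m%:Z) (P x + P y) by apply: Phi_supp; rewrite // rpredD ?P_X.
    rewrite wq_osc // 2!(lamD lam_char) [X in _ * X * _ * _ = _]hlam ?mulr1.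
      by rewrite mulrA [lam (- _) * _]mulrC.
    apply: fballD.
      by apply: fball_sub (hB _ _ _ _ hz hS0); rewrite /M0; lia.
    by apply/fball_half; apply: fball_sub (hB _ _ _ _ hP0 hS0); rewrite /M0; lia.
  move: E; rewrite (Yint_shift mu_haar muX_prod gS nG y0Y) (Yint_lin mu_haar muX_prod gS _ _ nG nG).
  rewrite mul0r addr0 => /eqP; rewrite -subr_eq0 -{1}[Yint _]mul1r -mulrBl mulf_eq0 (negPf nz) orbF.
  by rewrite subr_eq0 (lamN lam_char) => /eqP/(congr1 GRing.inv); rewrite invrK invr1 => <-.
have : fball c0 (w ^ M1%:Z * <<x, y_ j>>).
  apply/hc0 => s hs.
  have -> : w ^ M1%:Z * <<x, y_ j>> * s = <<x, (w ^ M1%:Z * s) *: y_ j>>.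
    by rewrite linearZr_LR /= mulrAC.
  have hws : fball M1 (w ^ M1%:Z * s) by apply: fballM0 => //; rewrite /fball /= hw.
  apply: phase; first exact/memvZ/mem_y.
  by apply: vball_sub (vballZ hws (hyj j)); rewrite /M1; lia.
have hwi : fball (- M1%:Z) (w ^ (- M1%:Z)) by rewrite /fball /= hw.
move=> /(fballM hwi).
have w0 : w ^ M1%:Z != 0.
  rewrite -absv_eq0 hw expfz_eq0 pnatr_eq0 negb_and; apply/orP; right.
  by rewrite -lt0n ltnW ?residue_order_gt1.
by rewrite mulrA -[w ^ (- _)]invr_expz mulVf // mul1r; apply: fball_sub; lia.
Qed.

Lemma weil_nice m Phi : vnice m Phi -> exists m', vnice m' (fun x => Yint (WG Phi (prX D x))).
Proof.
move=> Phi_nice; have [Phi_inv Phi_supp] := Phi_nice.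
have [M hM] := weil_support Phi_nice.
have [c [hP hS hB hy [hl hlam]]] := weil_bound_ex.
have [cX hcX] := hom_bounded (prX D).
pose m3 := (m + M + M + 6 * c)%N.
have inv x h : x \in X -> h \in X -> vball m3 h -> vball (- M%:Z) x ->
    Yint (WG Phi (x + h)) = Yint (WG Phi x).
  move=> xX hX hh hx; apply: Yint_eq => y yY; rewrite /WG (linearD P) /= addrAC.
  have hPx := hP _ _ hx; have hSx := hS _ _ hx; have hPh := hP _ _ hh; have hSh := hS _ _ hh.
  rewrite Phi_inv; last by apply: vball_sub hPh; rewrite /m3; lia.
  have [->|nz0] := eqVneq (Phi (P x + P y)) 0; first by rewrite !mulr0.
  have hz : vball (- m%:Z) (P x + P y) by apply: Phi_supp; rewrite // rpredD ?P_X.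
  have hPy : vball (- (m + M + c)%N%:Z) (P y).
    rewrite -[P y](addKr (P x)); apply: vballD.
      by apply: vballN; apply: vball_sub hPx; lia.
    by apply: vball_sub hz; lia.
  rewrite wq_addx (lamD lam_char) [X in _ * X * _ = _]hlam ?mulr1 //; apply: fballB.
    apply/fball_half; apply: fballD; first apply: fballD.
    - by apply: fball_sub (hB _ _ _ _ hPx hSh); rewrite /m3; lia.
    - by apply: fball_sub (hB _ _ _ _ hPh hSx); rewrite /m3; lia.
    - by apply: fball_sub (hB _ _ _ _ hPh hSh); rewrite /m3; lia.
  by apply: fball_sub (hB _ _ _ _ hSh hPy); rewrite /m3; lia.
exists (m3 + cX)%N; split=> [z h hh|z zX]; last first.
  by rewrite prX_id // => /hM/(_ _) h; apply: vball_sub (h zX); rewrite /m3; lia.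
rewrite linearD /=; have {}hh : vball m3 (prX D h) by apply: vball_sub (hcX _ _ hh); lia.
have zX := prX_in D z; have hX := prX_in D h; move: (prX D z) (prX D h) zX hX hh => x k xX kX hk.
(* Outside the support ball both values vanish, because that ball is a group containing k. *)
have [hx|hx] := pselect (vball (- M%:Z) x); first exact: inv.
have nx : ~ vball (- M%:Z) (x + k).
  move=> H; apply: hx; rewrite -[x](addrK k); apply: vballB => //.
  by apply: vball_sub hk; lia.
have z1 : Yint (WG Phi x) = 0 by apply/eqP/negPn/negP => /hM; apply: contra_not hx; exact.
have z2 : Yint (WG Phi (x + k)) = 0.
  by apply/eqP/negPn/negP => /hM; apply: contra_not nx; apply; rewrite rpredD.
by rewrite z1 z2.
Qed.

End Weil.

Local Open Scope classical_set_scope.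

(** * Weil operators on S(X, E), Levi elements and Galois conjugation *)

Section Operators.
Variables (R : realType) (F : nonArchLocalFieldType R) (p : nat).
Hypotheses (p_res : residue_char F p) (p_odd : p <> 2%N).
Variable lam : F -> R[i].
Hypotheses (lam_char : unitary_character lam) (lam_nontriv : exists t, lam t <> 1).
Variable mu : {measure set (borel F) -> \bar R}.
Hypotheses (mu_haar : haar_measure mu) (mu_dual : self_dual lam mu).
Variable muX : forall i : nat, {measure set (borel 'rV[F]_i) -> \bar R}.
Hypothesis muX_prod : forall i : nat, product_haar mu (muX i).
Variables (V : vectType F) (n : nat) (D : polarized_space V n).
Local Notation X := (spX D).
Local Notation Y := (spY D).
Local Notation "<< v , w >>" := (sform D v w).
Local Notation quad := (@quad_field R p).
Local Notation E := (Efield lam).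
Local Notation fns := (subvs_of X -> R[i]).
Implicit Types phi psi : fns.

Lemma nice_vnice m phi : niceat m phi -> exists m', vnice D m' (phi \o vsproj X).
Proof.
move=> [inv supp]; have [c1 h1] := hom_bounded (linfun (vsproj X)).
have [c2 h2] := hom_bounded (linfun (@vsval F V X)).
exists (m + c1 + c2)%N; split=> [z h hh|z zX] /=.
  rewrite linearD /= inv //; have := h1 _ _ hh; rewrite lfunE /=.
  by apply: vball_sub; lia.
move=> /supp /h2; rewrite lfunE /= vsprojK //; apply: vball_sub; lia.
Qed.

Lemma vnice_nice m (Psi : V -> R[i]) : vnice D m Psi -> exists m', niceat m' (fun x : subvs_of X => Psi (vsval x)).
Proof.
move=> [inv supp]; have [c1 h1] := hom_bounded (linfun (@vsval F V X)).
have [c2 h2] := hom_bounded (linfun (vsproj X)).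
exists (m + c1 + c2)%N; split=> [z h hh|z] /=.
  rewrite inv //; have := h1 _ _ hh; rewrite lfunE /=.
  by apply: vball_sub; lia.
move=> /(supp _ (subvsP z)) /h2; rewrite lfunE /= vsvalK; apply: vball_sub; lia.
Qed.

Lemma SXEP phi : SXE (D := D) lam phi <-> (exists m, niceat m phi) /\ forall x, E (phi x).
Proof. exact: schwartz_nice. Qed.

Lemma niceat_scale m (t : F) phi : absv t = 1 -> niceat m phi -> niceat m (fun x => phi (t *: x)).
Proof.
move=> t1 [inv supp]; split=> [x h hh|x /supp]; last by move=> /vball_unit; apply.
by rewrite scalerDr inv //; exact/vball_unit.
Qed.

Lemma niceat_lin m a b phi psi : niceat m phi -> niceat m psi ->
  niceat m (fun x => a * phi x + b * psi x).
Proof.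
move=> [inv supp] [inv' supp']; split=> [x h hh|x]; first by rewrite inv ?inv'.
have [p0|/supp//] := eqVneq (phi x) 0; have [q0|/supp'//] := eqVneq (psi x) 0.
by rewrite p0 q0 !mulr0 addr0 eqxx.
Qed.

Lemma SXE_scale t phi : absv t = 1 -> SXE (D := D) lam phi -> SXE (D := D) lam (fun x => phi (t *: x)).
Proof.
move=> t1 /SXEP[[m hm] hE]; apply/SXEP; split=> // .
by exists m; exact: niceat_scale.
Qed.

Lemma SXE_lin a b phi psi : E a -> E b -> SXE (D := D) lam phi -> SXE (D := D) lam psi ->
  SXE (D := D) lam (fun x => a * phi x + b * psi x).
Proof.
have Lf := Ef lam.
move=> Ea Eb /SXEP[[m hm] hE] /SXEP[[m' hm'] hE']; apply/SXEP; split; last first.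
  by move=> x; apply: (sfD Lf); exact: (sfM Lf).
exists (maxn m m'); apply: niceat_lin; [exact: niceat_le (leq_maxl _ _) hm|exact: niceat_le (leq_maxr _ _) hm'].
Qed.

Section Levi.
Variable t : F.
Hypothesis t1 : absv t = 1.
Local Notation gt := (g_ D t).

Let t0 : t != 0. Proof. by rewrite -absv_eq0 t1 oner_neq0. Qed.

Lemma g_E v : gt v = t^-1 *: prX D v + t *: prY D v.
Proof. by rewrite /g_ !lfunE /= !lfunE. Qed.

Lemma g_Sp : Sp D gt.
Proof.
move=> v w; rewrite !g_E linearDl !linearDr /= !linearZl_LR !linearZr_LR /=.
rewrite [<<prX D v, prX D w>>]sformXX ?prX_in // [<<prY D v, prY D w>>]sformYY ?prY_in //.
rewrite -[in RHS](prXY D v) -[in RHS](prXY D w) linearDl !linearDr /=.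
rewrite [<<prX D v, prX D w>>]sformXX ?prX_in // [<<prY D v, prY D w>>]sformYY ?prY_in //.
by rewrite !mulr0 !add0r !addr0 mulVKf // mulKf.
Qed.

Lemma g_dim : dim_Yq D gt = 0%N.
Proof.
suff E0 : ker_c D gt = Y by rewrite /dim_Yq E0 subnn.
apply/eqP; rewrite eqEsubv capvSl; apply/subvP => y yY.
by rewrite mem_ker_c yY g_E prX_Y // scaler0 add0r memvZ ?prY_in.
Qed.

(** Here i = 0, so tau_i is the identity and any chosen pair has product g_t, whose determinant on Y
    is t^n, of absolute value 1. *)
Lemma g_const : Yq_const D gt = 1.
Proof.
have [_ _ [tau tau_is gtE]] := decompP g_Sp.
have tau1 : tau = \1%VF.
  by apply: (End_eq (D := D)) => j; have [hx hy] := tau_is j; rewrite lfunE /= ?hx ?hy g_dim.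
rewrite /Yq_const; have <- : gt = ((decomp D gt).2 \o (decomp D gt).1)%VF.
  by rewrite {1}gtE tau1 comp_lfun1l.
rewrite /detY (_ : \matrix_(i, j) _ = t%:M) ?det_scalar ?absvX ?t1 ?expr1n ?sqrtr1 ?invr1 //.
apply/matrixP => i j; rewrite !mxE g_E prX_Y ?mem_y // scaler0 add0r prY_id ?mem_y //.
rewrite linearZ /= (coord_free _ _ (basis_free (bY_basis D))).
by case: eqP => _; rewrite ?mulr1 ?mulr0.
Qed.

Lemma weil_levi phi : weil (D := D) lam muX gt phi = fun x => phi (t^-1 *: x).
Proof.
apply/funext => x; rewrite weilE.
rewrite (@Yint_eq _ _ _ _ _ _ _ _ (fun=> phi (t^-1 *: x))); last first.
  move=> y yY; rewrite /WG /wq !lfunE /= !g_E.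
  have xX := subvsP x.
  rewrite (prX_id xX) (prY_X xX) (prX_Y yY) (prY_id yY) !scaler0 !addr0 !add0r.
  rewrite (prX_id (memvZ _ xX)) (prY_X (memvZ _ xX)) (prX_Y (memvZ _ yY)) (prY_id (memvZ _ yY)).
  rewrite !linear0l !linear0r mulr0 subr0 addr0 mul0r (lam0 lam_char) mul1r addr0.
  by rewrite linearZ /= vsvalK.
(* Y_g is a point, so the integral is a sum with a single term. *)
have no_index (k : 'I_(dim_Yq D gt)) : False by case: k => k; rewrite g_dim ltn0.
rewrite (@YintE _ _ _ mu_haar _ muX_prod _ _ _ _ g_Sp 0 (fun=> phi (t^-1 *: x)) unit (fun=> 0)).
- by rewrite big_const card_unit /= addr0 g_const g_dim expr0 mulr1 mulr1.
- split=> [//|]; split=> [//|v _ k]; by case: (no_index k).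
- split=> [_ k|v _]; first by case: (no_index k).
  by exists tt; split=> [k|[]//]; case: (no_index k).
Qed.

End Levi.

(** This is rho_e + c rho_o: the identity on even functions and the scalar [c] on odd ones. *)
Definition Aop (c : R[i]) phi : fns := fun x => (1 + c) / 2%:R * phi x + (1 - c) / 2%:R * phi (- x).

Lemma A_opE eta u i phi : A_op lam muX eta u i phi = Aop (eta_prod eta u i) phi.
Proof.
have m1 : absv (- 1 : F) = 1 by rewrite absvN absv1.
apply/funext => x; rewrite /A_op /rho_e /rho_o (weil_levi m1) /Aop -/(eta_prod eta u i).
rewrite invrN invr1 scaleN1r; move: (eta_prod _ _ _) (phi x) (phi (- x)) => c a b.
by field.
Qed.

Lemma Aop_Aop c c' phi : Aop c (Aop c' phi) = Aop (c * c') phi.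
Proof. by apply/funext => x; rewrite /Aop opprK; field. Qed.

Lemma Aop1 phi : Aop 1 phi = phi.
Proof. by apply/funext => x; rewrite /Aop; field. Qed.

(** The parity operator is -1 on odd functions only; this absorbs the sign that appears when the
    index wraps around. *)
Lemma AopN c phi : Aop c (fun x => phi (- x)) = Aop (- c) phi.
Proof. by apply/funext => x; rewrite /Aop !opprK addrC. Qed.

Lemma Aop_scale c t phi : Aop c (fun x => phi (t *: x)) = fun x => Aop c phi (t *: x).
Proof. by apply/funext => x; rewrite /Aop scalerN. Qed.

Lemma SXE_neg phi : SXE (D := D) lam phi -> SXE (D := D) lam (fun x => phi (- x)).
Proof.
move=> hphi; have m1 : absv (- 1 : F) = 1 by rewrite absvN absv1.
have -> : (fun x => phi (- x)) = (fun x => phi (-1 *: x)).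
  by apply/funext => x; rewrite scaleN1r.
exact: SXE_scale.
Qed.

Lemma SXE_Aop c phi : E c -> SXE (D := D) lam phi -> SXE (D := D) lam (Aop c phi).
Proof.
have Lf := Ef lam; move=> Ec hphi; apply: SXE_lin => //; last exact: SXE_neg.
- apply: (sfM Lf); last exact: (sfV Lf (sf_nat Lf 2)).
  by apply: (sfD Lf) => //; exact: (sf1 Lf).
- apply: (sfM Lf); last exact: (sfV Lf (sf_nat Lf 2)).
  by apply: (sfB Lf) => //; exact: (sf1 Lf).
Qed.

Section WeilOperator.
Variable g : 'End(V).
Hypothesis gS : Sp D g.
Hypothesis quadE : quad `<=` E.
Local Notation W := (weil (D := D) lam muX g).
Local Notation P := (blk_a D g).
Local Notation Yint := (@Yint R F muX V n D g).

Lemma weil_SXE phi : SXE (D := D) lam phi -> SXE (D := D) lam (W phi).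
Proof.
move=> /SXEP[[m hm] hE]; have [m' vn] := nice_vnice hm; apply/SXEP; split.
  have [m2 /vnice_nice[m3 h3]] := weil_nice p_res p_odd lam_char lam_nontriv mu_haar muX_prod gS vn.
  exists m3; rewrite (_ : W phi = fun x => Yint (WG lam D g (phi \o vsproj X) (prX D (vsval x)))) //.
  by apply/funext => x; rewrite weilE prX_id ?subvsP.
move=> x; rewrite weilE.
have [m2 nG] := WG_nice_at p_res p_odd lam_char gS (vsval x) vn.
apply: (Yint_in p_res lam_char lam_nontriv mu_haar mu_dual muX_prod gS (Ef lam) quadE nG) => y yY.
by apply: (sfM (Ef lam)); [exact: E_lam|exact: hE].
Qed.

Lemma weil_lin a b phi psi : SXE (D := D) lam phi -> SXE (D := D) lam psi ->
  W (fun x => a * phi x + b * psi x) = fun x => a * W phi x + b * W psi x.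
Proof.
move=> /SXEP[[m hm] _] /SXEP[[k hk] _].
have [m' vm] := nice_vnice hm; have [k' vk] := nice_vnice hk.
apply/funext => x; rewrite !weilE.
have [m2 nG] := WG_nice_at p_res p_odd lam_char gS (vsval x) vm.
have [k2 nG'] := WG_nice_at p_res p_odd lam_char gS (vsval x) vk.
have nM := Ynice_le (leq_maxl m2 k2) nG; have nM' := Ynice_le (leq_maxr m2 k2) nG'.
rewrite -(Yint_lin mu_haar muX_prod gS a b nM nM').
by apply: Yint_eq => y yY; rewrite /WG /=; ring.
Qed.

(** The substitution y -> t y costs no factor as |t| = 1, and the quadratic phase at (x, t y) is t^2
    times the phase at (t^-1 x, y). *)
Lemma weil_scale t phi x : absv t = 1 -> SXE (D := D) lam phi ->
  W (fun z => phi (t^-1 *: z)) x =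
  Yint (fun y => lam (t ^+ 2 * wq D g (vsval (t^-1 *: x)) y) *
    phi (vsproj X (P (vsval (t^-1 *: x)) + P y))).
Proof.
move=> t1 /SXEP[[m hm] _]; have tV1 : absv t^-1 = 1 by rewrite absvV t1 invr1.
have t0 : t != 0 by rewrite -absv_eq0 t1 oner_neq0.
have [m' vm] := nice_vnice (niceat_scale tV1 hm).
have [m2 nG] := WG_nice_at p_res p_odd lam_char gS (vsval x) vm.
rewrite weilE -(Yint_scale mu_haar muX_prod gS nG t1); apply: Yint_eq => y yY.
rewrite /WG /= -(wq_scale p_res p_odd) linearZ /= scalerA mulfV // scale1r.
congr (_ * phi _); rewrite -linearZ; congr (vsproj _ _).
by rewrite scalerDr !linearZ /= scalerA mulfV // scale1r.
Qed.

(** The case t = -1, where t^2 = 1 leaves the phase unchanged. *)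
Lemma weil_neg phi x : SXE (D := D) lam phi -> W (fun z => phi (- z)) x = W phi (- x).
Proof.
move=> hphi; have m1 : absv (- 1 : F) = 1 by rewrite absvN absv1.
have := weil_scale x m1 hphi; rewrite invrN invr1 scaleN1r => E0.
rewrite weilE -[RHS](_ : Yint (fun y => lam ((-1) ^+ 2 * wq D g (vsval (- x)) y) *
  phi (vsproj X (P (vsval (- x)) + P y))) = _); last first.
  by rewrite weilE; apply: Yint_eq => y yY; rewrite sqrrN expr1n mul1r.
rewrite -E0 -weilE; congr weil; apply/funext => z; by rewrite scaleN1r.
Qed.

Lemma weil_Aop c phi : SXE (D := D) lam phi -> W (Aop c phi) = Aop c (W phi).
Proof.
move=> hphi; have m1 : absv (- 1 : F) = 1 by rewrite absvN absv1.
have hN := SXE_neg hphi.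
by rewrite /Aop (weil_lin _ _ hphi hN); apply/funext => x; rewrite weil_neg.
Qed.

Variables (s : R[i] -> R[i]) (t : F).
Hypotheses (s_gal : Hgal p lam s) (t1 : absv t = 1) (s_lam : forall z, s (lam z) = lam (t ^+ 2 * z)).

Let s' := 'pinv_id E s.

Lemma galK x : E x -> s (s' x) = x.
Proof.
case: s_gal => -[_ _ sj] _ _ _ _ Ex.
by refine (@surjpK _ _ id _ _ _ sj x _); exact: mem_set.
Qed.

Lemma galV_in x : E x -> E (s' x).
Proof.
case: s_gal => -[_ _ sj] _ _ _ _ Ex.
by refine (@surjpinv_image_sub _ _ id _ _ _ sj _ _); exists x.
Qed.

Lemma SXE_gal phi : SXE (D := D) lam phi -> SXE (D := D) lam (s \o phi).
Proof.
move=> /SXEP[[m [inv supp]] hE]; apply/SXEP; split=> [|x /=]; last by apply: (Hgal_in s_gal).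
exists m; split=> [x h hh|x] /=; first by rewrite inv.
by have [->|/supp//] := eqVneq (phi x) 0; rewrite (hom0 (Ef lam) (Hgal_hom s_gal)) eqxx.
Qed.

Lemma SXE_galV phi : SXE (D := D) lam phi -> SXE (D := D) lam (s' \o phi).
Proof.
move=> /SXEP[[m [inv supp]] hE]; apply/SXEP; split=> [|x /=]; last by exact: galV_in.
exists m; split=> [x h hh|x] /=; first by rewrite inv.
move=> nz; apply: supp; apply: contra_neq nz => p0.
have [[_ sinj _] _ _ _ _] := s_gal; have E0 := sf0 (Ef lam).
apply: sinj; rewrite ?inE //; first by rewrite p0; exact: galV_in.
by rewrite galK // p0 (hom0 (Ef lam) (Hgal_hom s_gal)).
Qed.

(** That is, D(sigma) . sigma-W(g) = W(g) . D(sigma). Conjugation first applies the inverse of s to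
    [phi], so under the sum s changes only the values of [lam]. *)
Lemma gal_conj_weil phi : SXE (D := D) lam phi ->
  (fun x => gal_conj (D := D) lam s W phi (t^-1 *: x)) = W (fun x => phi (t^-1 *: x)).
Proof.
move=> hphi; apply/funext => x; rewrite (weil_scale x t1 hphi) /gal_conj /= weilE.
have hV := SXE_galV hphi; have [[m hm] hE'] := (SXEP _).1 hV.
have [m' vm] := nice_vnice hm.
have [m2 nG] := WG_nice_at p_res p_odd lam_char gS (vsval (t^-1 *: x)) vm.
have /SXEP[_ hE] := hphi.
have sh := Hgal_hom s_gal.
rewrite -(Yint_hom p_res lam_char lam_nontriv mu_haar mu_dual muX_prod gS (Ef lam) quadE sh _ nG).
- apply: Yint_eq => y yY; rewrite /WG (homM sh) ?s_lam /=; last 2 first.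
  + exact: E_lam.
  + exact: hE'.
  by rewrite galK.
- by move=> z; exact: (Hgal_fix s_gal).
- by move=> y yY; apply: (sfM (Ef lam)); [exact: E_lam|exact: hE'].
Qed.

Lemma SXE_gal_conj phi : SXE (D := D) lam phi -> SXE (D := D) lam (gal_conj (D := D) lam s W phi).
Proof. by move=> hphi; apply/SXE_gal/weil_SXE/SXE_galV. Qed.

End WeilOperator.

End Operators.

Local Open Scope classical_set_scope.

(** * The cocycle *)

Section Cocycle.
Variables (R : realType) (F : nonArchLocalFieldType R) (p : nat).
Hypotheses (p_res : residue_char F p) (p_odd : p <> 2%N).
Variable lam : F -> R[i].
Hypotheses (lam_char : unitary_character lam) (lam_nontriv : exists t, lam t <> 1).
Variable mu : {measure set (borel F) -> \bar R}.
Hypotheses (mu_haar : haar_measure mu) (mu_dual : self_dual lam mu).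
Variable muX : forall i : nat, {measure set (borel 'rV[F]_i) -> \bar R}.
Hypothesis muX_prod : forall i : nat, product_haar mu (muX i).
Variables (V : vectType F) (n : nat) (D : polarized_space V n).
Variable eps : F.
Hypotheses (eps_unit : prime_units eps) (eps_root : p.-1.-primitive_root eps).
Variable eta : R[i] -> R[i].
Hypotheses (eta_gal : Hgal p lam eta) (eta_eps : restricts_to p lam eta (eps ^+ 2)).
Variable u : R[i].
Hypotheses (u_cyclo : cyclo_field p u)
  (u_norm : gal_norm (cyclo_field p) (quad_field p) u = - 1).
Local Notation quad := (@quad_field R p).
Local Notation E := (Efield lam).
Local Notation X := (spX D).
Local Notation fns := (subvs_of X -> R[i]).
Local Notation S := (SXE (D := D) lam).
Local Notation W := (weil (D := D) lam muX).
Local Notation del := (delta eps (D := D) lam muX p eta u).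
Local Notation conj := (gal_conj (D := D) lam).
Local Notation h := p.-1./2.
Local Notation c_ := (eta_prod eta u).
Local Notation spec := (index_spec p lam eps).
Implicit Types (phi psi : fns) (s : R[i] -> R[i]).

Lemma quad_E : quad `<=` E.
Proof.
have Lf := Ef lam.
have sE := @sqrt_p_E _ _ _ p_res p_odd _ lam_char lam_nontriv _ eps_unit eps_root.
apply: field_gen_min; first exact: Lf.
move=> z [->|->]; first exact: sE.
refine (sf_sqrt Lf (sfM Lf (@E_i _ _ lam) sE) _).
rewrite exprMn !sqrtCK.
have -> : ('i : R[i]) ^+ 2 = -1.
  by apply/eqP; rewrite eq_complex /= !(mulr0,mul0r,mulr1,mul1r,sub0r,add0r,addr0) oppr0 !eqxx.
by rewrite mulN1r.
Qed.

Lemma U1M (x y : F) : U1 p x -> U1 p y -> U1 p (x * y).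
Proof.
move=> /(U1_props p_res)[Zx nx _] /(U1_props p_res)[Zy ny _].
have [|z Zz ->] := Zp_near_int p_res (ZpM Zx Zy) (m := 1); last by exists z.
have -> : x * y - 1%:~R = (x - 1) * y + (y - 1) by rewrite mulrBl mul1r subrKA.
by apply: fballD => //; apply: (@fballM0 _ _ 1) => //; exact: Zp_fball0.
Qed.

Lemma eps_halfN1 : eps ^+ h = -1.
Proof.
have : (eps ^+ h) ^+ 2 == 1 by rewrite -exprM mulnC (eps_h p_res p_odd eps_root).
rewrite sqrf_eq1 => /orP[|/eqP//].
have h0 := h_gt0 p_res p_odd.
rewrite -(prim_order_dvd eps_root) => /(dvdn_leq h0).
by have := half_predK p_res p_odd; lia.
Qed.

Lemma eta_prod_E i : E (c_ i).
Proof.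
exact: (cyc_E p_res lam_char lam_nontriv (eta_prod_cyc p_res lam_char lam_nontriv eta_gal u_cyclo i)).
Qed.

Lemma absv_index s c : spec s c -> absv (eps ^+ c.1 * c.2) = 1.
Proof.
move=> [_ /(U1_props p_res)[_ _ a1] _].
by rewrite absvM absvX (absv_eps p_res eps_root) expr1n mul1r.
Qed.

Lemma index_lam s c z : spec s c -> s (lam z) = lam ((eps ^+ c.1 * c.2) ^+ 2 * z).
Proof. by move=> [_ _ ->]; rewrite exprMn -exprM mulnC. Qed.

Lemma deltaE s c phi : Hgal p lam s -> spec s c ->
  del s phi = Aop (c_ c.1) (fun x => phi ((eps ^+ c.1 * c.2)^-1 *: x)).
Proof.
move=> hs sc; rewrite /delta (gal_indexE p_res p_odd lam_char lam_nontriv eps_unit eps_root hs sc).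
have a1 := absv_index sc; case: c sc a1 => i x sc a1.
by rewrite (A_opE lam_char mu_haar muX_prod) (weil_levi lam_char mu_haar muX_prod a1).
Qed.

Lemma index_comp s t c d : Hgal p lam s -> spec s c -> spec t d ->
  spec (s \o t) ((if c.1 + d.1 <= h then c.1 + d.1 else c.1 + d.1 - h)%N, c.2 * d.2).
Proof.
move=> hs [/andP[c1 ch] Uc sE] [/andP[d1 dh] Ud tE].
split=> /=; first by case: ifP => H; apply/andP; split=> //; lia.
  exact: U1M.
move=> z; rewrite tE sE mulrA; congr (lam (_ * z)).
have -> : eps ^+ (2 * c.1) * c.2 ^+ 2 * (eps ^+ (2 * d.1) * d.2 ^+ 2)
  = eps ^+ (2 * (c.1 + d.1)) * (c.2 * d.2) ^+ 2 by rewrite mulnDr exprD exprMn mulrACA.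
case: ifP => H //; congr (_ * _).
have -> : (2 * (c.1 + d.1) = 2 * h + 2 * (c.1 + d.1 - h))%N by lia.
by rewrite exprD (eps_h p_res p_odd eps_root) mul1r.
Qed.

Lemma delta_SXE s phi : Hgal p lam s -> S phi -> S (del s phi).
Proof.
move=> hs hphi; have sc := gal_indexP p_res p_odd lam_char lam_nontriv eps_unit eps_root hs.
rewrite (deltaE _ hs sc); apply: SXE_Aop; first exact: eta_prod_E.
by apply: SXE_scale => //; rewrite absvV (absv_index sc) invr1.
Qed.

Lemma delta_bij s : Hgal p lam s -> set_bij S S (del s).
Proof.
move=> hs; have sc := gal_indexP p_res p_odd lam_char lam_nontriv eps_unit eps_root hs.
set c := gal_index _ _ _ _ in sc.
have cn0 := eta_prod_neq0 p_res p_odd lam_char lam_nontriv eps_unit eps_root eta_gal eta_eps u_cyclo u_norm c.1.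
set t := eps ^+ c.1 * c.2; have t1 : absv t = 1 := absv_index sc.
have t0 : t != 0 by rewrite -absv_eq0 t1 oner_neq0.
pose inv psi : fns := fun x => Aop (c_ c.1)^-1 psi (t *: x).
have delK phi : inv (del s phi) = phi.
  apply/funext => x; rewrite /inv (deltaE _ hs sc) Aop_Aop mulVf // Aop1.
  by rewrite scalerA mulVf // scale1r.
split=> [phi|phi psi _ _ dE|psi hpsi]; first exact: delta_SXE.
  exact: etrans (esym (delK phi)) (etrans (congr1 inv dE) (delK psi)).
exists (inv psi).
  apply: SXE_scale => //; apply: SXE_Aop => //.
  exact: (sfV (Ef lam) (eta_prod_E _)).
rewrite (deltaE _ hs sc) -/t.
rewrite (_ : (fun x => _) = Aop (c_ c.1)^-1 psi); first by rewrite Aop_Aop mulfV // Aop1.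
by apply/funext => x; rewrite /inv scalerA mulfV // scale1r.
Qed.

Lemma delta_GL s : Hgal p lam s -> in_GL lam (del s).
Proof.
move=> hs; have sc := gal_indexP p_res p_odd lam_char lam_nontriv eps_unit eps_root hs.
split=> [|phi psi _ _|a phi _ _]; first exact: delta_bij.
- by rewrite !(deltaE _ hs sc) /Aop; apply/funext => x; ring.
- by rewrite !(deltaE _ hs sc) /Aop; apply/funext => x; ring.
Qed.

Lemma gal_conj_Aop s c phi : Hgal p lam s -> E c -> S phi ->
  conj s (Aop c) phi = Aop (s c) phi.
Proof.
move=> hs Ec /SXEP[_ hE]; apply/funext => x; rewrite /gal_conj /Aop /=.
have Lf := Ef lam; have sh := Hgal_hom hs.
have Ey y := galV_in hs (hE y); have E1 := sf1 Lf; have E2 := sf_nat Lf 2.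
have E2V := sfV Lf E2.
have s2 : s 2%:R = 2%:R.
  by rewrite (homD sh E1 E1) (hom1 sh).
rewrite (homD sh); last 2 first.
- by apply: (sfM Lf) => //; apply: (sfM Lf) => //; exact: (sfD Lf).
- by apply: (sfM Lf) => //; apply: (sfM Lf) => //; exact: (sfB Lf).
have Ep := sfD Lf E1 Ec; have Em := sfB Lf E1 Ec.
rewrite (homM sh (sfM Lf Ep E2V) (Ey _)) (homM sh (sfM Lf Em E2V) (Ey _)).
rewrite (homM sh Ep E2V) (homM sh Em E2V) (homV Lf sh E2) s2.
by rewrite (homD sh E1 Ec) (homB Lf sh E1 Ec) (hom1 sh) !(galK hs).
Qed.

Lemma delta_cocycle s t phi : Hgal p lam s -> Hgal p lam t -> S phi ->
  del (s \o t) phi = del s (conj s (del t) phi).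
Proof.
move=> hs ht hphi.
have sc := gal_indexP p_res p_odd lam_char lam_nontriv eps_unit eps_root hs.
have td := gal_indexP p_res p_odd lam_char lam_nontriv eps_unit eps_root ht.
set c := gal_index _ _ _ s in sc; set d := gal_index _ _ _ t in td.
rewrite (deltaE _ (Hgal_comp hs ht) (index_comp hs sc td)) /=.
have d1 : absv (eps ^+ d.1 * d.2)^-1 = 1 by rewrite absvV (absv_index td) invr1.
have -> : conj s (del t) phi = Aop (s (c_ d.1)) (fun x => phi ((eps ^+ d.1 * d.2)^-1 *: x)).
  rewrite -(gal_conj_Aop hs (eta_prod_E _) (SXE_scale d1 hphi)).
  by rewrite /gal_conj (deltaE _ ht td).
rewrite (deltaE _ hs sc) -Aop_scale Aop_Aop.
(* The scalar lies in the cyclotomic field, where s acts as a power of eta; the relation for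
   products of conjugates of [u] then applies. *)
rewrite (sigma_eta p_res lam_char lam_nontriv eps_unit eta_gal eta_eps hs sc (eta_prod_cyc p_res lam_char lam_nontriv eta_gal u_cyclo _)).
rewrite -(eta_prodD p_res lam_char lam_nontriv eta_gal u_cyclo).
have -> : (fun x => phi ((eps ^+ d.1 * d.2)^-1 *: ((eps ^+ c.1 * c.2)^-1 *: x)))
  = (fun x => phi ((eps ^+ (c.1 + d.1) * (c.2 * d.2))^-1 *: x)).
  apply/funext => x; rewrite scalerA -invfM.
  by rewrite mulrACA -exprD [(d.1 + _)%N]addnC [d.2 * _]mulrC.
case: ifP => // /negbT; rewrite -ltnNge => lt_h; set k := (c.1 + d.1 - h)%N.
have -> : (c.1 + d.1 = h + k)%N by rewrite /k; lia.
rewrite (eta_prodD p_res lam_char lam_nontriv eta_gal u_cyclo).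
rewrite (eta_prod_h p_res p_odd lam_char lam_nontriv eps_unit eps_root eta_gal eta_eps u_cyclo u_norm).
rewrite (iter_eta_h p_res p_odd lam_char lam_nontriv eps_unit eps_root eta_gal eta_eps (eta_prod_cyc p_res lam_char lam_nontriv eta_gal u_cyclo _)).
rewrite exprD eps_halfN1 !mulN1r mulNr invrN -AopN.
by congr (Aop _ _); apply/funext => x; rewrite scalerN scaleNr opprK.
Qed.

Lemma delta_intertwines g s phi : Sp D g -> Hgal p lam s -> S phi ->
  conj s (W g) phi = op_inv lam (del s) (W g (del s phi)).
Proof.
move=> gS hs hphi.
have sc := gal_indexP p_res p_odd lam_char lam_nontriv eps_unit eps_root hs.
have t1 := absv_index sc; set c := gal_index _ _ _ s in sc t1.
have tV1 : absv (eps ^+ c.1 * c.2)^-1 = 1 by rewrite absvV t1 invr1.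
have s_lam z := index_lam z sc.
(* [op_inv] inverts only on S(X, E), so the conjugate must be known to lie there before delta(sigma)
   can be cancelled. *)
have hpsi := SXE_gal_conj p_res p_odd lam_char lam_nontriv mu_haar mu_dual muX_prod gS quad_E hs hphi.
have <- : del s (conj s (W g) phi) = W g (del s phi).
  rewrite !(deltaE _ hs sc).
  rewrite (gal_conj_weil p_res p_odd lam_char lam_nontriv mu_haar mu_dual muX_prod gS quad_E hs t1 s_lam hphi).
  by rewrite (weil_Aop p_res p_odd lam_char mu_haar muX_prod gS _ (SXE_scale tV1 hphi)).
have [_ inj _] := delta_bij hs.
by rewrite /op_inv (pinvKV _ inj) //; exact: mem_set.
Qed.

End Cocycle.

Theorem mainTheorem2 (R : realType) (F : nonArchLocalFieldType R) (p : nat)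
  (p_res : residue_char F p) (p_odd : p <> 2%N)
  (lam : F -> R[i]) (lam_char : unitary_character lam)
  (lam_nontriv : exists t, lam t <> 1)
  (mu : {measure set (borel F) -> \bar R})
  (mu_haar : haar_measure mu) (mu_dual : self_dual lam mu)
  (muX : forall i : nat, {measure set (borel 'rV[F]_i) -> \bar R})
  (muX_prod : forall i : nat, product_haar mu (muX i))
  (V : vectType F) (n : nat) (D : polarized_space V n)
  (eps : F) (eps_unit : prime_units eps)
  (eps_root : p.-1.-primitive_root eps)
  (eta : R[i] -> R[i]) (eta_gal : Hgal p lam eta)
  (eta_eps : restricts_to p lam eta (eps ^+ 2))
  (u : R[i]) (u_cyclo : cyclo_field p u)
  (u_norm : gal_norm (cyclo_field p) (quad_field p) u = - 1) :
  let W := weil (D := D) lam muX in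
  let del := delta eps (D := D) lam muX p eta u in
  let conj := gal_conj (D := D) lam in
  [/\ forall sigma, Hgal p lam sigma -> in_GL lam (del sigma),
      forall sigma tau, Hgal p lam sigma -> Hgal p lam tau ->
        forall phi, SXE (D := D) lam phi ->
          del (sigma \o tau) phi = del sigma (conj sigma (del tau) phi) &
      forall g sigma, Sp D g -> Hgal p lam sigma ->
        forall phi, SXE (D := D) lam phi ->
          conj sigma (W g) phi = op_inv lam (del sigma) (W g (del sigma phi))].
Proof.
split=> [s hs|s t hs ht phi|g s gS hs phi].
- exact: (delta_GL p_res p_odd lam_char lam_nontriv mu_haar muX_prod D eps_unit eps_root eta_gal eta_eps u_cyclo u_norm hs).
- exact: (delta_cocycle p_res p_odd lam_char lam_nontriv mu_haar muX_prod eps_unit eps_root eta_gal eta_eps u_cyclo u_norm).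
- exact: (delta_intertwines p_res p_odd lam_char lam_nontriv mu_haar mu_dual muX_prod eps_unit eps_root eta_gal eta_eps u_cyclo u_norm).
Qed.
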